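(* Let $p$ be an odd prime, let $n\ge 1$ be an integer with $p\nmid n$, and let $\lambda\in\mathbb{F}_p^{*}$. Let $N_p(\lambda)$ be the number of points in $\mathbb{P}^{n-1}(\mathbb{F}_p)$ on the hypersurface $$x_1^n+x_2^n+\dots+x_n^n-n\lambda\,x_1x_2\cdots x_n=0.$$ Let $d:=\gcd(p-1,n)$, and let $W$, $\sim$, $A_w$, $B_w$ and $s=s(w)$ be as defined in the context. Then $$N_p(\lambda)=\frac{p^{n-1}-1}{p-1}+(-1)^n\sum_{[w^{\ast}]\in W/\sim}(-p)^{\frac1d\sum_{i=1}^n w_i}\;\prod_{i=1}^n\Gamma_p\!\left(\tfrac{w_i}{d}\right)\;{}_{s}G_{s}\biggl[\begin{array}{c}A_w\\ B_w\end{array}\Big|\;\lambda^n\;\biggr]_p ,$$ where the sum runs over the equivalence classes of $W/\sim$, and in the term for each class $w=(w_1,\dots,w_n)$ denotes a chosen representative $w^{\ast}$ of that class having $w_i=0$ for at least one $i$ (any such choice of representatives may be used).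
   Context: Notation. $\mathbb{Z}_p$ is the ring of $p$-adic integers. For $x\in\mathbb{Q}$, $\lfloor x\rfloor$ is the greatest integer $\le x$ and $\langle x\rangle:=x-\lfloor x\rfloor$. $\Gamma_p:\mathbb{Z}_p\to\mathbb{Z}_p^{*}$ is Morita's $p$-adic gamma function: $\Gamma_p(0)=1$, $\Gamma_p(m)=(-1)^m\prod_{0<j<m,\ p\nmid j}j$ for positive integers $m$, extended continuously to $\mathbb{Z}_p$. $\omega:\mathbb{F}_p^{*}\to\mathbb{Z}_p^{*}$ is the Teichmüller character (the multiplicative character with $\omega(x)\equiv x \pmod p$), and $\overline{\omega}=\omega^{-1}$; multiplicative characters (including the trivial one) are extended to $\mathbb{F}_p$ by the value $0$ at $0$. The $p$-adic hypergeometric function. For an odd prime $p$, $x\in\mathbb{F}_p$, an integer $m\ge 0$, and $a_1,\dots,a_m,b_1,\dots,b_m\in\mathbb{Q}\cap\mathbb{Z}_p$, $${}_{m}G_{m}\biggl[\begin{array}{cccc}a_1,&a_2,&\dots,&a_m\\ b_1,&b_2,&\dots,&b_m\end{array}\Big|\;x\;\biggr]_p:=\frac{-1}{p-1}\sum_{j=0}^{p-2}(-1)^{jm}\,\overline{\omega}^{\,j}(x)\prod_{i=1}^m\frac{\Gamma_p\bigl(\langle a_i-\frac{j}{p-1}\rangle\bigr)}{\Gamma_p(\langle a_i\rangle)}\,\frac{\Gamma_p\bigl(\langle -b_i+\frac{j}{p-1}\rangle\bigr)}{\Gamma_p(\langle -b_i\rangle)}\,(-p)^{-\lfloor\langle a_i\rangle-\frac{j}{p-1}\rfloor-\lfloor\langle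 -b_i\rangle+\frac{j}{p-1}\rfloor},$$ with the empty product equal to $1$ when $m=0$. The value does not depend on the order of the $a_i$ or of the $b_i$. The index set. With $d=\gcd(p-1,n)$, $$W:=\Bigl\{w=(w_1,\dots,w_n)\in\mathbb{Z}^n:\ 0\le w_i<d,\ \sum_{i=1}^n w_i\equiv 0 \pmod d\Bigr\},$$ and $w\sim w'$ if $w-w'$ is, modulo $d$, an integer multiple of $(1,1,\dots,1)$. $[w]$ denotes the class of $w$. Every class contains a representative with some $w_i=0$; writing $[w^{\ast}]$ indicates that such a representative has been chosen. The parameter lists. For $w\in W$ and $0\le k\le d-1$ let $n_k:=|\{i: 1\le i\le n,\ w_i=k\}|$. Let $S_w:=\{k: 0\le k\le d-1,\ n_k=0\}$ and let $S_w^c$ be its complement in $\{0,1,\dots,d-1\}$. $A_w$ is the list consisting of the numbers $\frac{d-k}{d}$ for $k\in S_w$, together with the numbers $\frac hn$ for $0\le h\le n-1$ with $h\not\equiv 0 \pmod{\frac nd}$. $B_w$ is the list in which, for each $k\in S_w^c$, the number $\frac{d-k}{d}$ is repeated $n_k-1$ times. Lists are counted with multiplicity; both $A_w$ and $B_w$ contain $s:=n-|S_w^c|$ numbers. *)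

(* Defs.v *)
From HB Require Import structures.
From mathcomp Require Import all_boot all_order all_algebra.
From mathcomp Require Import boolp classical_sets.
Set Implicit Arguments.
Unset Strict Implicit.
Unset Printing Implicit Defensive.
Import Order.TTheory GRing.Theory Num.Theory.
Local Open Scope ring_scope.

(* Z_p is the inverse limit of the Z/p^k: [res x k] is the representative in
   [0, p^k) of x modulo p^k (compatibility already forces res x k < p^k).  The
   type depends on the proof that p is prime, so that it is always an integral
   domain. *)
Record padic_int (p : nat) (p_pr : prime p) := PadicInt {
  res : nat -> nat;
  resP : forall k, (res k.+1 %% p ^ k = res k)%N }.

Section PadicInt.
Variables (p : nat) (p_pr : prime p).
Local Notation Zp := (padic_int p_pr).
Implicit Types (x y z : Zp) (k l : nat).

HB.instance Definition _ := gen_eqMixin Zp.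
HB.instance Definition _ := gen_choiceMixin Zp.

Lemma padic_eq x y : res x =1 res y -> x = y.
Proof.
case: x y => [u hu] [v hv] /= /funext euv.
by rewrite euv in hu *; congr PadicInt; exact: Prop_irrelevance.
Qed.

Lemma pX_gt0 k : (0 < p ^ k)%N.
Proof. by rewrite expn_gt0 prime_gt0. Qed.

Lemma res_mod x k : (res x k %% p ^ k = res x k)%N.
Proof. by rewrite -(resP x k) modn_mod. Qed.

Lemma res_lt x k : (res x k < p ^ k)%N.
Proof. by rewrite -res_mod ltn_mod pX_gt0. Qed.

Lemma res_modD x k l : (res x (k + l) %% p ^ k = res x k)%N.
Proof.
elim: l => [|l IH]; first by rewrite addn0 res_mod.
rewrite addnS -IH -[in RHS](resP x (k + l)) modn_dvdm //.
by rewrite dvdn_exp2l // leq_addr.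
Qed.

Lemma mod_compat (u : nat -> nat) :
  (forall k, u k.+1 = u k %[mod p ^ k]) ->
  forall k, ((u k.+1 %% p ^ k.+1) %% p ^ k = u k %% p ^ k)%N.
Proof. by move=> hu k; rewrite modn_dvdm ?dvdn_exp2l. Qed.

(* the p-adic integer congruent to u k modulo p^k for every k *)
Definition padic_of_compat (u : nat -> nat)
    (hu : forall k, u k.+1 = u k %[mod p ^ k]) : Zp :=
  @PadicInt p p_pr (fun k => u k %% p ^ k)%N (mod_compat hu).

Fact add_compat x y k :
  (res x k.+1 + res y k.+1 = res x k + res y k %[mod p ^ k])%N.
Proof. by rewrite -modnDm !resP. Qed.

Fact mul_compat x y k :
  (res x k.+1 * res y k.+1 = res x k * res y k %[mod p ^ k])%N.
Proof. by rewrite -modnMm !resP. Qed.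

Fact opp_compat x k :
  (p ^ k.+1 - res x k.+1 = p ^ k - res x k %[mod p ^ k])%N.
Proof.
apply/eqP; rewrite -(eqn_modDr (res x k.+1)) subnK ?(ltnW (res_lt _ _)) //.
rewrite -[X in _ == X]modnDmr resP subnK ?(ltnW (res_lt _ _)) //.
by rewrite expnS modnMl modnn.
Qed.

Fact nat_compat n k : n = n %[mod p ^ k]. Proof. by []. Qed.

Definition padic_add x y := padic_of_compat (add_compat x y).
Definition padic_mul x y := padic_of_compat (mul_compat x y).
Definition padic_opp x := padic_of_compat (opp_compat x).
Definition padic_nat n := padic_of_compat (nat_compat n).

Fact padic_addA : associative padic_add.
Proof. by move=> x y z; apply: padic_eq => k /=; rewrite modnDmr modnDml addnA. Qed.
Fact padic_addC : commutative padic_add.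
Proof. by move=> x y; apply: padic_eq => k /=; rewrite addnC. Qed.
Fact padic_add0 : left_id (padic_nat 0) padic_add.
Proof. by move=> x; apply: padic_eq => k /=; rewrite mod0n add0n res_mod. Qed.
Fact padic_addN : left_inverse (padic_nat 0) padic_opp padic_add.
Proof.
move=> x; apply: padic_eq => k /=.
by rewrite modnDml subnK ?(ltnW (res_lt _ _)) // modnn mod0n.
Qed.

HB.instance Definition _ :=
  GRing.isZmodule.Build Zp padic_addA padic_addC padic_add0 padic_addN.

Fact padic_mulA : associative padic_mul.
Proof. by move=> x y z; apply: padic_eq => k /=; rewrite modnMmr modnMml mulnA. Qed.
Fact padic_mulC : commutative padic_mul.
Proof. by move=> x y; apply: padic_eq => k /=; rewrite mulnC. Qed.
Fact padic_mul1 : left_id (padic_nat 1) padic_mul.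
Proof. by move=> x; apply: padic_eq => k /=; rewrite modnMml mul1n res_mod. Qed.
Fact padic_mulDl : left_distributive padic_mul padic_add.
Proof.
by move=> x y z; apply: padic_eq => k /=; rewrite modnMml modnDm mulnDl.
Qed.
Fact padic_1neq0 : padic_nat 1 != 0.
Proof.
apply/eqP => /(congr1 (fun x => res x 1)) /=.
by rewrite expn1 mod0n modn_small // prime_gt1.
Qed.

HB.instance Definition _ := GRing.Zmodule_isComNzRing.Build Zp
  padic_mulA padic_mulC padic_mul1 padic_mulDl padic_1neq0.

Definition padic_unit : {pred Zp} := fun x => `[< exists y, y * x = 1 >].
Definition padic_inv x : Zp :=
  if pselect (exists y, y * x = 1) is left h then sval (cid h) else x.

Fact padic_mulVx : {in padic_unit, left_inverse 1 padic_inv *%R}.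
Proof.
by move=> x /asboolP xu; rewrite /padic_inv; case: pselect => // h; case: cid.
Qed.
Fact padic_unitPl x y : y * x = 1 -> padic_unit x.
Proof. by move=> h; apply/asboolP; exists y. Qed.
Fact padic_invr_out : {in [predC padic_unit], padic_inv =1 id}.
Proof.
by move=> x /asboolPn nxu; rewrite /padic_inv; case: pselect.
Qed.

HB.instance Definition _ := GRing.ComNzRing_hasMulInverse.Build Zp
  padic_mulVx padic_unitPl padic_invr_out.

Lemma res0 k : res (0 : Zp) k = 0%N.
Proof. by rewrite /= mod0n. Qed.

Lemma resM x y k : res (x * y) k = (res x k * res y k %% p ^ k)%N.
Proof. by []. Qed.

Lemma resD x y k : res (x + y) k = ((res x k + res y k) %% p ^ k)%N.
Proof. by []. Qed.

Fact padic_idomain : GRing.integral_domain_axiom Zp.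
Proof.
have nz x : x != 0 -> exists k, ~~ (p ^ k %| res x k)%N.
  move=> x0; apply: contrapT => h; case/eqP: x0; apply: padic_eq => k.
  rewrite res0; apply/eqP; rewrite -res_mod; apply: contrapT => /negP hk.
  by apply: h; exists k.
move=> x y xy0; apply: contrapT => /negP; rewrite negb_or => /andP[].
move=> /nz[k hk] /nz[l hl].
have /eqP : res (x * y) (k + l) = 0%N by rewrite xy0 res0.
rewrite resM -/(dvdn _ _).
have hk' : ~~ (p ^ k %| res x (k + l))%N by rewrite /dvdn res_modD -res_mod.
have hl' : ~~ (p ^ l %| res y (k + l))%N.
  by rewrite /dvdn addnC res_modD -res_mod.
have x_gt0 : (0 < res x (k + l))%N by case: (res x _) hk' => //; rewrite dvdn0.
have y_gt0 : (0 < res y (k + l))%N by case: (res y _) hl' => //; rewrite dvdn0.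
rewrite pfactor_dvdn // in hk'; rewrite pfactor_dvdn // in hl'.
rewrite pfactor_dvdn ?muln_gt0 ?x_gt0 // lognM //.
rewrite -!ltnNge in hk' hl'.
by apply/negP; rewrite -ltnNge -addSn leq_add // ltnW.
Qed.

HB.instance Definition _ :=
  GRing.ComUnitRing_isIntegral.Build Zp padic_idomain.

Lemma res_nat n k : res (n%:R : Zp) k = (n %% p ^ k)%N.
Proof.
elim: n => [|n IH]; first by rewrite res0 mod0n.
by rewrite mulrS /= IH modnDm add1n.
Qed.

End PadicInt.

Section Gamma.
Variables (p : nat) (p_pr : prime p).
Local Notation Zp := (padic_int p_pr).

(* continuity for the p-adic topology: the sets of all y such that
   res y l = res x l, that is y = x mod p^l, are the basic neighbourhoods of x *)
Definition padic_continuous (g : Zp -> Zp) : Prop :=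
  forall (x : Zp) k, exists l,
    forall y : Zp, res y l = res x l -> res (g y) k = res (g x) k.

Definition morita_nat (m : nat) : Zp :=
  (-1) ^+ m * \prod_(1 <= j < m | ~~ (p %| j)%N) j%:R.

Definition is_morita_gamma (g : Zp -> Zp) : Prop :=
  [/\ g 0 = 1, forall m, (0 < m)%N -> g m%:R = morita_nat m
    & padic_continuous g].

(* well defined for odd p, by morita_gammaP and morita_gamma_unique *)
Definition Gammap : Zp -> Zp :=
  xget (fun=> 1) [set g : Zp -> Zp | is_morita_gamma g]%classic.

Lemma morita_gamma_unique g h : is_morita_gamma g -> is_morita_gamma h -> g = h.
Proof.
move=> [g0 gm gc] [h0 hm hc]; apply/funext => x; apply: padic_eq => k.
have [l1 gl] := gc x k; have [l2 hl] := hc x k.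
pose n := res x (l1 + l2).
have nx l : (l <= l1 + l2)%N -> res (n%:R : Zp) l = res x l.
  by move=> le_l; rewrite res_nat /n -(subnKC le_l) res_modD.
rewrite -(gl n%:R) ?nx ?leq_addr // -(hl n%:R) ?nx ?leq_addl //.
by have [-> | n_gt0] := posnP n; rewrite ?g0 ?h0 ?gm ?hm.
Qed.

Lemma odd_prime_ndvd2 : odd p -> ~~ (p %| 2)%N.
Proof. by apply: contraL; rewrite dvdn_prime2 // => /eqP->. Qed.

Definition red k (x : Zp) : 'Z_(p ^ k) := (res x k)%:R.

Section Red.
Variable k : nat.
Hypothesis k_gt0 : (0 < k)%N.
Local Notation N := (p ^ k)%N.

Let N_gt1 : (1 < N)%N.
Proof. by rewrite -[1%N](exp1n k) ltn_exp2r ?prime_gt1. Qed.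

Lemma redM : {morph @red k : x y / x * y}.
Proof. by move=> x y; rewrite /red resM -natrM Zp_nat_mod. Qed.

Lemma redD : {morph @red k : x y / x + y}.
Proof. by move=> x y; rewrite /red resD -natrD Zp_nat_mod. Qed.

Lemma red_nat n : @red k n%:R = n%:R.
Proof. by rewrite /red res_nat Zp_nat_mod. Qed.

Lemma redN1 : @red k (-1) = -1.
Proof.
apply/eqP; rewrite -subr_eq0 opprK -[1 in X in _ + X](red_nat 1) -redD addNr.
by rewrite -[0](mulr0n 1) red_nat.
Qed.

Lemma red_morita m :
  red k (morita_nat m) =
  (-1) ^+ m * \prod_(1 <= j < m | ~~ (p %| j)%N) j%:R.
Proof.
rewrite /morita_nat redM (big_morph _ redM (red_nat 1)); congr (_ * _).
  elim: m => [|m IH]; first exact: (red_nat 1).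
  by rewrite !exprS redM IH redN1.
by apply: eq_bigr => j _; rewrite red_nat.
Qed.

Lemma red_inj (x y : Zp) : red k x = red k y -> res x k = res y k.
Proof.
move=> /(congr1 (@nat_of_ord _)); rewrite /red !val_Zp_nat // !modn_small ?res_lt //.
Qed.

Lemma Zp_dvdn m : ((m%:R : 'Z_N) == 0) = (N %| m)%N.
Proof. by rewrite -(inj_eq (@ord_inj _)) /= val_Zp_nat. Qed.

Lemma sqr_unit (x : 'Z_N) : odd p ->
  x \is a GRing.unit -> (x == x^-1) = (x == 1) || (x == -1).
Proof.
move=> p_odd xU; apply/eqP/orP => [xV|]; last first.
  by case=> /eqP->; rewrite ?invrN ?invr1.
have: (x - 1) * (x + 1) = 0.
  by rewrite -subr_sqr expr1n expr2 {1}xV mulVr // subrr.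
move: xU; rewrite -[x]natr_Zp; case: (nat_of_ord x) => [|b]; first by rewrite unitr0.
rewrite -natr1 addrK -addrA => _ /eqP.
rewrite -[1 + 1](natrD _ 1 1) -natrD -natrM Zp_dvdn => dvdN.
have p_ndvd2 := odd_prime_ndvd2 p_odd.
have [pb | pNb] := boolP (p %| b)%N.
  left; rewrite addrC -subr_eq0 addrAC subrr add0r Zp_dvdn.
  rewrite -(@Gauss_dvdl _ _ (b + (1 + 1))) //.
  by rewrite coprimeXl // prime_coprime // dvdn_addr.
right; rewrite -subr_eq0 opprK -addrA -[1 + 1](natrD _ 1 1) -natrD Zp_dvdn.
by rewrite -(@Gauss_dvdr _ b) // coprimeXl // prime_coprime.
Qed.

Lemma wilson_unit : odd p -> \prod_(x : 'Z_N | x \is a GRing.unit) x = -1.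
Proof.
move=> p_odd; rewrite (bigID (fun x => x == x^-1)) /=.
have -> : \prod_(x : 'Z_N | (x \is a GRing.unit) && (x == x^-1)) x = -1.
  rewrite (eq_bigl (fun x => (x == 1) || (x == -1))); last first.
    move=> x; have [xU | xNU] := boolP (x \is a GRing.unit); first exact: sqr_unit.
    by apply/esym/norP; split; apply: contraNneq xNU => ->; rewrite ?unitrN unitr1.
  rewrite (bigD1 1) ?eqxx //= mul1r (bigD1 (-1)) /= ?eqxx ?orbT //=; last first.
    rewrite -subr_eq0 -opprD oppr_eq0 -[1 + 1](natrD _ 1 1) Zp_dvdn.
    apply: contra (odd_prime_ndvd2 p_odd).
    exact: (dvdn_trans (dvdn_exp k_gt0 (dvdnn p))).
  rewrite big1 ?mulr1 // => x /andP[/andP[/orP[] /eqP-> h1 h2]].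
    by rewrite eqxx in h1.
  by rewrite eqxx in h2.
rewrite (bigID (fun x : 'Z_N => (x < x^-1)%N)) /=.
rewrite [X in _ * (_ * X)](reindex_inj invr_inj) /=.
rewrite [X in _ * (_ * X)](eq_bigl (fun x : 'Z_N =>
  [&& x \is a GRing.unit, x != x^-1 & (x < x^-1)%N])); last first.
  move=> x; rewrite unitrV invrK [x^-1 == x]eq_sym -andbA; congr (_ && _).
  have [_|xVx] /= := eqVneq x x^-1; first by [].
  by rewrite -leqNgt [RHS]ltn_neqAle (inj_eq (@ord_inj _)) xVx.
rewrite (eq_bigl (fun x : 'Z_N =>
  [&& x \is a GRing.unit, x != x^-1 & (x < x^-1)%N])); last first.
  by move=> x; rewrite andbA.
rewrite -big_split /= big1 ?mulr1 // => x /andP[xU _]; exact: mulrV.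
Qed.

Let G (x : 'Z_N) : 'Z_N := if x \is a GRing.unit then x else 1.

Lemma prod_ndvd m n :
  \prod_(m <= j < n | ~~ (p %| j)%N) j%:R = \prod_(m <= j < n) G j%:R.
Proof.
rewrite big_mkcond; apply: eq_bigr => j _.
by rewrite /G unitZpE // coprime_pexpl // prime_coprime.
Qed.

Lemma wilson_pX m : odd p ->
  \prod_(m <= j < m + N | ~~ (p %| j)%N) j%:R = -1 :> 'Z_N.
Proof.
move=> p_odd; rewrite prod_ndvd; elim: m => [|m IH].
  rewrite add0n -(wilson_unit p_odd) [RHS]big_mkcond /=.
  rewrite -[X in index_iota 0 X](Zp_cast N_gt1) big_mkord.
  by apply: eq_bigr => x _; rewrite natr_Zp.
have N_gt0 : (0 < N)%N by exact: ltnW.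
rewrite addSn big_nat_recr /=; last by rewrite -[m.+1]addn1 leq_add2l.
rewrite -IH [RHS]big_ltn; last by rewrite -[X in (X < _)%N]addn0 ltn_add2l.
by rewrite mulrC natrD -[N%:R]Zp_nat_mod // modnn addr0.
Qed.

Lemma morita_period m : odd p ->
  res (morita_nat (m + N)) k = res (morita_nat m) k.
Proof.
move=> p_odd; apply: red_inj; rewrite !red_morita exprD.
rewrite -[(-1) ^+ N]signr_odd oddX p_odd orbT expr1 -mulrA; congr (_ * _).
case: m => [|m].
  have : \prod_(0 <= j < 0 + N | ~~ (p %| j)%N) j%:R = -1 :> 'Z_N.
    exact: wilson_pX.
  rewrite add0n big_ltn_cond ?pX_gt0 // dvdn0 /= => ->.
  by rewrite mulrNN mulr1 big_geq.
rewrite (big_cat_nat (n := m.+1)) //=; last exact: leq_addr.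
by rewrite wilson_pX // mulrCA mulrNN !mulr1.
Qed.
End Red.

Lemma morita_mod m k : odd p ->
  res (morita_nat (m %% p ^ k)) k = res (morita_nat m) k.
Proof.
move=> p_odd; have [->|k_gt0] := posnP k.
  by rewrite -[LHS]res_mod -[RHS]res_mod expn0 !modn1.
rewrite [in RHS](divn_eq m (p ^ k)) addnC.
elim: (m %/ _)%N => [|q IH]; first by rewrite mul0n addn0.
by rewrite mulSn [(p ^ k + _)%N]addnC addnA morita_period.
Qed.

Lemma morita_gammaP : odd p -> is_morita_gamma Gammap.
Proof.
move=> p_odd; apply: (@xgetPex _ _ [set g | is_morita_gamma g]%classic) => /=.
pose u (x : Zp) k := res (morita_nat (res x k)) k.
have hu x k : (u x k.+1 = u x k %[mod p ^ k])%N.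
  by rewrite /u resP res_mod -[in RHS](resP x k) morita_mod.
have gm m : padic_of_compat p_pr (hu m%:R) = morita_nat m.
  by apply: padic_eq => k /=; rewrite /u res_mod res_nat morita_mod.
exists (fun x => padic_of_compat p_pr (hu x)); split.
- by rewrite -[0](mulr0n 1) gm /morita_nat expr0 big_geq // mul1r.
- by move=> m _; exact: gm.
- by move=> x k; exists k => y yx /=; rewrite /u yx.
Qed.

End Gamma.

Section Teichmuller.
Variables (p : nat) (p_pr : prime p).
Local Notation Zp := (padic_int p_pr).

Definition is_teichmuller (w : 'F_p -> Zp) : Prop :=
  [/\ w 0 = 0, w 1 = 1, {morph w : x y / x * y}
    & forall x, res (w x) 1 = x :> nat].

Definition teichmuller : 'F_p -> Zp :=
  xget (fun=> 0) [set w : 'F_p -> Zp | is_teichmuller w]%classic.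

Lemma lift_exp k a b : (0 < k)%N -> (a = b %[mod p ^ k] ->
  a ^ p = b ^ p %[mod p ^ k.+1])%N.
Proof.
move=> k_gt0; wlog le_ba : a b / (b <= a)%N => [W | ] ab.
  by case/orP: (leq_total a b) => h; [apply/esym|]; apply: W.
apply/eqP; rewrite eqn_mod_dvd ?leq_exp2r ?prime_gt0 // subn_exp expnSr.
have pab : a = b %[mod p].
  by rewrite -[LHS](@modn_dvdm (p ^ k)) ?ab ?modn_dvdm ?dvdn_exp.
apply: dvdn_mul; first by rewrite -eqn_mod_dvd //; apply/eqP.
rewrite /dvdn -modn_summ (eq_bigr (fun=> b ^ p.-1 %% p)%N) => [|i _].
  by rewrite sum_nat_const card_ord modnMr.
rewrite -modnMml -modnXm pab modnXm modnMml -expnD subnK //.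
by rewrite -ltnS prednK ?prime_gt0.
Qed.

Lemma lift_expX k a b : (a = b %[mod p] ->
  a ^ (p ^ k) = b ^ (p ^ k) %[mod p ^ k.+1])%N.
Proof.
move=> ab; elim: k => [|k IH]; first by rewrite expn0 !expn1.
by rewrite [(p ^ k.+1)%N]expnSr !expnM; exact: lift_exp.
Qed.

Lemma teichmullerP : is_teichmuller teichmuller.
Proof.
apply: (@xgetPex _ _ [set w | is_teichmuller w]%classic) => /=.
have p_gt0 := prime_gt0 p_pr.
pose u (a k : nat) := (a ^ (p ^ k))%N.
have dvdS k : (p ^ k %| p ^ k.+1)%N by rewrite dvdn_exp2l.
have lift a b k : (a = b %[mod p] -> u a k = u b k %[mod p ^ k])%N.
  by move=> ab; rewrite -(modn_dvdm _ (dvdS k)) (lift_expX _ ab) modn_dvdm.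
have hu a k : (u a k.+1 = u a k %[mod p ^ k])%N.
  by rewrite /u expnS expnM; apply: lift; exact: fermat_little.
have Fp_mod (m : nat) : (m%:R : 'F_p) = (m %% p)%N :> nat by exact: val_Fp_nat.
exists (fun x : 'F_p => padic_of_compat p_pr (hu x)); split.
- by apply: padic_eq => k; rewrite [RHS]res0 /= /u exp0n ?expn_gt0 ?p_gt0 ?mod0n.
- apply: padic_eq => k; rewrite -[1 in RHS](mulr1n 1) res_nat /=.
  by rewrite (lift _ 1%N) /u ?exp1n // -[1 in LHS](mulr1n 1) Fp_mod modn_mod.
- move=> x y; apply: padic_eq => k; rewrite resM.
  have -> : x * y = (x * y)%N%:R by rewrite natrM !natr_Zp.
  rewrite [LHS]/= [RHS]/= modnMm /u -expnMn.
  by apply: lift; rewrite Fp_mod modn_mod.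
move=> x /=; rewrite /u !expn1 fermat_little // modn_small //.
by rewrite -[X in (_ < X)%N](Fp_cast p_pr).
Qed.

Lemma teichmuller_unique v w : is_teichmuller v -> is_teichmuller w -> v = w.
Proof.
have fix_exp u x k : is_teichmuller u -> u x = u x ^+ (p ^ k).
  case=> u0 u1 uM _; rewrite -(_ : u (x ^+ (p ^ k)) = u x ^+ (p ^ k)).
    congr u; elim: k => [|k IH]; first by rewrite expn0 expr1.
    rewrite expnSr exprM -IH -[LHS](natr_Zp x) -[x in RHS]natr_Zp -natrX.
    by rewrite -[RHS]Fp_nat_mod // fermat_little // Fp_nat_mod.
  by elim: (p ^ k)%N => [|m IH]; rewrite ?expr0 // !exprS uM IH.
have resX (x : Zp) m k : res (x ^+ m) k = (res x k ^ m %% p ^ k)%N.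
  elim: m => [|m IH]; first exact: (res_nat p_pr 1 k).
  by rewrite exprS resM IH modnMmr -expnS.
move=> vT wT; apply/funext => x; apply: padic_eq => k.
rewrite -[LHS]resP -[RHS]resP; congr (_ %% _)%N.
rewrite (fix_exp v x k vT) (fix_exp w x k wT) !resX; apply: lift_expX.
case: vT wT => _ _ _ vp [_ _ _ wp].
have resS1 (z : Zp) : (res z k.+1 %% p = res z 1)%N.
  by have := res_modD z 1 k; rewrite add1n expn1.
by rewrite !resS1 vp wp.
Qed.

End Teichmuller.

(* Q_p *)
Notation padic_num p_pr := {fraction (padic_int p_pr)}.

Definition fracpart (x : rat) : rat := x - (Num.floor x)%:~R.

Section Hypergeometric.
Variables (p : nat) (p_pr : prime p).
Local Notation Qp := (padic_num p_pr).

(* [ratr] sends a rational with denominator prime to p to its value in Z_p *)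
Definition GammaQ (x : rat) : Qp :=
  tofrac (Gammap (ratr x : padic_int p_pr)).

(* every power of the character, including the trivial one, is 0 at 0 *)
Definition omega_bar_exp (j : nat) (x : 'F_p) : Qp :=
  if x == 0 then 0 else tofrac ((teichmuller p_pr x)^-1 ^+ j).

Definition padicG (m : nat) (a b : seq rat) (x : 'F_p) : Qp :=
  -1 / (p%:R - 1) *
  \sum_(0 <= j < p.-1)
    let q : rat := j%:R / (p%:R - 1) in
    (-1) ^+ (j * m) * omega_bar_exp j x *
    \prod_(i < m)
      (GammaQ (fracpart (a`_i - q)) / GammaQ (fracpart a`_i) *
       (GammaQ (fracpart (- b`_i + q)) / GammaQ (fracpart (- b`_i))) *
       (- p%:R) ^ (- Num.floor (fracpart a`_i - q)
                   - Num.floor (fracpart (- b`_i) + q))).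
End Hypergeometric.

Section IndexSet.
Variables (n d : nat).
Implicit Types v w : {ffun 'I_n -> 'I_d}.

Definition Wset : {set {ffun 'I_n -> 'I_d}} :=
  [set w : {ffun 'I_n -> 'I_d} | (d %| \sum_i w i)%N].

Definition Wsim : rel {ffun 'I_n -> 'I_d} := fun v w =>
  [exists c : 'I_d, [forall i, (v i == w i + c %[mod d])%N]].

Definition Wclasses : {set {set {ffun 'I_n -> 'I_d}}} :=
  equivalence_partition Wsim Wset.

Definition nocc w (k : 'I_d) : nat := #|[set i | w i == k]|.

Definition Sset w : {set 'I_d} := [set k | nocc w k == 0%N].

Definition Alist w : seq rat :=
  [seq (d%:R - k%:R) / d%:R | k : 'I_d <- enum (Sset w)] ++
  [seq h%:R / n%:R | h <- iota 0 n & ~~ (n %/ d %| h)%N].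

Definition Blist w : seq rat :=
  flatten [seq nseq (nocc w k).-1 ((d%:R - k%:R) / d%:R : rat)
          | k : 'I_d <- enum (~: Sset w)].

Definition sdim w : nat := (n - #|~: Sset w|)%N.
End IndexSet.

Section Hypersurface.
Variables (F : finFieldType) (n : nat).

Definition dwork_form (lambda : F) (x : 'rV[F]_n) : F :=
  \sum_i x 0 i ^+ n - n%:R * lambda * \prod_i x 0 i.

(* the point of P^(n-1)(F) with homogeneous coordinates x *)
Definition proj_point (x : 'rV[F]_n) : {set 'rV[F]_n} :=
  [set c *: x | c in [pred c : F | c != 0]].

Definition dwork_points (lambda : F) : {set {set 'rV[F]_n}} :=
  [set proj_point x | x in [pred x | (x != 0) && (dwork_form lambda x == 0)]].
End Hypersurface.

(* Main.v *)
Require Import Defs.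
From HB Require Import structures.
From mathcomp Require Import all_boot all_order all_algebra.
From mathcomp Require Import cyclic finfield qpoly zify ring.
Set Implicit Arguments.
Unset Strict Implicit.
Unset Printing Implicit Defensive.
Import Order.TTheory GRing.Theory Num.Theory.
Local Open Scope ring_scope.

(**
  Let [pi^(p-1) = - p]. The Dwork exponential [theta x = exp (pi (x - x^p))],
  evaluated at Teichmueller representatives, is an additive character of [F_p] with
  values in [Z_p[pi]]: its [p]-th power is [exp (p pi x) exp (- p pi x^p) = 1], it is
  [1 + pi x] modulo [pi^2], and a [p]-th root of unity that is [1] modulo [pi^2] is
  [1]. Its Fourier coefficients are given by the Gross-Koblitz formula: the
  coefficient of the [a]-th power of the Teichmueller character is
  [pi^a Gam (a/(p-1)) / (1 - p)]. For this, expand [m |-> Gam (- (a + p m))] in a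
  Mahler series, whose coefficients are those of [exp (y + y^p/p)] up to explicit
  factors; evaluated at the fixed point [t = a/(p-1)] of the exponent, the series is
  the eigenvalue of Dwork's operator on a one-dimensional cohomology space, hence
  [1 - p] times its trace, and the trace is the Fourier coefficient.

  Expanding the number of solutions in this character leaves the exponent vectors
  [(a_1, ..., a_n, b)] with [n a_i + b = 0] and [sum a_i + b = 0] modulo [p - 1],
  which are parametrized by a class of [W] and an index [j]. The reflection and
  multiplication formulas for [Gam] then turn each product of Fourier coefficients
  into the [j]-th summand of the hypergeometric function.
*)

(** * The ring of p-adic integers *)

(** The Gross-Koblitz values are taken as the definition of the Fourier coefficients ([gcoef]), and
    the function [addchar] with these coefficients has to be shown additive; its zeroth coefficient
    then makes its sum over the field vanish, which is all the orthogonality that the count uses.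

    Limits appear as families of congruences between finite sums, modulo [p^k] ([pideal]) or [pi^k]
    ([piideal]). Equalities follow because an element of all these ideals is zero.

    The delicate point is a rate. The series [exp (pi x)] does not converge at units, so the Dwork
    exponential can be evaluated at Teichmueller representatives only through a bound on its own
    coefficients. The bound comes from the differences of gamma values: order [2k/3] for the k-th
    difference leaves about [k/6] after division by [k!], whence the 6 in the approximations, and
    gives the coefficient of [x^m] order at least [m/3] in [pi]. *)

Lemma natr_pred (R : nzRingType) n : (0 < n)%N -> n%:R - 1 = n.-1%:R :> R.
Proof. by case: n => // n _; rewrite -natr1 addrK. Qed.

Section PadicDivisibility.
Variables (p : nat) (p_pr : prime p).
Local Notation Zp := (padic_int p_pr).
Local Notation Qp := (padic_num p_pr).
Implicit Types (x y : Zp) (z w : Qp) (k l m : nat).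

Lemma res_sub0 x y k : (res (x - y) k == 0%N) = (res x k == res y k).
Proof.
have H : res x k = ((res (x - y)%R k + res y k) %% p ^ k)%N by rewrite -resD subrK.
apply/eqP/eqP => [h|h]; first by rewrite H h add0n res_mod.
apply/eqP; have := res_lt (x - y) k; move: H; rewrite h.
have := res_lt y k; move: (res (x - y) k) (res y k) => a b hb /eqP.
rewrite -{1}(modn_small hb) -{1}[b]add0n eqn_modDr mod0n => /eqP h0 ha.
by rewrite -(modn_small ha) -h0.
Qed.

Lemma res_leq x k l : (l <= k)%N -> (res x k %% p ^ l = res x l)%N.
Proof. by move=> /subnKC <-; rewrite res_modD. Qed.

Lemma resX x m k : res (x ^+ m) k = (res x k ^ m %% p ^ k)%N.
Proof.
elim: m => [|m IH]; first by rewrite expr0 expn0 -(res_nat p_pr 1 k).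
by rewrite exprS resM IH modnMmr expnS.
Qed.

(** Dividing by [p^k] loses [k] digits, so the quotient modulo [p^l] is read off from the residue of
    [x] modulo [p^(k + l)]. *)
Lemma padic_dvdP x k : reflect (exists y, x = p%:R ^+ k * y) (res x k == 0%N).
Proof.
apply: (iffP eqP) => [h|[y ->]]; last first.
  by rewrite resM resX res_nat modnMml -modnMml modnXm modnn mul0n mod0n.
have dv l : (p ^ k %| res x (k + l))%N by rewrite /dvdn res_modD h.
have hu l : (res x (k + l.+1) %/ p ^ k = res x (k + l) %/ p ^ k %[mod p ^ l])%N.
  by rewrite !modn_divl -expnD -(addnC k) addnS resP res_mod.
exists (padic_of_compat p_pr hu); apply: padic_eq => l.
rewrite -[in LHS](res_leq x (leq_addl k l)) resM resX res_nat /= modnMm.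
by rewrite -[in RHS]modnMml modnXm modnMml mulnC divnK.
Qed.

(** Euler's power [a^(phi(p^k) - 1)] inverts modulo each [p^k]; these inverses are compatible
    because an inverse modulo [p^k] is unique. *)
Lemma padic_unitP x : res x 1 != 0%N -> x \is a GRing.unit.
Proof.
move=> x1.
have co k : coprime (res x k) (p ^ k).
  case: k => [|k]; first by rewrite expn0 coprimen1.
  rewrite coprimeXr // coprime_sym prime_coprime //.
  by have := res_leq x (ltn0Sn k); rewrite expn1 /dvdn => ->.
have inv k : (res x k ^ (totient (p ^ k)).-1 * res x k = 1 %[mod p ^ k])%N.
  by rewrite -expnSr prednK ?totient_gt0 ?pX_gt0 // Euler_exp_totient.
have hu k : (res x k.+1 ^ (totient (p ^ k.+1)).-1
   = res x k ^ (totient (p ^ k)).-1 %[mod p ^ k])%N.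
  set a := (_ ^ _)%N; set b := (_ ^ _)%N.
  have ha : (a * res x k = 1 %[mod p ^ k])%N.
    rewrite -(resP x k) modnMmr -(@modn_dvdm (p ^ k.+1)) ?dvdn_exp2l //.
    by rewrite inv modn_dvdm ?dvdn_exp2l.
  rewrite -[a in LHS]muln1 -modnMmr -(inv k) modnMmr.
  by rewrite mulnCA -modnMmr ha modnMmr muln1.
apply/GRing.unitrP; exists (padic_of_compat p_pr hu).
have E : padic_of_compat p_pr hu * x = 1.
  apply: padic_eq => k; rewrite resM /= modnMml inv.
  by rewrite -(res_nat p_pr 1 k).
by split => //; rewrite mulrC.
Qed.

Lemma nat_unit m : ~~ (p %| m)%N -> (m%:R : Zp) \is a GRing.unit.
Proof. by move=> h; apply: padic_unitP; rewrite res_nat expn1. Qed.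

Lemma padic_nat_eq0 m : ((m%:R : Zp) == 0) = (m == 0)%N.
Proof.
apply/eqP/eqP => [h|-> //].
have : (p ^ m %| m)%N by rewrite /dvdn -(res_nat p_pr) h res0.
case: m h => // m _ /(dvdn_leq (ltn0Sn m)).
by rewrite leqNgt ltn_expl ?prime_gt1.
Qed.

Lemma padic_sep0 x : (forall k, res x k = 0%N) -> x = 0.
Proof. by move=> h; apply: padic_eq => k; rewrite h res0. Qed.

Local Notation "x %:F" := (tofrac x : Qp) (at level 1, format "x %:F") : ring_scope.

(** [p^k Z_p] inside [Q_p]: membership in these submodules replaces an absolute value. As [k] is a
    natural number, every member is integral. *)
Definition pideal (k : nat) (z : Qp) := exists y : Zp, z = p%:R ^+ k * y%:F.

Lemma tofrac_nat m : (m%:R : Zp)%:F = m%:R.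
Proof. by rewrite rmorph_nat. Qed.

Lemma Qp_nat_eq0 m : ((m%:R : Qp) == 0) = (m == 0)%N.
Proof. by rewrite -tofrac_nat -tofrac0 tofrac_eq padic_nat_eq0. Qed.

Lemma pQ_neq0 : (p%:R : Qp) != 0.
Proof. by rewrite Qp_nat_eq0 -lt0n prime_gt0. Qed.

Lemma pideal_tofrac k x : pideal k x%:F <-> res x k = 0%N.
Proof.
split=> [[y h]|/eqP/padic_dvdP[y ->]]; last first.
  by exists y; rewrite tofracM rmorphXn /= tofrac_nat.
apply/eqP/padic_dvdP; exists y; apply/eqP.
by rewrite -tofrac_eq h tofracM rmorphXn /= tofrac_nat.
Qed.

Lemma pideal0 k : pideal k 0.
Proof. by exists 0; rewrite tofrac0 mulr0. Qed.
Lemma pidealD k z w : pideal k z -> pideal k w -> pideal k (z + w).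
Proof. by move=> [x ->] [y ->]; exists (x + y); rewrite tofracD mulrDr. Qed.
Lemma pidealN k z : pideal k z -> pideal k (- z).
Proof. by move=> [x ->]; exists (- x); rewrite tofracN mulrN. Qed.
Lemma pidealB k z w : pideal k z -> pideal k w -> pideal k (z - w).
Proof. by move=> hz hw; apply: pidealD => //; apply: pidealN. Qed.
Lemma pidealM k l z w : pideal k z -> pideal l w -> pideal (k + l) (z * w).
Proof. by move=> [x ->] [y ->]; exists (x * y); rewrite tofracM exprD mulrACA. Qed.
Lemma pidealW k l z : (l <= k)%N -> pideal k z -> pideal l z.
Proof.
move=> /subnKC <- [x ->]; exists (p%:R ^+ (k - l) * x).
by rewrite tofracM rmorphXn /= tofrac_nat exprD mulrA.
Qed.
Lemma pidealMl k z w : pideal 0 z -> pideal k w -> pideal k (z * w).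
Proof. exact: pidealM. Qed.
Lemma pidealMr k z w : pideal k z -> pideal 0 w -> pideal k (z * w).
Proof. by rewrite mulrC => hz hw; apply: pidealMl. Qed.
Lemma pideal_int x : pideal 0 x%:F.
Proof. by exists x; rewrite mul1r. Qed.
Lemma pideal_nat m : pideal 0 m%:R.
Proof. by rewrite -tofrac_nat; apply: pideal_int. Qed.
Lemma pideal1 : pideal 0 1. Proof. exact: (pideal_nat 1). Qed.
Lemma pideal_pX k : pideal k (p%:R ^+ k).
Proof. by exists 1; rewrite tofrac1 mulr1. Qed.
Lemma pideal_sum k (I : Type) (r : seq I) (P : pred I) (F : I -> Qp) :
  (forall i, P i -> pideal k (F i)) -> pideal k (\sum_(i <- r | P i) F i).
Proof. by move=> h; elim/big_ind: _ => // *; [exact: pideal0|exact: pidealD]. Qed.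
Lemma pidealX k z m : pideal k z -> pideal (k * m) (z ^+ m).
Proof.
move=> h; elim: m => [|m IH]; first by rewrite muln0 expr0; exact: pideal1.
by rewrite mulnS exprS; exact: pidealM.
Qed.
Lemma pideal_sgn m : pideal 0 ((-1) ^+ m).
Proof. by apply: (@pidealX 0 _ m); apply: pidealN; apply: pideal1. Qed.

Lemma pideal_sep z : (forall k, pideal k z) -> z = 0.
Proof.
move=> h; have [y hy] := h 0%N; rewrite expr0 mul1r in hy.
rewrite hy (_ : y = 0) ?tofrac0 //; apply: padic_sep0 => k.
by apply/pideal_tofrac; rewrite -hy.
Qed.

Lemma tofrac_inv_nat m : ~~ (p %| m)%N -> ((m%:R : Zp)^-1)%:F = m%:R^-1.
Proof. by move=> h; rewrite rmorphV ?nat_unit //= tofrac_nat. Qed.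

Lemma pideal_inv_nat m : ~~ (p %| m)%N -> pideal 0 (m%:R^-1).
Proof. by move=> h; rewrite -tofrac_inv_nat //; apply: pideal_int. Qed.

(** Legendre's recursion [v(m!) = q + v(q!)] with [q = m %/ p]: the bound for [q] gives
    [(p - 1) v(m!) <= (p - 1) q + q <= m]. *)
Lemma logn_fact_bound m : (p.-1 * logn p m`! <= m)%N.
Proof.
have p1 := prime_gt1 p_pr.
elim/ltn_ind: m => m IH; case: (posnP m) => [->|m0]; first by rewrite fact0 logn1 muln0.
have lt : (m %/ p < m)%N by rewrite ltn_Pdiv.
have -> : logn p m`! = (m %/ p + logn p (m %/ p)`!)%N.
  have H : (m %/ p <= m)%N by rewrite leq_div.
  rewrite !logn_fact // big_ltn // expn1; congr (_ + _)%N.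
  rewrite big_add1 /=.
  rewrite (@big_cat_nat _ _ _ (m %/ p).+1) //= [X in (_ + X)%N]big1_seq.
    by rewrite addn0; apply: eq_big_nat => i _; rewrite -divnMA expnS.
  move=> i /andP[_]; rewrite mem_index_iota => /andP[hi _].
  rewrite expnS divnMA divn_small // (leq_ltn_trans _ (ltn_expl i p1)) //.
  by rewrite ltnW.
have := IH _ lt; have := leq_trunc_div m p.
move: (logn _ _) => e; move: (m %/ p)%N => q.
have -> : (q * p = q * p.-1 + q)%N by nia.
nia.
Qed.

End PadicDivisibility.

(** * Morita's gamma function and the Teichmueller character *)

Section GammaTheory.
Variables (p : nat) (p_pr : prime p) (p_odd : odd p).
Local Notation Zp := (padic_int p_pr).
Local Notation Gam := (@Gammap p p_pr).
Implicit Types (x y : Zp) (k l m : nat).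

Lemma res_mulC_cong x x' y y' k : res x k = res x' k -> res y k = res y' k ->
  res (x * y) k = res (x' * y') k.
Proof. by rewrite !resM => -> ->. Qed.

Lemma res_add_cong x x' y y' k : res x k = res x' k -> res y k = res y' k ->
  res (x + y) k = res (x' + y') k.
Proof. by rewrite !resD => -> ->. Qed.

Lemma res_opp_cong x x' k : res x k = res x' k -> res (- x) k = res (- x') k.
Proof. by move=> h; rewrite -mulN1r -[- x']mulN1r; apply: res_mulC_cong. Qed.

Lemma res_prod_cong k (I : Type) (r : seq I) (F G : I -> Zp) :
  (forall i, res (F i) k = res (G i) k) ->
  res (\prod_(i <- r) F i) k = res (\prod_(i <- r) G i) k.
Proof.
move=> h; elim: r => [|i r IH]; first by rewrite !big_nil.
by rewrite !big_cons; apply: res_mulC_cong.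
Qed.

Lemma res_at0 x : res x 0 = 0%N.
Proof. by rewrite -res_mod modn1. Qed.

Lemma res_lowW x y k l : (l <= k)%N -> res x k = res y k -> res x l = res y l.
Proof. by move=> h e; rewrite -(res_leq x h) e res_leq. Qed.

Lemma res_unit_mul0 u x k : u \is a GRing.unit -> res (u * x) k = 0%N -> res x k = 0%N.
Proof.
move=> uU /eqP/padic_dvdP[y e]; apply/eqP/padic_dvdP; exists (u^-1 * y).
by rewrite mulrCA -e mulKr.
Qed.

Lemma Gam_nat m : Gam m%:R = morita_nat p_pr m.
Proof.
have [g0 gm _] := morita_gammaP p_pr p_odd.
case: m => [|m]; last exact: gm.
by rewrite mulr0n g0 /morita_nat expr0 big_geq // mul1r.
Qed.

(** Continuity only provides some precision [l]. Since the defining products are periodic modulo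
    [p^k] ([morita_mod]), precision [k] of the argument suffices: [Gam] does not increase
    distances. *)
Lemma Gam_res x k : res (Gam x) k = res (morita_nat p_pr (res x k)) k.
Proof.
have [_ _ gc] := morita_gammaP p_pr p_odd.
have [l hl] := gc x k.
have <- : res (Gam (res x (k + l))%:R) k = res (Gam x) k.
  by apply: hl; rewrite res_nat res_leq // leq_addl.
by rewrite Gam_nat -morita_mod // res_leq // leq_addr.
Qed.

Lemma Gam_cong x y k : res x k = res y k -> res (Gam x) k = res (Gam y) k.
Proof. by rewrite !Gam_res => ->. Qed.

Lemma morita_natS m : morita_nat p_pr m.+1 =
  morita_nat p_pr m * (if (p %| m)%N then -1 else - m%:R).
Proof.
rewrite /morita_nat exprS big_mkcond /=.
case: m => [|m]; first by rewrite dvdn0 !big_geq // !mulr1 mul1r.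
rewrite big_nat_recr //= -big_mkcond /=.
by case: (p %| m.+1)%N => /=; ring.
Qed.

Lemma res1_dvd x k : (0 < k)%N -> (p %| res x k)%N = (res x 1 == 0%N).
Proof. by move=> h; have := res_leq x h; rewrite expn1 /dvdn => ->. Qed.

Lemma GamS x : Gam (x + 1) = Gam x * (if res x 1 == 0%N then -1 else - x).
Proof.
apply: padic_eq => k; case: (posnP k) => [->|k0]; first by rewrite !res_at0.
have hx : res x k = res ((res x k)%:R : Zp) k by rewrite res_nat res_mod.
rewrite (@Gam_cong _ ((res x k).+1%:R)); last first.
  by rewrite -natr1; apply: res_add_cong.
rewrite Gam_nat morita_natS -Gam_nat; apply: res_mulC_cong.
  by apply: Gam_cong.
by rewrite res1_dvd //; case: ifP => // _; apply: res_opp_cong.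
Qed.

Lemma Gam_unit x : Gam x \is a GRing.unit.
Proof.
apply: padic_unitP; rewrite Gam_res; set m := res x 1.
suff : morita_nat p_pr m \is a GRing.unit.
  move=> u; apply/negP => /eqP h.
  have : res (morita_nat p_pr m / morita_nat p_pr m) 1 = res (1 : Zp) 1 by rewrite divrr.
  by rewrite resM h mul0n mod0n (res_nat p_pr 1 1) modn_small // expn1 prime_gt1.
elim: m => [|m IH]; first by rewrite /morita_nat expr0 big_geq // mulr1 unitr1.
rewrite morita_natS unitrM IH /=; case: ifP => h; rewrite unitrN ?unitr1 //.
by rewrite nat_unit // h.
Qed.

Lemma Gam_neq0 x : Gam x != 0.
Proof. by apply/negP => /eqP h; have := Gam_unit x; rewrite h unitr0. Qed.

(** The functional equation is used downwards: each multiple of [p] that is passed contributes a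
    factor [-1]. *)
Lemma Gam_negnat m :
  Gam (- m%:R) * (\prod_(1 <= j < m.+1 | ~~ (p %| j)%N) j%:R) = (-1) ^+ (m %/ p)%N.
Proof.
elim: m => [|m IH].
  by rewrite oppr0 big_geq // mulr1 div0n expr0 (Gam_nat 0) /morita_nat big_geq // mulr1.
rewrite big_mkcond big_nat_recr //= -big_mkcond /=.
have := GamS (- m.+1%:R).
rewrite -[X in - X + 1]natr1 opprD addrNK.
have -> : (res (- m.+1%:R : Zp) 1 == 0%N) = (p %| m.+1)%N.
  rewrite -sub0r res_sub0 res0 res_nat expn1 eq_sym /dvdn //.
move=> e; move: IH; rewrite e; case: ifP => h /= IH.
  by rewrite divnS ?prime_gt0 // h exprD -IH expr1; ring.
by rewrite divnS ?prime_gt0 // h exprD -IH expr0; ring.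
Qed.

Definition tau r : Zp := r%:R / (p.-1)%:R.

Lemma p1_ndvd : ~~ (p %| p.-1)%N.
Proof. by clear p_odd; have := prime_gt1 p_pr => h; rewrite gtnNdvd //; lia. Qed.

Lemma p1_unit : (p.-1)%:R \is a @GRing.unit Zp.
Proof. exact: nat_unit p1_ndvd. Qed.

Lemma tauE r : (p.-1)%:R * tau r = r%:R.
Proof. by rewrite /tau mulrCA divrr ?mulr1 // p1_unit. Qed.

Lemma tau_res r m k : res (tau r) k = res (m%:R : Zp) k <-> (r = p.-1 * m %[mod p ^ k])%N.
Proof.
have -> : (r = p.-1 * m %[mod p ^ k])%N <-> res (r%:R : Zp) k = res ((p.-1 * m)%:R : Zp) k.
  by rewrite !res_nat.
rewrite -(tauE r) natrM; split => h; first by apply: res_mulC_cong.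
apply/eqP; rewrite -res_sub0; apply/eqP/(res_unit_mul0 p1_unit)/eqP.
by rewrite mulrBr res_sub0 h.
Qed.

Lemma Gam_tau0 : Gam (tau 0) = 1.
Proof. by rewrite /tau mul0r (Gam_nat 0) /morita_nat expr0 big_geq // mulr1. Qed.

(** Modulo [p^k] the arguments are [N] and [- (N - 1)] for a natural number [N], and there the
    products in [morita_nat] and [Gam_negnat] cancel. What is left is the sign [(-1)^(N + l)] with
    [l = (N - 1) %/ p]. *)
Lemma Gam_reflect r : (0 < r < p.-1)%N ->
  Gam (tau r) * Gam (tau (p.-1 - r)) = - (-1) ^+ r.
Proof.
move=> /andP[r0 rp]; have p1 := prime_gt1 p_pr.
apply: padic_eq => k; case: (posnP k) => [->|k0]; first by rewrite !res_at0.
set x := tau r.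
have e1 : tau (p.-1 - r) = 1 - x.
  by rewrite /tau natrB ?(ltnW rp) // mulrBl divrr ?p1_unit.
pose N := res x k.
have hN : res x k = res (N%:R : Zp) k by rewrite res_nat res_mod.
have : res x k = res (N%:R : Zp) k by [].
move=> /(res_lowW k0) /tau_res; rewrite expn1 => hmod.
have N0 : (0 < N)%N.
  rewrite lt0n; apply/negP => /eqP h; move: hmod; rewrite h muln0 mod0n modn_small; lia.
have := divn_eq N p; set l := (N %/ p)%N; set s := (N %% p)%N => eN.
have sp : (s < p)%N by rewrite ltn_mod; lia.
(* [r = (p - 1) N = - s] modulo [p], and the ranges of [r] and [s] leave only this possibility. *)
have hs : (s + r = p)%N.
  have : (p %| r + N)%N.
    rewrite /dvdn -modnDml hmod modnDml -mulSnr prednK ?prime_gt0 //.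
    by rewrite modnMr.
  rewrite eN addnCA dvdn_addr ?dvdn_mull // => /dvdnP[[|[|q]]]; lia.
have eD : ((N.-1) %/ p = l)%N.
  have -> : (N.-1 = l * p + s.-1)%N by lia.
  by rewrite divnMDl ?divn_small ?addn0; lia.
rewrite (@res_mulC_cong _ (morita_nat p_pr N) _ (Gam (- N.-1%:R))); first last.
- apply: Gam_cong; rewrite e1 -[N.-1]subn1 natrB // opprB.
  by apply: res_add_cong => //; apply: res_opp_cong.
- by rewrite -Gam_nat; apply: Gam_cong.
have -> : morita_nat p_pr N * Gam (- N.-1%:R) = (-1) ^+ N * (-1) ^+ l.
  rewrite -eD -Gam_negnat /morita_nat -[in index_iota 1 N](prednK N0); ring.
congr (res _ _); rewrite -exprD -signr_odd -[(-1) ^+ r]signr_odd.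
have -> : odd (N + l) = ~~ odd r.
  have : odd (s + r) by rewrite hs.
  rewrite eN !oddD oddM p_odd andbT; case: (odd l); case: (odd s); case: (odd r) => //.
by case: (odd r); rewrite /= ?expr0 ?expr1 ?opprK.
Qed.

End GammaTheory.

(** * Teichmueller representatives as fixed points of the [p]-th power *)

Section TeichmullerTheory.
Variables (p : nat) (p_pr : prime p) (p_odd : odd p).
Local Notation Zp := (padic_int p_pr).
Local Notation w := (teichmuller p_pr).
Implicit Types (x y : 'F_p) (k m : nat).

Lemma teich0 : w 0 = 0. Proof. by case: (teichmullerP p_pr). Qed.
Lemma teich1 : w 1 = 1. Proof. by case: (teichmullerP p_pr). Qed.
Lemma teichM : {morph w : x y / x * y}. Proof. by case: (teichmullerP p_pr). Qed.
Lemma teich_res1 x : res (w x) 1 = x :> nat. Proof. by case: (teichmullerP p_pr). Qed.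
Lemma teichX m : {morph w : x / x ^+ m}.
Proof. by move=> x; elim: m => [|m IH]; rewrite ?expr0 ?teich1 // !exprS teichM IH. Qed.
Lemma Fp_expp x : x ^+ p = x.
Proof. by have := expf_card x; rewrite card_Fp. Qed.

Lemma Fp_expp1 x : x != 0 -> x ^+ p.-1 = 1.
Proof.
move=> x0; apply: (mulfI x0); rewrite mulr1 -exprS prednK ?prime_gt0 //.
exact: Fp_expp.
Qed.

Lemma teich_expp1 x : x != 0 -> w x ^+ p.-1 = 1.
Proof. by move=> x0; rewrite -teichX Fp_expp1 // teich1. Qed.

Lemma teich_expp x : w x ^+ p = w x.
Proof. by rewrite -teichX Fp_expp. Qed.

Lemma teich_exp_mod x m : x != 0 -> w x ^+ (m %% p.-1)%N = w x ^+ m.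
Proof.
move=> x0; rewrite [in RHS](divn_eq m p.-1) exprD mulnC exprM teich_expp1 //.
by rewrite expr1n mul1r.
Qed.

Lemma teich_unit x : x != 0 -> w x \is a GRing.unit.
Proof.
move=> x0; apply: padic_unitP; rewrite teich_res1.
by apply: contra x0 => /eqP h; apply/eqP/val_inj.
Qed.

(** [w m] is its own [p]-th power, while raising to the [p]-th power gains one digit of agreement
    between [w m] and [m]. *)
Lemma teich_lim m k : res (w m%:R) k = (m ^ (p ^ k.-1) %% p ^ k)%N.
Proof.
case: k => [|k]; first by rewrite res_at0 modn1.
have -> : w m%:R = w m%:R ^+ (p ^ k).
  elim: k => [|k IH]; first by rewrite expr1.
  by rewrite expnSr exprM -IH teich_expp.
rewrite resX; apply: lift_expX => //.
have := res_leq (w m%:R) (ltn0Sn k); rewrite expn1 => ->.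
by rewrite teich_res1 val_Fp_nat.
Qed.

End TeichmullerTheory.

(** * The multiplication formula for the gamma function *)

Section GammaMultiplication.
Variables (p : nat) (p_pr : prime p) (p_odd : odd p).
Local Notation Zp := (padic_int p_pr).
Local Notation Gam := (@Gammap p p_pr).
Local Notation w := (teichmuller p_pr).
Variables (n : nat) (n_gt0 : (0 < n)%N) (pn : ~~ (p %| n)%N).

Definition ndvd_count N := (\sum_(0 <= j < N) ~~ (p %| j))%N.

Lemma ndvd_countE N s : (0 < s <= p)%N -> ndvd_count (N * p + s) = (N * p.-1 + s.-1)%N.
Proof.
have p0 := prime_gt0 p_pr.
have step M t : (t < p)%N -> ndvd_count (M * p + t.+1) = (ndvd_count (M * p) + t)%N.
  elim: t => [|t IH] tp; rewrite /ndvd_count addnS big_nat_recr //= -/(ndvd_count _).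
    by rewrite !addn0 dvdn_mull ?addn0.
  by rewrite (IH (ltnW tp)) dvdn_addr ?dvdn_mull // gtnNdvd // addn1 addnS.
case: s => // s /=; elim: N s => [|N IH] s sp.
  by rewrite step // /ndvd_count big_geq.
have E : (N.+1 * p = N * p + p.-1.+1)%N by rewrite mulSnr prednK.
by rewrite step // E IH ?prednK // mulSnr.
Qed.

(** Passing from [N] to [N + 1] replaces the factor [h = 0] by [h = n]. The functional equation at
    [N / n] links the two, and it releases a factor [n] exactly when [p] does not divide [N]. *)
Lemma Gam_mult_nat N :
  (\prod_(h < n) Gam ((N%:R + h%:R) / n%:R)) * n%:R ^+ ndvd_count N =
  (\prod_(h < n) Gam (h%:R / n%:R)) * Gam N%:R.
Proof.
elim: N => [|N IH].
  rewrite /ndvd_count big_geq // expr0 mulr1 (Gam_nat p_pr p_odd 0) /morita_nat big_geq //.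
  by rewrite !mulr1; apply: eq_bigr => h _; rewrite add0r.
have nU := nat_unit p_pr pn.
pose F h := Gam ((N%:R + h%:R) / n%:R).
have sh : (\prod_(h < n) Gam ((N.+1%:R + h%:R) / n%:R)) * F 0%N = (\prod_(h < n) F h) * F n.
  rewrite -(big_mkord predT F) -big_nat_recr // big_nat_recl // mulrC; congr (_ * _).
  rewrite big_mkord; apply: eq_bigr => h _; rewrite /F -natr1 -(addn1 h) natrD.
  by congr (Gam (_ / _)); ring.
have Fn : F n = F 0%N * (if (p %| N)%N then -1 else - (N%:R / n%:R)).
  rewrite /F addr0 mulrDl divrr // GamS //; congr (_ * _).
  have -> : (res (N%:R / n%:R : Zp) 1 == 0%N) = (p %| N)%N.
    apply/eqP/idP => h.
      have : res (n%:R * (N%:R / n%:R) : Zp) 1 = 0%N by rewrite resM h muln0 mod0n.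
      by rewrite mulrCA divrr // mulr1 res_nat expn1 /dvdn => ->.
    by rewrite resM res_nat expn1 (eqP h) mul0n mod0n.
  by case: ifP.
have F0 : F 0%N != 0 by exact: Gam_neq0.
apply: (mulIf F0); rewrite mulrAC sh Fn Gam_nat // morita_natS -Gam_nat //.
rewrite -/(F) /ndvd_count big_nat_recr //= -/(ndvd_count _) (mulrA (\prod_(h < n) Gam (h%:R / n%:R))) -IH.
rewrite -/(F 0%N) -/(\prod_(h < n) F h).
move: (\prod_(h < n) F h) (F 0%N) (ndvd_count N) => P c q.
case: ifP => h /=; first by rewrite exprD expr0; ring.
have -> : - N%:R = - (N%:R / n%:R) * n%:R :> Zp by rewrite mulNr divrK.
by rewrite exprD expr1; ring.
Qed.

(** For natural numbers tending to [r / (p - 1)], the power of [n] in [Gam_mult_nat] has exponent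
    [p^k (p - 1 - r)], and [n^(p^k)] tends to [w n]. *)
Lemma Gam_mult r : (r <= p.-1)%N ->
  w n%:R ^+ (p.-1 - r) * (\prod_(h < n) Gam ((tau p_pr r + h%:R) / n%:R)) =
  (\prod_(h < n) Gam (h%:R / n%:R)) * Gam (tau p_pr r).
Proof.
move=> rp; have p1 := prime_gt1 p_pr.
(* [N k = p^k - r (p^k - 1) / (p - 1)], which is [r / (p - 1)] modulo [p^k]. The recursion exhibits
   [N k.+1] as [(N k - 1) p + (p - r)], the shape that [ndvd_countE] counts. *)
have [N hN] : exists N : nat -> nat, forall k, (0 < N k)%N /\
    (p.-1 * N k + r * p ^ k = p ^ k * p.-1 + r)%N /\ (N k.+1 = p * N k - r)%N.
  exists (fun k => iter k (fun m => p * m - r)%N 1%N) => k; elim: k => [|k [IH1 [IH2 IH3]]].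
    by rewrite /= expn0; lia.
  split; first by rewrite IH3; nia.
  split => //; rewrite IH3 expnS mulnBr.
  have : (r <= p * iter k (fun m => p * m - r)%N 1%N)%N by nia.
  move: (iter k _ _) (p ^ k)%N IH1 IH2 => M q IH1 IH2 hr.
  have : (p.-1 * r <= p.-1 * (p * M))%N by rewrite leq_mul2l hr orbT.
  have -> : p = (p.-1).+1 by lia.
  by nia.
apply: padic_eq => [[|k]]; first by rewrite !res_at0.
have [N0 [_ NS]] := hN k; have [_ [NE _]] := hN k.+1.
have hx : res (tau p_pr r) k.+1 = res ((N k.+1)%:R : Zp) k.+1.
  have : (p.-1 * p ^ k.+1 + r = r * p ^ k.+1 + p.-1 * N k.+1)%N by lia.
  move=> /(congr1 (fun z => z %% p ^ k.+1)%N); rewrite !modnMDl.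
  by move=> h; apply/tau_res.
have cnt : ndvd_count (N k.+1) = (p ^ k * (p.-1 - r))%N.
  rewrite NS.
  have -> : (p * N k - r = (N k).-1 * p + (p - r))%N.
    have rp' : (r <= p)%N by apply: leq_trans rp (leq_pred p).
    by rewrite addnBA // -mulSnr prednK // mulnC.
  rewrite ndvd_countE; last by lia.
  have [_ [E _]] := hN k; move: N0 E; case: (N k) => // N' _.
  rewrite mulnBr mulnS [(r * _)%N]mulnC /= [(N' * _)%N]mulnC.
  have : (p ^ k * r <= p ^ k * p.-1)%N by rewrite leq_mul2l rp orbT.
  lia.
have ew : res (w n%:R ^+ (p.-1 - r)) k.+1 = res ((n%:R : Zp) ^+ ndvd_count (N k.+1)) k.+1.
  rewrite cnt exprM [LHS]resX [RHS]resX; congr (_ ^ _ %% _)%N.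
  by rewrite -natrX res_nat teich_lim.
have eG : res (\prod_(h < n) Gam ((tau p_pr r + h%:R) / n%:R)) k.+1 =
    res (\prod_(h < n) Gam (((N k.+1)%:R + h%:R) / n%:R)) k.+1.
  apply: res_prod_cong => h; apply: Gam_cong => //; apply: res_mulC_cong => //.
  exact: res_add_cong.
rewrite (res_mulC_cong ew eG) mulrC Gam_mult_nat.
by apply: res_mulC_cong => //; apply: Gam_cong.
Qed.

End GammaMultiplication.

(** * Mahler coefficients of the gamma function *)

Section ForwardDifference.
Variable R : comNzRingType.
Implicit Types (g h : nat -> R) (k m : nat).

Definition fdiff g m := g m.+1 - g m.
Local Notation D := fdiff.

Lemma eq_iter_fdiff k g h : g =1 h -> iter k D g =1 iter k D h.
Proof.
by move=> e; elim: k => [|k IH] m //=; rewrite /fdiff !IH.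
Qed.

Lemma iter_fdiffD k g h m :
  iter k D (fun m => g m + h m) m = iter k D g m + iter k D h m.
Proof. by elim: k m => [|k IH] m //=; rewrite /fdiff !IH; ring. Qed.

Lemma iter_fdiffS k g m : iter k D (fun m => g m.+1) m = iter k D g m.+1.
Proof. by elim: k m => [|k IH] m //=; rewrite /fdiff !IH. Qed.

Lemma iter_fdiffN k g m : iter k D (fun m => - g m) m = - iter k D g m.
Proof. by elim: k m => [|k IH] m //=; rewrite /fdiff !IH; ring. Qed.

Lemma iter_fdiff_cst k c m : iter k.+1 D (fun=> c) m = 0.
Proof. by elim: k m => [|k IH] m; rewrite iterS /fdiff ?IH /= subrr. Qed.

Lemma iter_fdiff_affine k (al be : R) g m :
  iter k D (fun m => (al + be * m%:R) * g m) m =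
  (al + be * m%:R) * iter k D g m + be * k%:R * iter k.-1 D g m.+1.
Proof.
elim: k m => [|k IH] m; first by rewrite /=; ring.
rewrite iterS /fdiff !IH [k.+1.-1]/= iterS /fdiff.
case: k {IH} => [|k]; first by rewrite /= -!natr1; ring.
by rewrite /= /fdiff -!natr1; ring.
Qed.

(** At a natural number the Mahler series is a finite sum; any [N > m] may bound it because
    ['C(m, k)] vanishes for [k > m]. *)
Lemma newton_fdiff N g m : (m < N)%N ->
  g m = \sum_(k < N) 'C(m, k)%:R * iter k D g 0.
Proof.
elim: m N g => [|m IH] [|N] // g mN.
  rewrite big_ord_recl /= big1 ?addr0 ?mul1r // => i _.
  by rewrite bin0n /= mul0r.
have -> : g m.+1 = g m + D g m by rewrite /fdiff; ring.
rewrite {1}(IH N.+1 g (ltnW mN)) (IH N (D g) mN) !big_ord_recl /= !bin0 -addrA.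
rewrite -big_split /=; congr (_ + _); apply: eq_bigr => i _.
by rewrite /bump /= add1n binS natrD -iterSr /=; ring.
Qed.

End ForwardDifference.

Section FallingProduct.
Variable R : comNzRingType.

(** [k!] times the binomial coefficient of [x] and [k]; the division by [k!] is left to the Mahler
    coefficients, where its cost is controlled. *)
Definition fallr (x : R) k := \prod_(l < k) (x - l%:R).

Lemma fallr_nat m k : fallr (m%:R) k = (m ^_ k)%:R.
Proof.
elim: k => [|k IH]; first by rewrite /fallr big_ord0 ffactn0.
rewrite /fallr big_ord_recr /= -/(fallr _ _) IH ffactnSr natrM.
case: (leqP k m) => h; first by rewrite natrB.
by rewrite ffact_small // !mul0r.
Qed.
End FallingProduct.

(** * Dwork's trace argument as a telescoping identity *)

Section Telescope.
Variables (F : fieldType) (p : nat) (a : nat) (t : F) (c : nat -> F).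
Hypothesis ht : (p%:R - 1) * t = a%:R.
Hypothesis hc : forall m, m.+1%:R * c m.+1 =
  c m + (if (p <= m.+1)%N then c (m.+1 - p)%N else 0).
Hypothesis p_gt1 : (1 < p)%N.

Let N i j := (- p%:R) ^+ i * c (a + p * i - j)%N.
Fixpoint tele_rem i k := if k is k'.+1 then N i k' - (t + k'%:R) * tele_rem i k' else 0.
Local Notation B := tele_rem.
Let rho k := fallr (- t) k.

Let rhoS k : rho k.+1 = - (t + k%:R) * rho k.
Proof. by rewrite /rho /fallr big_ord_recr /=; ring. Qed.

(* [N i j] is the matrix, up to a constant and in the basis [pi^j x^(t + j)], of
   Dwork's operator [alpha f = psi (exp (pi x - pi x^p) f)], which satisfies
   [alpha D = p D alpha] for [D = x d/dx + pi x]; [rho k] is the class of the k-th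
   basis vector modulo the image of [D], and [tele_rem] is [alpha] composed with a
   left inverse of [D]. Comparing traces gives [(1 - p) Tr alpha = alpha mod D], and
   truncating the trace leaves only a telescoping boundary term. *)
Lemma tele_step i k : (k <= i.+1)%N ->
  N i.+1 k = rho k * N i.+1 0 + p%:R * ((t + i.+1%:R) * B i.+1 k + B i k).
Proof.
elim: k => [|k IH] ki; first by rewrite /rho /fallr big_ord0 /=; ring.
(* This is [hc] at the index [a + p (i + 1) - k], which equals [p (t + i + 1) - (t + k)] because
   [(p - 1) t = a]. *)
have Nrec : N i.+1 k.+1 = p%:R * N i k + (p%:R * (t + i.+1%:R) - (t + k%:R)) * N i.+1 k.
  rewrite /N.
  have ep : (a + p * i.+1 - k = (a + p * i.+1 - k.+1).+1)%N by nia.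
  have := hc (a + p * i.+1 - k.+1); rewrite -ep.
  have -> : (p <= a + p * i.+1 - k)%N by nia.
  have -> : (a + p * i.+1 - k - p = a + p * i - k)%N by nia.
  have -> : (a + p * i.+1 - k)%:R = p%:R * (t + i.+1%:R) - (t + k%:R) :> F.
    rewrite natrB; last by nia.
    rewrite natrD natrM -ht; ring.
  rewrite exprS => e.
  have {}e : c (a + p * i.+1 - k.+1)%N =
    (p%:R * (t + i.+1%:R) - (t + k%:R)) * c (a + p * i.+1 - k)%N - c (a + p * i - k)%N.
    by rewrite e addrK.
  by rewrite e; ring.
rewrite Nrec rhoS /=; have := IH (ltnW ki) => {}IH.
rewrite mulrBl {2}IH; ring.
Qed.

Lemma telescope n : (1 - p%:R) * \sum_(i < n.+1) (- p%:R) ^+ i * c (a + p.-1 * i)%N =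
  \sum_(i < n.+1) fallr (- t) i * ((- p%:R) ^+ i * c (a + p * i)%N) - p%:R * B n n.+1.
Proof.
have Ni0 i : (- p%:R) ^+ i * c (a + p * i)%N = N i 0 by rewrite /N subn0.
have Nii i : (- p%:R) ^+ i * c (a + p.-1 * i)%N = N i i.
  by rewrite /N; congr (_ * c _); nia.
elim: n => [|n IH].
  by rewrite !big_ord1 Ni0 Nii /= /fallr big_ord0; ring.
have key : (1 - p%:R) * N n.+1 n.+1 =
    rho n.+1 * N n.+1 0 + p%:R * B n n.+1 - p%:R * B n.+1 n.+2.
  have -> : B n.+1 n.+2 = N n.+1 n.+1 - (t + n.+1%:R) * B n.+1 n.+1 by [].
  by rewrite mulrBl mul1r {1}(tele_step (leqnn n.+1)); ring.
rewrite big_ord_recr mulrDr IH [in RHS]big_ord_recr.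
have -> : (- p%:R) ^+ @ord_max n.+1 * c (a + p.-1 * @ord_max n.+1)%N = N n.+1 n.+1 by rewrite Nii.
have -> : (- p%:R) ^+ @ord_max n.+1 * c (a + p * @ord_max n.+1)%N = N n.+1 0 by rewrite Ni0.
rewrite key -/(rho _).
set S := (X in X - _ + _); set S' := (X in _ = X + _ - _).
have -> : S' = S by [].
by move: S (B n n.+1) (B n.+1 n.+2) => {S'} S b b'; ring.
Qed.

(** For bounding the boundary term: an additive subgroup that is stable under the factors [t + l]
    contains it as soon as it contains the matrix entries. *)
Lemma tele_rem_ind (P : F -> Prop) i k : P 0 -> (forall x y, P x -> P y -> P (x - y)) ->
  (forall l y, P y -> P ((t + l%:R) * y)) -> (forall j, (j < k)%N -> P (N i j)) -> P (B i k).
Proof.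
move=> P0 PB PM; elim: k => [|k IH] PN //=; apply: PB; first exact: PN.
by apply: PM; apply: IH => j jk; apply: PN; rewrite ltnW.
Qed.
End Telescope.

Lemma cancel_frac (F : fieldType) (s x y z : F) : x != 0 -> y != 0 ->
  s * x * y / (x * y * z) = s / z.
Proof.
move=> x0 y0; rewrite -[s * x * y]mulrA [s * _]mulrC -mulf_div divff ?mul1r //.
by rewrite mulf_neq0.
Qed.

Lemma gamneg_rec_frac (F : fieldType) (u q x y z w : F) :
  q != 0 -> x != 0 -> z != 0 -> w != 0 ->
  u * y / w = - z * (- q * u * (x * y) / (w * (q * x * z))).
Proof. by move=> q0 x0 z0 w0; field; rewrite q0 x0 z0 w0. Qed.

(** * Gamma values at negative integers and their ratios *)

Section DworkCoefficients.
Local Notation D := (@fdiff _).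
Variables (p : nat) (p_pr : prime p) (p_odd : odd p).
Local Notation Zp := (padic_int p_pr).
Local Notation Qp := (padic_num p_pr).
Local Notation Gam := (@Gammap p p_pr).
Local Notation "x %:F" := (tofrac x : Qp) (at level 1, format "x %:F") : ring_scope.
Local Notation pideal := (@pideal p p_pr).
Implicit Types (a k l m : nat).

Let p_gt1 : (1 < p)%N := prime_gt1 p_pr.
Let p_gt2 : (2 < p)%N.
Proof. by have := prime_gt1 p_pr; case: p p_odd => [|[|[|]]]. Qed.

(** Iterates [D (g h) = g(m + 1) D h + D g h]. The bounds are assumed at every [m], so the shift of
    [g] does no harm. *)
Lemma pideal_leibniz k (g h : nat -> Qp) (u v : nat -> nat) w :
  (forall i m, (i <= k)%N -> pideal (u i) (iter i D g m)) ->
  (forall i m, (i <= k)%N -> pideal (v i) (iter i D h m)) ->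
  (forall i, (i <= k)%N -> (w <= u i + v (k - i))%N) ->
  forall m, pideal w (iter k D (fun m => g m * h m) m).
Proof.
elim: k g h u v => [|k IH] g h u v hg hh hw m.
  by apply: pidealW (hw 0%N (leqnn 0)) _; apply: pidealM; [apply: (hg 0%N)|apply: (hh 0%N)].
rewrite iterSr (@eq_iter_fdiff _ k _ (fun m => g m.+1 * D h m + D g m * h m)); last first.
  by move=> m'; rewrite /fdiff; ring.
rewrite iter_fdiffD; apply: pidealD.
  apply: (IH (fun m => g m.+1) _ u (fun i => v i.+1)).
  - by move=> i m' ik; rewrite iter_fdiffS; apply: hg; rewrite leqW.
  - by move=> i m' ik; rewrite -iterSr; apply: hh.
  - by move=> i ik; rewrite -subSn //; apply: hw; rewrite leqW.
apply: (IH _ _ (fun i => u i.+1) v).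
- by move=> i m' ik; rewrite -iterSr; apply: hg.
- by move=> i m' ik; apply: hh; rewrite leqW.
- by move=> i ik; have := hw i.+1 ik; rewrite subSS.
Qed.

(* [Gam (- (a + p m))], see [Gam_neg] *)
Definition gamneg a m : Qp := (- p%:R) ^+ m * m`!%:R / (a + p * m)`!%:R.

Lemma factQ_neq0 m : (m`!%:R : Qp) != 0.
Proof. by rewrite Qp_nat_eq0 -lt0n fact_gt0. Qed.

Lemma fact_ndvd_prod m :
  (m`! = p ^ (m %/ p) * (m %/ p)`! * \prod_(1 <= j < m.+1 | ~~ (p %| j)) j)%N.
Proof.
elim: m => [|m IH]; first by rewrite div0n big_geq.
rewrite factS IH [in RHS]big_mkcond big_nat_recr //= -big_mkcond /= divnS ?prime_gt0 //.
case: (boolP (p %| m.+1)%N) => h /=; last by rewrite add0n; ring.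
have e : (m.+1 = (m %/ p).+1 * p)%N.
  by rewrite -{1}(divnK h) divnS ?prime_gt0 // h.
rewrite add1n expnS factS {1}e; ring.
Qed.

Lemma Gam_neg a m : (a < p)%N -> (Gam (- (a + p * m)%:R))%:F = gamneg a m.
Proof.
move=> ap; have := Gam_negnat p_pr p_odd (a + p * m).
have -> : ((a + p * m) %/ p = m)%N.
  by rewrite addnC mulnC divnMDl ?prime_gt0 // divn_small // addn0.
set P := \prod_(_ <= _ < _ | _) _ => e.
have eP : P%:F = (\prod_(1 <= j < (a + p * m).+1 | ~~ (p %| j)) j)%N%:R.
  by rewrite /P -(tofrac_nat p_pr) natr_prod.
have ef := fact_ndvd_prod (a + p * m).
have P0 : P%:F != 0.
  rewrite eP Qp_nat_eq0; apply/eqP => h.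
  by have := fact_gt0 (a + p * m); rewrite ef h muln0.
have -> : gamneg a m = (- 1) ^+ m / P%:F.
  rewrite /gamneg ef; have -> : ((a + p * m) %/ p = m)%N.
    by rewrite addnC mulnC divnMDl ?prime_gt0 // divn_small // addn0.
  rewrite 2!natrM natrX -eP exprNn cancel_frac ?factQ_neq0 //.
  by rewrite expf_neq0 // pQ_neq0.
apply: (mulIf P0); rewrite divfK // -tofracM e rmorphXn /= tofracN tofrac1 //.
Qed.

Lemma pideal_gamneg a m : (a < p)%N -> pideal 0 (gamneg a m).
Proof. by move=> ap; rewrite -Gam_neg //; apply: pideal_int. Qed.

(** The ratio of [gamneg a m] to [gamneg a m.+1]. For [a < p] the omitted index [p - a] is that of
    the only multiple of [p], so by Wilson's theorem the ratio is [1] modulo [p]. *)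
Definition gratio a m : Qp :=
  - \prod_(1 <= j < p.+1 | j != (p - a)%N) (a + p * m + j)%:R.

Lemma fact_addE N s : ((N + s)`! = N`! * \prod_(1 <= j < s.+1) (N + j))%N.
Proof.
elim: s => [|s IH]; first by rewrite big_geq // addn0 muln1.
by rewrite addnS factS IH [in RHS]big_nat_recr //= addnS mulnC mulnA.
Qed.

Lemma gamneg_rec a m : (a < p)%N -> gamneg a m = gratio a m * gamneg a m.+1.
Proof.
move=> ap; rewrite /gamneg /gratio.
have -> : (a + p * m.+1 = a + p * m + p)%N by rewrite mulnS; ring.
rewrite (fact_addE (a + p * m)) (bigD1_seq (p - a)%N) /=; first last.
- exact: iota_uniq.
- by rewrite mem_index_iota; apply/andP; split; lia.
have -> : (a + p * m + (p - a) = p * m.+1)%N by nia.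
set P := (\prod_(1 <= j < p.+1 | j != p - a) _)%N.
have -> : \prod_(1 <= j < p.+1 | j != (p - a)%N) (a + p * m + j)%:R = P%:R :> Qp.
  by rewrite natr_prod.
have P0 : (P%:R : Qp) != 0.
  rewrite natr_prod prodf_seq_neq0; apply/allP => j; rewrite mem_index_iota => /andP[j0 _].
  by apply/implyP => _; rewrite Qp_nat_eq0; lia.
have -> : ((a + p * m)`! * (p * m.+1 * P))%:R = (a + p * m)`!%:R * (p%:R * m.+1%:R * P%:R) :> Qp.
  by rewrite -!natrM.
have -> : (m.+1)`!%:R = m.+1%:R * m`!%:R :> Qp by rewrite -natrM.
rewrite exprS; apply: gamneg_rec_frac => //; first exact: pQ_neq0; last exact: factQ_neq0.
by rewrite Qp_nat_eq0.
Qed.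

End DworkCoefficients.


Lemma gamneg_wrap_frac (F : fieldType) (u q x y z : F) : q != 0 -> x != 0 -> z != 0 ->
  - q * u * (x * y) / (q * x * z) = - (u * y / z).
Proof. by move=> q0 x0 z0; field; rewrite ?q0 ?x0 ?z0 ?oppr_eq0. Qed.

Lemma dcoef_rec_frac0 (F : fieldType) (q x y s t : F) : q != 0 -> x != 0 -> y != 0 ->
  q * x * (s / (- q * x * y)) = - (s + t) / y + t / y.
Proof. by move=> q0 x0 y0; field; rewrite ?q0 ?x0 ?y0 ?oppr_eq0. Qed.

Lemma dcoef_rec_frac (F : fieldType) (q x y s t : F) : q != 0 -> x != 0 -> y != 0 ->
  (s - q * x * t) / (- q * x * y) = s / (- q * x * y) + t / y.
Proof. by move=> q0 x0 y0; field; rewrite ?q0 ?x0 ?y0 ?oppr_eq0. Qed.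

(** * Divisibility of the Mahler coefficients and their recurrence *)

Section DworkCoefficientBounds.
Local Notation D := (@fdiff _).
Variables (p : nat) (p_pr : prime p) (p_odd : odd p).
Local Notation Zp := (padic_int p_pr).
Local Notation Qp := (padic_num p_pr).
Local Notation Gam := (@Gammap p p_pr).
Local Notation "x %:F" := (tofrac x : Qp) (at level 1, format "x %:F") : ring_scope.
Local Notation pideal := (@pideal p p_pr).
Local Notation gratio := (@gratio p p_pr).
Implicit Types (a k l m : nat).

Let p_gt1 : (1 < p)%N := prime_gt1 p_pr.
Let p_gt2 : (2 < p)%N.
Proof. by have := prime_gt1 p_pr; case: p p_odd => [|[|[|]]]. Qed.

Lemma horner_pideal (A : {poly Qp}) x : (forall i, pideal 0 A`_i) -> pideal 1 x ->
  pideal 1 (A.[x] - A`_0) /\ pideal 2 (A.[x] - A`_0 - A`_1 * x).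
Proof.
move=> hA hx; elim/poly_ind: A hA => [|A c IH] hA.
  by rewrite horner0 !coef0 mul0r !subr0; split; apply: pideal0.
have cf i : (A * 'X + c%:P)`_i.+1 = A`_i by rewrite coefD coefMX coefC /= addr0.
have [|IH1 _] := IH; first by move=> i; rewrite -cf.
have c0 : (A * 'X + c%:P)`_0 = c by rewrite coefD coefMX coefC /= add0r.
rewrite hornerMXaddC c0 cf addrK -mulrBl; split; last exact: (pidealM IH1 hx).
apply: pidealMl hx; rewrite -[A.[x]](subrK A`_0); apply: pidealD; first exact: pidealW IH1.
by rewrite -cf.
Qed.

(** Over all [j] the constants run through every residue and the product is ['X^p - 'X]; the omitted
    factor is ['X] itself. *)
Lemma Fp_prod_translate a : (a < p)%N ->
  \prod_(1 <= j < p.+1 | j != (p - a)%N) ('X + ((a + j)%:R)%:P) = 'X^(p.-1) - 1 :> {poly 'F_p}.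
Proof.
move=> ap.
have full : \prod_(1 <= j < p.+1) ('X + ((a + j)%:R)%:P) = 'X^p - 'X :> {poly 'F_p}.
  have := finField_genPoly 'F_p; rewrite card_Fp // => ->.
  rewrite big_add1 /= -[X in index_iota 0 X](Fp_cast p_pr) big_mkord.
  rewrite [RHS](reindex_inj (h := fun x : 'F_p => - (a.+1%:R) - x)) /=; last first.
    by move=> x y /addrI /oppr_inj.
  apply: eq_bigr => x _; congr ('X + _); rewrite -polyCN opprB opprK; congr (_%:P).
  by rewrite -[x in RHS]natr_Zp -natrD addnS -addSn addnC.
have X0 : ('X : {poly 'F_p}) != 0 by rewrite polyX_eq0.
apply: (mulfI X0); rewrite mulrBr mulr1 -exprS prednK ?prime_gt0 // -full.
rewrite [RHS](bigD1_seq (p - a)%N) /= ?iota_uniq // ?mem_index_iota; last by apply/andP; split; lia.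
by rewrite subnKC ?(ltnW ap) // pchar_Fp_0 // addr0.
Qed.

(** Integer coefficients serve two purposes: the value at [p m] in [Q_p] is [- gratio a m], and the
    coefficients can be reduced modulo [p]. *)
Definition ratio_poly a : {poly int} :=
  \prod_(1 <= j < p.+1 | j != (p - a)%N) ('X + ((a + j)%:R)%:P).

Lemma ratio_poly_coef a i : (a < p)%N ->
  ((ratio_poly a)`_i)%:~R = ('X^(p.-1) - 1 : {poly 'F_p})`_i.
Proof.
move=> ap; rewrite -(Fp_prod_translate ap) -coef_map /= /ratio_poly rmorph_prod /=.
by congr (nth _ (polyseq _) _); apply: eq_bigr => j _; rewrite rmorphD /= map_polyX map_polyC /= rmorph_nat.
Qed.

Lemma pideal_dvdz (z : int) : (z%:~R : 'F_p) = 0 -> pideal 1 z%:~R.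
Proof.
move=> /eqP; have hc : p \in [pchar 'F_p] by apply: pchar_Fp.
rewrite -(dvdz_pcharf hc) => /dvdzP[q ->]; rewrite intrM mulrC.
apply: pidealMr; first by have := pideal_pX p_pr 1.
by case: q => q; rewrite ?NegzE ?intrN; [|apply: pidealN]; apply: pideal_nat.
Qed.

Lemma pideal_intr (z : int) : pideal 0 z%:~R.
Proof.
by case: z => q; rewrite ?NegzE ?intrN; [|apply: pidealN]; apply: pideal_nat.
Qed.

Lemma gratio_horner a m :
  gratio a m = - (map_poly intr (ratio_poly a)).[p%:R * m%:R] .
Proof.
rewrite /gratio /ratio_poly rmorph_prod horner_prod; congr (- _).
apply: eq_bigr => j _; rewrite [in RHS]rmorphD /= map_polyX map_polyC /= rmorph_nat.
by rewrite hornerD hornerX hornerC -natrM -natrD; congr (_%:R); ring.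
Qed.

Lemma pideal_prod_affine k (r : seq nat) (P : pred nat) (b : nat -> nat) m :
  pideal k (iter k D (fun m => \prod_(j <- r | P j) (b j + p * m)%:R) m).
Proof.
elim: r k m => [|j r IH] k m.
  rewrite (@eq_iter_fdiff _ k _ (fun=> 1)); last by move=> m'; rewrite big_nil.
  by case: k => [|k]; [exact: pideal1 | rewrite iter_fdiff_cst; exact: pideal0].
rewrite (@eq_iter_fdiff _ k _ (fun m => (if P j then (b j + p * m)%:R else 1) *
   \prod_(j <- r | P j) (b j + p * m)%:R)); last first.
  by move=> m'; rewrite big_cons; case: ifP => _; rewrite ?mul1r.
apply: (pideal_leibniz (u := id) (v := id)) => [i m' _|i m' _|i ik]; first 1 last.
- exact: IH.
- by rewrite subnKC.
case: (P j); last by case: i => [|i]; [exact: pideal1 | rewrite iter_fdiff_cst; exact: pideal0].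
rewrite (@eq_iter_fdiff _ i _ (fun m => ((b j)%:R + p%:R * m%:R) * 1)); last first.
  by move=> m''; rewrite mulr1 natrD natrM.
rewrite iter_fdiff_affine; apply: pidealD.
  case: i => [|i]; last by rewrite iter_fdiff_cst mulr0; exact: pideal0.
  by rewrite mulr1 -natrM -natrD; exact: pideal_nat.
case: i => [|[|i]]; rewrite ?mulr0 ?mul0r; first exact: pideal0.
  by rewrite /= !mulr1; have := pideal_pX p_pr 1.
by rewrite iter_fdiff_cst mulr0; exact: pideal0.
Qed.

(** Modulo [p], [ratio_poly] is ['X^(p-1) - 1]. Its constant term gives the case [i = 0]; since
    [p > 2] its linear coefficient vanishes, which raises the case [i = 1] to [p^2]. From [i = 2]
    on, it is enough that each difference of a product of factors [b + p m] gains one [p]. *)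
Lemma pideal_gratio a i m : (a < p)%N ->
  pideal (if i is 0 then 1 else if i is 1 then 2 else i) (iter i D (fun m => 1 - gratio a m) m).
Proof.
move=> ap.
have hA j : pideal 0 (map_poly intr (ratio_poly a) : {poly Qp})`_j.
  by rewrite coef_map /=; apply: pideal_intr.
have hx k : pideal 1 (p%:R * k%:R).
  by apply: pidealMr; [have := pideal_pX p_pr 1 | exact: pideal_nat].
case: i => [|[|i]].
- rewrite /= gratio_horner opprK.
  have [h _] := horner_pideal hA (hx m).
  set A := map_poly _ _ in h *.
  have -> : 1 + A.[p%:R * m%:R] = (A.[p%:R * m%:R] - A`_0) + (1 + A`_0) by ring.
  apply: pidealD => //; rewrite /A coef_map /= -[1]/(1%:~R) -intrD.
  apply: pideal_dvdz; rewrite intrD ratio_poly_coef // coefB coefXn coef1 /=.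
  by have -> : (0 == p.-1)%N = false; [lia | rewrite sub0r addrN].
- rewrite /= /fdiff.
  have [_ h1] := horner_pideal hA (hx m); have [_ h2] := horner_pideal hA (hx m.+1).
  rewrite !gratio_horner; set A := map_poly _ _ in h1 h2 *.
  set y1 := A.[p%:R * m%:R] in h1 *; set y2 := A.[p%:R * m.+1%:R] in h2 *.
  have -> : 1 - - y2 - (1 - - y1) = (y2 - A`_0 - A`_1 * (p%:R * m.+1%:R))
     - (y1 - A`_0 - A`_1 * (p%:R * m%:R)) + A`_1 * p%:R by rewrite -natr1; ring.
  apply: pidealD; first exact: pidealB.
  apply: (@pidealM _ _ 1 1); last by have := pideal_pX p_pr 1.
  rewrite /A coef_map /=; apply: pideal_dvdz; rewrite ratio_poly_coef // coefB coefXn coef1 /=.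
  by rewrite subr0; have -> : (1 == p.-1)%N = false by lia.
rewrite iterSr.
rewrite (@eq_iter_fdiff _ i.+1 _ (D (fun m => \prod_(1 <= j < p.+1 | j != (p - a)%N) ((a + j) + p * m)%:R))).
  by rewrite -iterSr; apply: pideal_prod_affine.
move=> m'; rewrite /fdiff /gratio.
rewrite !opprK opprD addrACA subrr add0r; congr (_ - _);
by apply: eq_bigr => j _; congr (_%:R); ring.
Qed.

(* [ceil (2 k / 3)]: a rate above [k / 2] is needed because dividing by [k!] may
   cost [k / 2] when [p = 3]; it relies on [gratio] being constant modulo [p^2]. *)
Definition bexp k := ((2 * k + 2) %/ 3)%N.

(** The relation [D gamneg = gamneg(m + 1) (1 - gratio)] bounds a difference of order [k + 1] by
    those of order at most [k]. *)
Lemma pideal_diff_gamneg a k m : (a < p)%N -> pideal (bexp k) (iter k D (gamneg p_pr a) m).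
Proof.
move=> ap; elim/ltn_ind: k m => -[|k] IH m; first exact: pideal_gamneg.
rewrite iterSr (@eq_iter_fdiff _ k _ (fun m => gamneg p_pr a m.+1 * (1 - gratio a m))); last first.
  by move=> m'; rewrite /fdiff [gamneg p_pr a m' in LHS]gamneg_rec //; ring.
apply: (@pideal_leibniz _ _ k (fun m => gamneg p_pr a m.+1) _ bexp
  (fun i => if i is 0 then 1 else if i is 1 then 2 else i)%N).
- by move=> i m' ik; rewrite iter_fdiffS; apply: IH.
- by move=> i m' _; apply: pideal_gratio.
(* The tight case is [k - i = 2], with three more orders of difference for two powers of [p]:
   [bexp (i + 3) = bexp i + 2]. This fixes the slope [2/3]. *)
move=> i ik; rewrite /bexp; have : (k = i + (k - i))%N by lia.
by case: (k - i)%N => [|[|j]] ->; lia.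
Qed.

Lemma pideal_fact k : pideal 0 (p%:R ^+ (k %/ 2) / k`!%:R).
Proof.
have [u uco ek] := pfactor_coprime p_pr (fact_gt0 k).
have := logn_fact_bound p_pr k; set e := logn p k`! in ek *; move=> he.
have he2 : (e <= k %/ 2)%N by nia.
rewrite ek natrM natrX invfM [_^-1 / _]mulrC mulrA -(subnK he2) exprD mulfK.
  apply: (@pidealM _ _ 0 0); last by apply: pideal_inv_nat; rewrite -prime_coprime.
  by rewrite -natrX; apply: pideal_nat.
by rewrite expf_neq0 // pQ_neq0.
Qed.

Lemma pideal_diff_fact a k : (a < p)%N ->
  pideal (bexp k - k %/ 2) (iter k D (gamneg p_pr a) 0 / k`!%:R).
Proof.
move=> ap; have [y ->] := pideal_diff_gamneg k 0 ap.
have h : (k %/ 2 <= bexp k)%N by rewrite /bexp; lia.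
have -> : (p%:R : Qp) ^+ bexp k = p%:R ^+ (bexp k - k %/ 2) * p%:R ^+ (k %/ 2).
  by rewrite -exprD subnK.
rewrite -!mulrA; apply: (@pidealMr _ _ (bexp k - k %/ 2)); first exact: pideal_pX.
rewrite mulrCA; apply: (@pidealM _ _ 0 0); first exact: pideal_int.
by apply: pideal_fact.
Qed.

(* the coefficient of [y^m] in [exp (y + y^p/p)] *)
Definition dcoef m : Qp :=
  iter (m %/ p) D (gamneg p_pr (m %% p)) 0 / ((- p%:R) ^+ (m %/ p) * (m %/ p)`!%:R).

Lemma dcoefE a k : (a < p)%N ->
  dcoef (a + p * k) = iter k D (gamneg p_pr a) 0 / ((- p%:R) ^+ k * k`!%:R).
Proof.
move=> ap; rewrite /dcoef addnC mulnC divnMDl ?prime_gt0 // modnMDl.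
by rewrite divn_small // modn_small // addn0.
Qed.

Lemma dcoef0 : dcoef 0 = 1.
Proof.
by rewrite /dcoef div0n mod0n /= /gamneg muln0 addn0 expr0 fact0 !mulr1 !divr1.
Qed.

Lemma gamneg_shift a m : (a + p * m).+1%:R * gamneg p_pr a.+1 m = gamneg p_pr a m.
Proof.
rewrite /gamneg addSn factS natrM invfM mulrCA [X in _ * X]mulrA divff ?mul1r //.
by rewrite Qp_nat_eq0.
Qed.

Lemma gamneg_wrap m : gamneg p_pr 0 m.+1 = - gamneg p_pr p.-1 m.
Proof.
rewrite /gamneg add0n mulnS.
have -> : (p + p * m = (p.-1 + p * m).+1)%N by lia.
have -> : ((p.-1 + p * m).+1)`!%:R = p%:R * m.+1%:R * (p.-1 + p * m)`!%:R :> Qp.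
  by rewrite factS -!natrM; congr (_ * _)%:R; lia.
have -> : (m.+1)`!%:R = m.+1%:R * m`!%:R :> Qp by rewrite -natrM.
rewrite exprS gamneg_wrap_frac ?pQ_neq0 ?factQ_neq0 //.
by rewrite Qp_nat_eq0.
Qed.

(** Coefficient form of [f' = (1 + y^(p-1)) f] for [f = exp (y + y^p/p)]. It comes from the
    relations between gamma values at neighbouring residues: [gamneg_shift] inside a block of length
    [p], [gamneg_wrap] across its end. *)
Lemma dcoef_rec m : m.+1%:R * dcoef m.+1 =
  dcoef m + (if (p <= m.+1)%N then dcoef (m.+1 - p)%N else 0).
Proof.
have em := divn_eq m.+1 p; have lt : (m.+1 %% p < p)%N by rewrite ltn_mod prime_gt0.
move: (m.+1 %/ p)%N (m.+1 %% p)%N em lt => k a; rewrite mulnC addnC => em lt.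
have nz q : (- p%:R : Qp) ^+ q * q`!%:R != 0.
  by rewrite mulf_neq0 ?factQ_neq0 // expf_neq0 // oppr_eq0 pQ_neq0.
have nzS q : (- p%:R : Qp) * q.+1%:R != 0.
  by rewrite mulf_neq0 ?oppr_eq0 ?pQ_neq0 // Qp_nat_eq0.
have fS q : (- p%:R : Qp) ^+ q.+1 * (q.+1)`!%:R = - p%:R * q.+1%:R * ((- p%:R) ^+ q * q`!%:R).
  have -> : (q.+1)`!%:R = q.+1%:R * q`!%:R :> Qp by rewrite -natrM.
  by rewrite exprS; ring.
case: a lt em => [|a] lt em.
  case: k em => [|k] em; first by rewrite muln0 in em.
  have em' : m = (p.-1 + p * k)%N by rewrite mulnS in em; lia.
  have -> : (p <= m.+1)%N by rewrite em mulnS; lia.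
  have -> : (m.+1 - p = 0 + p * k)%N by rewrite em mulnS; lia.
  rewrite em em' !dcoefE ?prime_gt0 //; last by lia.
  have e : iter k D (gamneg p_pr p.-1) 0 = - (iter k.+1 D (gamneg p_pr 0) 0 + iter k D (gamneg p_pr 0) 0).
    rewrite iterS /fdiff subrK -iter_fdiffS -iter_fdiffN.
    by apply: eq_iter_fdiff => q; rewrite gamneg_wrap opprK.
  rewrite add0n e fS natrM; apply: dcoef_rec_frac0; [exact: pQ_neq0 | | exact: nz].
  by rewrite Qp_nat_eq0.
have em' : m = (a + p * k)%N by lia.
have rec : (a.+1 + p * k)%:R * iter k D (gamneg p_pr a.+1) 0 =
    iter k D (gamneg p_pr a) 0 - p%:R * k%:R * iter k.-1 D (gamneg p_pr a.+1) 0.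
  have -> : iter k D (gamneg p_pr a) 0 = iter k D (fun m => ((a.+1)%:R + p%:R * m%:R) * gamneg p_pr a.+1 m) 0.
    by apply: eq_iter_fdiff => q; rewrite -natrM -natrD gamneg_shift.
  rewrite iter_fdiff_affine natrD natrM mulr0 addr0 mulrDl -addrA; congr (_ + _).
  case: k {em em'} => [|k]; first by rewrite mulr0 !mul0r subrr.
  by rewrite -mulrBr; congr (_ * _); rewrite iterS /fdiff addrC opprB addrC subrK.
rewrite em em' !dcoefE //; last by rewrite ltnW.
case: k em em' rec => [|k] em em' rec.
  have -> : (p <= a.+1 + p * 0)%N = false by lia.
  by rewrite mulrA rec mulr0 mul0r subr0 addr0.
have -> : (p <= a.+1 + p * k.+1)%N by rewrite mulnS; lia.
have -> : (a.+1 + p * k.+1 - p = a.+1 + p * k)%N by rewrite mulnS; lia.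
rewrite dcoefE // mulrA rec fS [k.+1.-1]/=.
by apply: dcoef_rec_frac; [exact: pQ_neq0 | rewrite Qp_nat_eq0 | exact: nz].
Qed.

End DworkCoefficientBounds.


(** * Gamma values at [a/(p-1)] as limits of truncated traces *)

Section GrossKoblitz.
Local Notation D := (@fdiff _).
Variables (p : nat) (p_pr : prime p) (p_odd : odd p).
Local Notation Zp := (padic_int p_pr).
Local Notation Qp := (padic_num p_pr).
Local Notation Gam := (@Gammap p p_pr).
Local Notation "x %:F" := (tofrac x : Qp) (at level 1, format "x %:F") : ring_scope.
Local Notation pideal := (@pideal p p_pr).
Local Notation dcoef := (@dcoef p p_pr).
Implicit Types (a k l m : nat).

Let p_gt1 : (1 < p)%N := prime_gt1 p_pr.
Let p_gt2 : (2 < p)%N.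
Proof. by have := prime_gt1 p_pr; case: p p_odd => [|[|[|]]]. Qed.

Lemma pideal_fallr_sub r (x y : Qp) k : pideal 0 x -> pideal 0 y -> pideal r (x - y) ->
  pideal 0 (fallr x k) /\ pideal r (fallr x k - fallr y k).
Proof.
move=> hx hy hxy; elim: k => [|k [IH0 IH]].
  by rewrite /fallr !big_ord0 subrr; split; [exact: pideal1 | exact: pideal0].
have hy' j : pideal 0 (y - j%:R) by apply: pidealB => //; apply: pideal_nat.
have hx' j : pideal 0 (x - j%:R) by apply: pidealB => //; apply: pideal_nat.
rewrite /fallr !big_ord_recr /= -!/(fallr _ _); split; first exact: (@pidealM _ _ 0 0).
have -> : fallr x k * (x - k%:R) - fallr y k * (y - k%:R) =
   fallr x k * (x - y) + (fallr x k - fallr y k) * (y - k%:R) by ring.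
by apply: pidealD; [apply: pidealMl | apply: pidealMr].
Qed.

Lemma dcoef_scaled a k : (a < p)%N ->
  (- p%:R) ^+ k * dcoef (a + p * k) = iter k D (gamneg p_pr a) 0 / k`!%:R.
Proof.
move=> ap; rewrite dcoefE // invfM mulrCA [_ * (_ / _)]mulrA divff ?mul1r //.
by rewrite expf_neq0 // oppr_eq0 pQ_neq0.
Qed.

Lemma fallr_series_Gam a n : (a < p.-1)%N ->
  pideal (bexp n) (\sum_(k < n) fallr (- (tau p_pr a)%:F) k * ((- p%:R) ^+ k * dcoef (a + p * k))
    - (Gam (tau p_pr a))%:F).
Proof.
move=> ap; have ap' : (a < p)%N by lia.
set r := bexp n; set t := tau p_pr a.
(* [M = a (p^r - 1) / (p - 1)] is a natural number congruent to [- t] modulo [p^r], so that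
   [- (a + p M)] is congruent to [t]. In Newton's formula at [M] the tail has integral binomials,
   and [bexp] bounds it without any loss to [k!]. *)
pose M := (a * \sum_(i < r) p ^ i)%N.
have eM : (p.-1 * M + a = a * p ^ r)%N.
  have := predn_exp p r; rewrite /M mulnCA => <-.
  by rewrite -mulnSr prednK ?pX_gt0.
have uT : (p.-1)%:R * t = a%:R by rewrite tauE.
have tM : res (- t) r = res (M%:R : Zp) r.
  apply/eqP; rewrite -res_sub0; apply/eqP/(res_unit_mul0 (p1_unit p_pr)).
  have -> : (p.-1)%:R * (- t - M%:R) = p%:R ^+ r * - a%:R.
    by rewrite mulrBr mulrN uT -opprD -natrM -natrD addnC eM natrM natrX; ring.
  by apply/eqP/padic_dvdP; eexists.
have tM1 : res (- (a + p * M)%:R : Zp) r = res t r.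
  rewrite natrD natrM opprD; apply/eqP; rewrite -res_sub0; apply/eqP/(res_unit_mul0 (p1_unit p_pr)).
  have -> : (p.-1)%:R * (- a%:R - p%:R * M%:R - t) = p%:R ^+ r * - (p * a)%:R.
    have -> : (p.-1)%:R * (- a%:R - p%:R * M%:R - t) =
      - ((p.-1)%:R * a%:R) - p%:R * ((p.-1)%:R * M%:R) - (p.-1)%:R * t :> Zp by ring.
    rewrite uT -!natrM -!opprD -!natrD.
    have -> : (p.-1 * a + p * (p.-1 * M) + a = p * a * p ^ r)%N by nia.
    by rewrite natrM natrX; ring.
  by apply/eqP/padic_dvdP; eexists.
have hG : pideal r (gamneg p_pr a M - (Gam t)%:F).
  rewrite -Gam_neg // -tofracB; apply/pideal_tofrac/eqP; rewrite res_sub0; apply/eqP.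
  exact: Gam_cong.
have hN : gamneg p_pr a M = \sum_(k < n + M.+1) 'C(M, k)%:R * iter k D (gamneg p_pr a) 0.
  by apply: newton_fdiff; lia.
rewrite big_split_ord /= in hN.
set S1 := \sum_(i < n) _ in hN; set S2 := \sum_(i < M.+1) _ in hN.
have hS2 : pideal r S2.
  apply: pideal_sum => i _; apply: pidealMl; first exact: pideal_nat.
  apply: (@pidealW _ _ (bexp (n + i))); first by rewrite /r /bexp; lia.
  exact: pideal_diff_gamneg.
set S := \sum_(k < n) _.
have hS : pideal r (S - S1).
  rewrite /S /S1 -sumrB; apply: pideal_sum => k _; rewrite dcoef_scaled //.
  have -> : 'C(M, k)%:R * iter k D (gamneg p_pr a) 0 =
     fallr M%:R k * (iter k D (gamneg p_pr a) 0 / k`!%:R).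
    rewrite fallr_nat -bin_ffact natrM -mulrA; congr (_ * _).
    by rewrite mulrCA divff ?mulr1 // factQ_neq0.
  rewrite -mulrBl; apply: pidealMr; last first.
    by apply: (pidealW _ (pideal_diff_fact p_pr p_odd k ap')).
  have [] := @pideal_fallr_sub r (- t%:F) M%:R k; rewrite -?tofracN.
  - exact: pideal_int.
  - exact: pideal_nat.
  - rewrite -tofrac_nat -tofracB; apply/pideal_tofrac/eqP; rewrite res_sub0; exact/eqP.
  by [].
have -> : S - (Gam t)%:F = (S - S1) + (gamneg p_pr a M - (Gam t)%:F) - S2 by rewrite hN; ring.
by apply: pidealB => //; apply: pidealD.
Qed.

(* Boyarsky and Dwork: the sum is the truncated trace, divided by [pi^a], of the
   operator described above [tele_step], and the rate comes from [bexp]. *)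
Lemma dwork_trace a n : (a < p.-1)%N ->
  pideal (n %/ 6) ((1 - p%:R) * \sum_(i < n.+1) (- p%:R) ^+ i * dcoef (a + p.-1 * i)
    - (Gam (tau p_pr a))%:F).
Proof.
move=> ap; have ap' : (a < p)%N by lia.
set t := tau p_pr a.
have ht : (p%:R - 1) * t%:F = a%:R :> Qp.
  have -> : (p%:R - 1 : Qp) = ((p.-1)%:R : Zp)%:F.
    by rewrite tofrac_nat natr_pred ?prime_gt0.
  by rewrite -tofracM tauE tofrac_nat.
rewrite (telescope ht (dcoef_rec p_pr p_odd) p_gt1) addrAC; apply: pidealB.
  by apply: pidealW (fallr_series_Gam n.+1 ap); rewrite /bexp; lia.
apply: pidealMl; first exact: pideal_nat.
apply: tele_rem_ind => [|x y|l y|j jn].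
- exact: pideal0.
- exact: pidealB.
- by apply: pidealMl; apply: pidealD; [exact: pideal_int | exact: pideal_nat].
(* A boundary entry: with [m = m %% p + p k], the [n - k] factors [p] left over and the Mahler term
   of index [k] together give at least order [n %/ 6]. *)
set m := (a + p * n - j)%N; have em : m = (m %% p + p * (m %/ p))%N.
  by rewrite addnC mulnC -divn_eq.
have mp : (m %% p < p)%N by rewrite ltn_mod prime_gt0.
have kn : (m %/ p <= n)%N.
  by rewrite -ltnS ltn_divLR ?prime_gt0 // /m mulSn mulnC; lia.
rewrite em; set k := (m %/ p)%N in kn em *.
rewrite -(subnK kn) exprD -mulrA dcoef_scaled //.
apply: (@pidealW _ _ ((n - k) + (bexp k - k %/ 2))); first by rewrite /bexp; lia.
apply: pidealM; last exact: pideal_diff_fact.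
by rewrite exprNn; apply: pidealMl; [exact: pideal_sgn | exact: pideal_pX].
Qed.

End GrossKoblitz.

(** * The Dwork exponential as an additive character *)

Section PolynomialCongruence.
Variable K : comNzRingType.
Implicit Types A B h : {poly K}.

(** Congruence modulo ['X^N]: polynomials up to this relation play the role of power series. *)
Definition eqX N A B := forall i, (i < N)%N -> A`_i = B`_i.

Lemma eqXM N A A' B B' : eqX N A A' -> eqX N B B' -> eqX N (A * B) (A' * B').
Proof.
move=> hA hB i iN; rewrite !coefM; apply: eq_bigr => j _.
have := ltn_ord j => jn.
by rewrite hA ?hB //; [apply: leq_ltn_trans (leq_subr _ _) iN | apply: leq_ltn_trans iN].
Qed.

Lemma eqX_comp_Xn N d A B : (0 < d)%N -> eqX N A B -> eqX N (A \Po 'X^d) (B \Po 'X^d).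
Proof.
move=> d0 h i iN; rewrite !coef_comp_poly_Xn //; case: ifP => // _; apply: h.
exact: leq_ltn_trans (leq_div _ _) iN.
Qed.

(** The equation [A' = h A] gives [(i + 1) A_(i+1)] in terms of lower coefficients, and [i + 1] can
    be cancelled. Identities between truncated exponentials are reduced in this way to their
    differential equations. *)
Lemma ode_uniq M A B h : (forall n x y, n.+1%:R * x = n.+1%:R * y :> K -> x = y) ->
  A`_0 = B`_0 -> eqX M A^`() (h * A) -> eqX M B^`() (h * B) -> eqX M.+1 A B.
Proof.
move=> reg e0 hA hB i; elim/ltn_ind: i => -[//|i] IH iM.
have e : A^`()`_i = B^`()`_i.
  rewrite hA // hB // !coefM; apply: eq_bigr => j _; congr (_ * _).
  by apply: IH; lia.
by apply: (reg i); move: e; rewrite !coef_deriv !mulr_natl.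
Qed.

Lemma horner_poly_split q N (F : nat -> K) x :
  (\poly_(m < q * N) F m).[x] = \sum_(a < q) \sum_(i < N) F (a + q * i)%N * x ^+ (a + q * i).
Proof.
rewrite horner_poly exchange_big /=; elim: N => [|N IH]; first by rewrite muln0 !big_ord0.
rewrite big_ord_recr /= -IH mulnS addnC big_split_ord /=; congr (_ + _).
by apply: eq_bigr => a _; rewrite addnC.
Qed.

End PolynomialCongruence.

Lemma expr1D_ends (R : comNzRingType) q (y : R) : (1 + y) ^+ q.+2 =
  1 + (q.+2%:R * y + (\sum_(i < q) 'C(q.+2, i.+2)%:R * y ^+ i.+2 + y ^+ q.+2)).
Proof.
rewrite exprDn big_ord_recl big_ord_recl big_ord_recr /= bin0 expr0 !expr1n mul1r mulr1n.
congr (1 + (_ + (_ + _))).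
- by rewrite /bump /= expr1 mul1r bin1 mulr_natl.
- by apply: eq_bigr => i _; rewrite /bump /= !add1n ?expr1n mul1r mulr_natl.
by rewrite /bump /= !add1n binn ?expr1n mul1r mulr1n.
Qed.

(** * Orders in [pi], the truncated Dwork exponential, and additivity *)

Section AdditiveCharacter.
Variables (p : nat) (p_pr : prime p) (p_odd : odd p).
Local Notation Zp := (padic_int p_pr).
Local Notation Qp := (padic_num p_pr).
Local Notation Gam := (@Gammap p p_pr).
Local Notation "x %:F" := (tofrac x : Qp) (at level 1, format "x %:F") : ring_scope.
Local Notation pideal := (@pideal p p_pr).
Local Notation dcoef := (@dcoef p p_pr).
Local Notation w := (teichmuller p_pr).

Variables (K : comNzRingType) (iota : {rmorphism Qp -> K}) (pi : K).
Hypothesis pi_exp : pi ^+ p.-1 = - p%:R.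

Let p_gt1 : (1 < p)%N := prime_gt1 p_pr.
Let p_gt2 : (2 < p)%N.
Proof. by have := prime_gt1 p_pr; case: p p_odd => [|[|[|]]]. Qed.

(** [pi^k Z_p[pi]], where an element of [Z_p[pi]] is given as the value at [pi] of a polynomial over
    [Z_p]. *)
Definition piideal k z :=
  exists A : {poly Zp}, z = pi ^+ k * (map_poly (iota \o @tofrac Zp) A).[pi].

Hypothesis piideal_sep : forall z, (forall k, piideal k z) -> z = 0.

Lemma piideal0 k : piideal k 0.
Proof. by exists 0; rewrite rmorph0 horner0 mulr0. Qed.
Lemma piidealD k y z : piideal k y -> piideal k z -> piideal k (y + z).
Proof. by move=> [A ->] [B ->]; exists (A + B); rewrite rmorphD hornerD mulrDr. Qed.
Lemma piidealN k z : piideal k z -> piideal k (- z).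
Proof. by move=> [A ->]; exists (- A); rewrite rmorphN hornerN mulrN. Qed.
Lemma piidealB k y z : piideal k y -> piideal k z -> piideal k (y - z).
Proof. by move=> hy hz; apply: piidealD => //; apply: piidealN. Qed.
Lemma piidealM k l y z : piideal k y -> piideal l z -> piideal (k + l) (y * z).
Proof.
by move=> [A ->] [B ->]; exists (A * B); rewrite rmorphM hornerM exprD mulrACA.
Qed.
Lemma piideal_pi k : piideal k (pi ^+ k).
Proof. by exists 1; rewrite rmorph1 hornerC mulr1. Qed.
Lemma piidealW k l z : (l <= k)%N -> piideal k z -> piideal l z.
Proof.
move=> /subnKC <- [A ->]; exists ('X^(k - l) * A).
by rewrite rmorphM /= map_polyXn hornerM hornerXn exprD mulrA.
Qed.
Lemma piidealMl k y z : piideal 0 y -> piideal k z -> piideal k (y * z).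
Proof. exact: piidealM. Qed.
Lemma piidealMr k y z : piideal k y -> piideal 0 z -> piideal k (y * z).
Proof. by rewrite mulrC => hy hz; apply: piidealMl. Qed.
Lemma piideal_iota k x : pideal k x -> piideal (p.-1 * k) (iota x).
Proof.
move=> [y ->]; exists (((-1) ^+ k * y)%:P).
rewrite map_polyC hornerC /= !tofracM !rmorphM /= !rmorphXn /= !rmorphN !rmorph1 rmorph_nat.
by rewrite exprM pi_exp exprNn mulrACA -exprMn mulrNN mulr1 expr1n mul1r.
Qed.
Lemma piideal_iota0 x : pideal 0 x -> piideal 0 (iota x).
Proof. by move=> /piideal_iota; rewrite muln0. Qed.
Lemma piideal_nat m : piideal 0 m%:R.
Proof. by rewrite -(rmorph_nat iota); apply: piideal_iota0; apply: pideal_nat. Qed.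
Lemma piideal1 : piideal 0 1. Proof. exact: (piideal_nat 1). Qed.
Lemma piideal_sum k (I : Type) (r : seq I) (P : pred I) (F : I -> K) :
  (forall i, P i -> piideal k (F i)) -> piideal k (\sum_(i <- r | P i) F i).
Proof. by move=> h; elim/big_ind: _ => // *; [exact: piideal0|exact: piidealD]. Qed.
Lemma piidealX z m : piideal 0 z -> piideal 0 (z ^+ m).
Proof.
move=> h; elim: m => [|m IH]; first exact: piideal1.
by rewrite exprS; exact: (@piidealM 0 0).
Qed.

Lemma piideal_p : piideal p.-1 p%:R.
Proof. by have := piideal_pi p.-1; rewrite pi_exp => /piidealN; rewrite opprK. Qed.

Lemma pi_fact k : piideal 0 (pi ^+ k * iota (k`!%:R^-1)).
Proof.
have [u uco ek] := pfactor_coprime p_pr (fact_gt0 k).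
have := logn_fact_bound p_pr k; set e := logn p k`! in ek *; move=> he.
have ep : (- p%:R) ^+ e = (-1) ^+ e * iota (p%:R ^+ e) by rewrite rmorphXn rmorph_nat exprNn.
have e1 : iota (p%:R ^+ e) * iota (p%:R ^+ e)^-1 = 1.
  by rewrite -rmorphM divff ?rmorph1 // expf_neq0 // pQ_neq0.
rewrite ek -(subnK he) exprD exprM pi_exp natrM natrX invfM rmorphM /= ep.
move: e1; move: (iota (p%:R ^+ e)) (iota (p%:R ^+ e)^-1) => v v' e1.
have -> : pi ^+ (k - p.-1 * e) * ((-1) ^+ e * v) * (iota u%:R^-1 * v') =
    pi ^+ (k - p.-1 * e) * (-1) ^+ e * iota u%:R^-1 * (v * v') by ring.
rewrite e1 mulr1.
apply: (@piidealM 0 0); last by apply: piideal_iota0; apply: pideal_inv_nat; rewrite -prime_coprime.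
apply: (@piidealM 0 0); first by apply: piidealW (piideal_pi _).
by apply: piidealX; apply: piidealN; apply: piideal1.
Qed.

(** The coefficient of [x^m] in [exp (pi (x - x^p))]: put [y = pi x] in [exp (y + y^p/p)] and use
    [pi^p = - p pi]. *)
Definition theta m := pi ^+ m * iota (dcoef m).

(** For [m = a + p k] the powers [pi^((p-1) k)] and [(- p)^k] cancel and [pi^k / k!] is integral.
    This leaves the order [a + (p - 1) bexp k], which is at least [m / 3]. *)
Lemma piideal_theta m : piideal ((m + 2) %/ 3) (theta m).
Proof.
have em : m = (m %% p + p * (m %/ p))%N.
  by rewrite addnC mulnC -divn_eq.
have ap : (m %% p < p)%N by rewrite ltn_mod prime_gt0.
move: (m %% p)%N (m %/ p)%N em ap => a k -> ap {m}.
rewrite /theta dcoefE // exprD -{2}(prednK (prime_gt0 p_pr)) mulSn exprD exprM pi_exp.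
set y := iter _ _ _ _.
have -> : pi ^+ a * (pi ^+ k * (- p%:R) ^+ k) * iota (y / ((- p%:R) ^+ k * k`!%:R)) =
  pi ^+ a * (pi ^+ k * iota (k`!%:R^-1)) * iota y.
  have -> : (- p%:R : K) ^+ k = iota ((- p%:R) ^+ k) by rewrite rmorphXn rmorphN rmorph_nat.
  have q1 : iota ((- p%:R) ^+ k) * iota (((- p%:R) ^+ k)^-1) = 1.
    by rewrite -rmorphM divff ?rmorph1 // expf_neq0 // oppr_eq0 pQ_neq0.
  rewrite invfM !rmorphM /=.
  move: q1; move: (iota ((- p%:R) ^+ k)) (iota (((- p%:R) ^+ k)^-1)) => v v' q1.
  have -> : pi ^+ a * (pi ^+ k * v) * (iota y * (v' * iota k`!%:R^-1)) =
    pi ^+ a * (pi ^+ k * iota k`!%:R^-1) * iota y * (v * v') by ring.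
  by rewrite q1 mulr1.
apply: (@piidealW (a + 0 + p.-1 * bexp k)).
  rewrite addn0; have : (p.-1 * (2 * k) <= p.-1 * (3 * bexp k))%N.
    by rewrite leq_mul2l /bexp; lia.
  have : (p * k <= p.-1 * (2 * k))%N by nia.
  lia.
apply: piidealM; last by apply: piideal_iota; exact: pideal_diff_gamneg.
by apply: piidealM; [exact: piideal_pi | exact: pi_fact].
Qed.

Lemma theta_rec m : m.+1%:R * theta m.+1 =
  pi * theta m - p%:R * pi * (if (p.-1 <= m)%N then theta (m - p.-1) else 0).
Proof.
have := congr1 iota (dcoef_rec p_pr p_odd m); rewrite rmorphM rmorph_nat rmorphD /= => e.
rewrite /theta mulrCA e mulrDr exprS -!mulrA; congr (_ + _).
have -> : (p <= m.+1)%N = (p.-1 <= m)%N by lia.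
case: ifP => h; last by rewrite rmorph0 !mulr0 oppr0.
have -> : (m.+1 - p = m - p.-1)%N by lia.
have -> : pi ^+ m = pi ^+ (m - p.-1) * - p%:R by rewrite -pi_exp -exprD subnK.
by ring.
Qed.

(** Order at least [i / 3], rounded up, in the [i]-th coefficient. Rounding up is subadditive, so
    products keep this rate. *)
Definition goodp (A : {poly K}) := forall i, piideal ((i + 2) %/ 3) A`_i.

Lemma goodpD A B : goodp A -> goodp B -> goodp (A + B).
Proof. by move=> hA hB i; rewrite coefD; apply: piidealD. Qed.
Lemma goodpN A : goodp A -> goodp (- A).
Proof. by move=> hA i; rewrite coefN; apply: piidealN. Qed.
Lemma goodpM A B : goodp A -> goodp B -> goodp (A * B).
Proof.
move=> hA hB i; rewrite coefM; apply: piideal_sum => j _.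
apply: piidealW (piidealM (hA j) (hB (i - j)%N)); have := ltn_ord j; lia.
Qed.
Lemma goodp1 : goodp 1.
Proof. by move=> i; rewrite coef1; case: i => [|i] /=; [exact: piideal1|exact: piideal0]. Qed.
Lemma goodpX A n : goodp A -> goodp (A ^+ n).
Proof.
by move=> hA; elim: n => [|n IH]; [exact: goodp1 | rewrite exprS; exact: goodpM].
Qed.

(** Turns a congruence modulo ['X^M] into one modulo a power of [pi] at integral points; this stands
    in for convergence on the closed unit disc. *)
Lemma goodp_horner M A x : goodp A -> eqX M A 0 -> piideal 0 x -> piideal ((M + 2) %/ 3) A.[x].
Proof.
move=> hA h0 hx; rewrite horner_coef; apply: piideal_sum => i _.
apply: piidealMr; last exact: piidealX.
case: (ltnP i M) => h; first by rewrite h0 // coef0; exact: piideal0.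
by apply: piidealW (hA i); lia.
Qed.

Definition expp M z : {poly K} := \poly_(i < M) (z ^+ i * iota (i`!%:R^-1)).

Lemma iota_natK m : (0 < m)%N -> m%:R * iota (m%:R^-1) = 1.
Proof.
move=> m0; rewrite -(rmorph_nat iota) -rmorphM divff ?rmorph1 //.
by rewrite Qp_nat_eq0 -lt0n.
Qed.

Lemma nat_reg n x y : n.+1%:R * x = n.+1%:R * y :> K -> x = y.
Proof.
move=> h; rewrite -[x]mul1r -[y]mul1r -(iota_natK (ltn0Sn n)) ![_ * iota _]mulrC.
by rewrite -!mulrA h.
Qed.

Lemma expp_deriv M z : eqX M (expp M.+1 z)^`() (z%:P * expp M.+1 z).
Proof.
move=> i iM; rewrite coef_deriv coefCM !coef_poly ltnS iM ltnW //.
rewrite -[LHS]mulr_natl exprS factS natrM invfM rmorphM /=.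
have := iota_natK (ltn0Sn i); move: (iota i.+1%:R^-1) (iota i`!%:R^-1) => u v hu.
have -> : i.+1%:R * (z * z ^+ i * (u * v)) = i.+1%:R * u * (z * (z ^+ i * v)) by ring.
by rewrite hu mul1r.
Qed.

Lemma expp_coef0 M z : (expp M.+1 z)`_0 = 1.
Proof. by rewrite coef_poly /= fact0 invr1 rmorph1 mulr1. Qed.

Lemma goodp_expp M c : c = 1 \/ c = -1 -> goodp (expp M (c * p%:R * pi)).
Proof.
move=> hc i; rewrite coef_poly; case: ifP => _; last exact: piideal0.
rewrite !exprMn -[_ * iota _]mulrA; apply: (@piidealW (p.-1 * i + 0)); first by nia.
apply: piidealM; last exact: pi_fact.
apply: piidealMl; first by apply: piidealX; case: hc => ->; [|apply: piidealN]; exact: piideal1.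
by have := @piideal_iota i (p%:R ^+ i) (pideal_pX _ _); rewrite rmorphXn rmorph_nat.
Qed.

Lemma goodp_expp_comp M c : c = 1 \/ c = -1 -> goodp (expp M (c * p%:R * pi) \Po 'X^p).
Proof.
move=> hc i; rewrite coef_comp_poly_Xn ?prime_gt0 //.
case: ifP => hp; last exact: piideal0.
rewrite coef_poly; case: ifP => _; last exact: piideal0.
rewrite !exprMn -[_ * iota _]mulrA; apply: (@piidealW (p.-1 * (i %/ p) + 0)).
  by rewrite -{1}(divnK hp); nia.
apply: piidealM; last exact: pi_fact.
apply: piidealMl; first by apply: piidealX; case: hc => ->; [|apply: piidealN]; exact: piideal1.
by have := @piideal_iota (i %/ p) (p%:R ^+ (i %/ p)) (pideal_pX _ _); rewrite rmorphXn rmorph_nat.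
Qed.

Definition thetap M : {poly K} := \poly_(m < M) theta m.

Lemma goodp_theta M : goodp (thetap M).
Proof.
move=> i; rewrite coef_poly; case: ifP => _; last exact: piideal0.
exact: piideal_theta.
Qed.

Lemma thetap_deriv M : eqX M (thetap M.+1)^`() ((pi%:P - (p%:R * pi)%:P * 'X^(p.-1)) * thetap M.+1).
Proof.
move=> i iM; rewrite coef_deriv mulrBl coefB -mulrA !coefCM coefXnM !coef_poly ltnS iM.
rewrite (leqW iM) -[LHS]mulr_natl theta_rec; congr (_ - _ * _).
case: (ltnP i p.-1) => // h; rewrite (leq_ltn_trans (leq_subr _ _)) //.
by rewrite ltnW.
Qed.

(* [(exp (pi X - pi X^p))^p = exp (p pi X) exp (- p pi X^p)] *)
Lemma thetap_exp M : eqX M.+1 (thetap M.+1 ^+ p)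
  (expp M.+1 (p%:R * pi) * (expp M.+1 (- p%:R * pi) \Po 'X^p)).
Proof.
set h := pi%:P - (p%:R * pi)%:P * 'X^(p.-1).
apply: (@ode_uniq _ M _ _ (p%:R%:P * h)).
- exact: nat_reg.
- rewrite -!horner_coef0 horner_exp hornerM horner_comp hornerXn expr0n.
  rewrite gtn_eqF ?prime_gt0 // !horner_coef0 !expp_coef0 coef_poly /theta.
  by rewrite dcoef0 rmorph1 expr0 !mul1r expr1n.
- have -> : p%:R%:P * h * thetap M.+1 ^+ p = p%:R%:P * ((h * thetap M.+1) * thetap M.+1 ^+ p.-1).
    by rewrite -mulrA -[h * _ * _]mulrA -exprS prednK ?prime_gt0.
  have -> : (thetap M.+1 ^+ p)^`() = p%:R%:P * ((thetap M.+1)^`() * thetap M.+1 ^+ p.-1).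
    by rewrite deriv_exp polyC_natr mulr_natl.
  by apply: eqXM => //; apply: eqXM => //; exact: thetap_deriv.
rewrite derivM deriv_comp derivXn.
set E1 := expp _ _; set E2 := expp _ _.
have -> : p%:R%:P * h * (E1 * (E2 \Po 'X^p)) =
   ((p%:R * pi)%:P * E1) * (E2 \Po 'X^p) +
   E1 * ((((- p%:R * pi)%:P * E2) \Po 'X^p) * ('X^(p.-1) *+ p)).
  rewrite comp_polyM comp_polyC /h -['X^_ *+ p]mulr_natl !polyCM polyCN polyC_natr; ring.
move=> i iM; rewrite !coefD; congr (_ + _).
  by apply: (eqXM (N := M)) iM => //; exact: expp_deriv.
apply: (eqXM (N := M)) iM => //; apply: eqXM => //.
by apply: eqX_comp_Xn; [exact: prime_gt0 | exact: expp_deriv].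
Qed.

Lemma expp_inv M : eqX M.+1 (expp M.+1 (p%:R * pi) * expp M.+1 (- p%:R * pi)) 1.
Proof.
apply: (@ode_uniq _ M _ _ 0).
- exact: nat_reg.
- by rewrite coefM big_ord1 subn0 !expp_coef0 mulr1 coef1.
- rewrite derivM.
  have -> : 0 * (expp M.+1 (p%:R * pi) * expp M.+1 (- p%:R * pi)) =
     ((p%:R * pi)%:P * expp M.+1 (p%:R * pi)) * expp M.+1 (- p%:R * pi) +
     expp M.+1 (p%:R * pi) * ((- p%:R * pi)%:P * expp M.+1 (- p%:R * pi)).
    by rewrite !polyCM polyCN; ring.
  move=> i iM; rewrite !coefD; congr (_ + _);
  by apply: (eqXM (N := M)) iM => //; exact: expp_deriv.
by move=> i _; rewrite mul0r -polyC1 derivC.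
Qed.

Lemma thetap_root M x : piideal 0 x -> x ^+ p = x ->
  piideal ((M.+1 + 2) %/ 3) ((thetap M.+1).[x] ^+ p - 1).
Proof.
move=> hx xp.
set E1 := expp M.+1 (p%:R * pi); set E2 := expp M.+1 (- p%:R * pi).
have g1 : goodp E1 by rewrite /E1 -[p%:R]mul1r; apply: goodp_expp; left.
have g2 : goodp E2 by rewrite /E2 -[- p%:R]mulN1r; apply: goodp_expp; right.
have g3 : goodp (E2 \Po 'X^p) by rewrite /E2 -[- p%:R]mulN1r; apply: goodp_expp_comp; right.
(* At [x^p = x] the composed factor takes the value [E2.[x]], so both errors are values of
   polynomials that vanish modulo ['X^(M+1)]. *)
have -> : (thetap M.+1).[x] ^+ p - 1 =
   (thetap M.+1 ^+ p - E1 * (E2 \Po 'X^p)).[x] + (E1 * E2 - 1).[x].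
  rewrite !hornerD !hornerN horner_exp !hornerM horner_comp hornerXn xp (hornerC 1); ring.
apply: piidealD; apply: goodp_horner => //.
- apply: goodpD; first by apply: goodpX; exact: goodp_theta.
  by apply: goodpN; apply: goodpM.
- by move=> i iM; rewrite coefB thetap_exp // subrr coef0.
- by apply: goodpD; [apply: goodpM | apply: goodpN; exact: goodp1].
by move=> i iM; rewrite coefB expp_inv // subrr coef0.
Qed.


Definition gcoef a := pi ^+ a * iota ((Gam (tau p_pr a))%:F / (1 - p%:R)).
Definition wK x := iota (w x)%:F.
(** The value at [0] is set apart because the sum would give [gcoef 0 = 1 / (1 - p)] there. *)
Definition addchar x := if x == 0 then 1 else \sum_(a < p.-1) gcoef a * wK x ^+ a.

Lemma one_subp : 1 - p%:R = - (p.-1)%:R :> Qp.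
Proof. by rewrite -opprB natr_pred ?prime_gt0. Qed.

Lemma pideal_inv_1p : pideal 0 ((1 - p%:R)^-1).
Proof.
by rewrite one_subp invrN; apply: pidealN; apply: pideal_inv_nat; exact: p1_ndvd.
Qed.

Lemma oneBp_neq0 : 1 - p%:R != 0 :> Qp.
Proof. by rewrite one_subp oppr_eq0 Qp_nat_eq0; lia. Qed.

Lemma wK_piideal x : piideal 0 (wK x).
Proof. by apply: piideal_iota0; apply: pideal_int. Qed.

Lemma wK_expp x : wK x ^+ p = wK x.
Proof. by rewrite /wK -rmorphXn -tofracXn teich_expp. Qed.

Lemma wK_expp1 x : x != 0 -> wK x ^+ p.-1 = 1.
Proof. by move=> x0; rewrite /wK -rmorphXn -tofracXn teich_expp1 // tofrac1 rmorph1. Qed.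

Lemma wKM x y : wK (x * y) = wK x * wK y.
Proof. by rewrite /wK teichM tofracM rmorphM. Qed.

Lemma piideal_gcoef a : piideal a (gcoef a).
Proof.
apply: piidealMr; first exact: piideal_pi.
by apply: piideal_iota0; apply: (@pidealM _ _ 0 0); [exact: pideal_int | exact: pideal_inv_1p].
Qed.

Lemma piideal_addchar x : piideal 0 (addchar x).
Proof.
rewrite /addchar; case: ifP => _; first exact: piideal1.
apply: piideal_sum => a _; apply: (@piidealM 0 0); first by apply: piidealW (piideal_gcoef a).
exact/piidealX/wK_piideal.
Qed.

(** Where [x^(p-1) = 1] the exponents of [thetap] fold modulo [p - 1], and the folded coefficient of
    [x^a] is [pi^a] times the truncated sum of [dwork_trace]. *)
Lemma addchar_approx n x : x != 0 ->
  piideal (n %/ 6) (addchar x - (thetap (p.-1 * n.+1)).[wK x]).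
Proof.
move=> x0; rewrite /addchar (negPf x0) /thetap horner_poly_split -sumrB.
apply: piideal_sum => a _.
rewrite (eq_bigr (fun i : 'I_n.+1 => pi ^+ a *
    iota ((- p%:R) ^+ i * dcoef (a + p.-1 * i)) * wK x ^+ a)); last first.
  move=> i _; rewrite /theta !exprD !exprM pi_exp wK_expp1 // expr1n mulr1.
  have -> : (- p%:R : K) ^+ i = iota ((- p%:R) ^+ i) by rewrite rmorphXn rmorphN rmorph_nat.
  by move: (dcoef _) => c; rewrite (rmorphM iota); ring.
rewrite -mulr_suml -mulr_sumr -rmorph_sum /= /gcoef -mulrBl -mulrBr -rmorphB.
apply: piidealMr; last exact/piidealX/wK_piideal.
apply: piidealMl; first by apply: piidealW (piideal_pi a).
apply: (@piidealW (p.-1 * (n %/ 6))); first by rewrite leq_pmull //; lia.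
apply: piideal_iota.
have h := dwork_trace p_pr p_odd n (ltn_ord a).
set S := \sum_(i < n.+1) _ in h *.
have -> : (Gam (tau p_pr a))%:F / (1 - p%:R) - S =
    - ((1 - p%:R) * S - (Gam (tau p_pr a))%:F) * (1 - p%:R)^-1.
  by rewrite opprB mulrBl mulrAC divff ?mul1r // oneBp_neq0.
by apply: pidealMr; [exact: pidealN | exact: pideal_inv_1p].
Qed.

Lemma piideal_subXX k x y n : piideal 0 x -> piideal 0 y -> piideal k (x - y) -> piideal k (x ^+ n - y ^+ n).
Proof.
move=> hx hy h; elim: n => [|n IH]; first by rewrite subrr; exact: piideal0.
have -> : x ^+ n.+1 - y ^+ n.+1 = x ^+ n * (x - y) + (x ^+ n - y ^+ n) * y by rewrite !exprSr; ring.
by apply: piidealD; [apply: piidealMl => //; exact: piidealX | exact: piidealMr].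
Qed.

Lemma addchar_root x : addchar x ^+ p = 1.
Proof.
case: (eqVneq x 0) => [->|x0]; first by rewrite /addchar eqxx expr1n.
apply/eqP; rewrite -subr_eq0; apply/eqP/piideal_sep => k.
pose n := (6 * k)%N; set M := (p.-1 * n.+1)%N.
have M0 : (0 < M)%N by rewrite muln_gt0; lia.
have h := addchar_approx n x0.
rewrite -/M in h; set y := (thetap M).[_] in h.
have hk : (n %/ 6 = k)%N by rewrite /n mulKn.
have hy : piideal 0 y.
  have -> : y = addchar x - (addchar x - y) by ring.
  by apply: piidealB; [exact: piideal_addchar | apply: piidealW h].
have -> : addchar x ^+ p - 1 = (addchar x ^+ p - y ^+ p) + (y ^+ p - 1) by ring.
apply: piidealD; first by apply: piideal_subXX => //; [exact: piideal_addchar | rewrite -hk].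
apply: (@piidealW ((M.-1.+1 + 2) %/ 3)); first by rewrite prednK // /M /n; nia.
by rewrite /y -(prednK M0); apply: thetap_root; [exact: wK_piideal | exact: wK_expp].
Qed.

(** [1 / (p - 1)] is [-1] modulo [p], and [Gam (-1) = 1] by the functional equation. This makes the
    first-order term of [addchar] equal to [pi * wK x] modulo [pi^2]. *)
Lemma Gam_tau1 : pideal 1 ((Gam (tau p_pr 1))%:F - 1).
Proof.
have e : Gam (-1) = 1.
  have := GamS p_odd (-1 : Zp); rewrite addNr (Gam_nat p_pr p_odd 0) opprK.
  have -> : (res (-1 : Zp) 1 == 0%N) = false.
    rewrite -sub0r res_sub0 res0 (res_nat p_pr 1) expn1 modn_small ?prime_gt1 //.
  by rewrite mulr1 /morita_nat expr0 big_geq // mul1r => <-.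
rewrite -tofrac1 -tofracB; apply/pideal_tofrac/eqP; rewrite res_sub0 -e; apply/eqP.
apply: Gam_cong => //; apply/eqP; rewrite -res_sub0; apply/eqP/(res_unit_mul0 (p1_unit p_pr)).
rewrite mulrBr tauE mulrN1 opprK -(natrD _ 1 p.-1) add1n prednK ?prime_gt0 //.
by rewrite res_nat expn1 modnn.
Qed.

Lemma addchar_near1 x : piideal 2 (addchar x - 1 - pi * wK x).
Proof.
rewrite /addchar; case: (eqVneq x 0) => [->|x0].
  by rewrite /wK teich0 tofrac0 rmorph0 mulr0 subr0 subrr; exact: piideal0.
have pp : (1 < p.-1)%N by lia.
have -> : p.-1 = (p.-1.-2).+2 by lia.
rewrite !big_ord_recl /= !expr0 expr1 !mulr1.
set S := \sum_(i < _) _.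
have -> : gcoef 0 + (gcoef 1 * wK x + S) - 1 - pi * wK x =
   (gcoef 0 - 1) + (gcoef 1 - pi) * wK x + S by ring.
apply: piidealD; last first.
  apply: piideal_sum => i _; apply: piidealMr; last exact/piidealX/wK_piideal.
  by apply: piidealW (piideal_gcoef _); rewrite /bump /=.
have hinv : pideal 1 ((1 - p%:R)^-1 - 1 : Qp).
  have -> : (1 - p%:R)^-1 - 1 = p%:R * (1 - p%:R)^-1 :> Qp.
    by apply: (mulIf oneBp_neq0); rewrite mulrBl divfK ?oneBp_neq0 // mulVf ?oneBp_neq0 //; ring.
  by apply: pidealMr; [have := pideal_pX p_pr 1 | exact: pideal_inv_1p].
apply: piidealD.
  rewrite /gcoef expr0 mul1r Gam_tau0 // tofrac1 mul1r -(rmorph1 iota) -rmorphB.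
  by apply: piidealW (piideal_iota hinv); lia.
apply: piidealMr; last exact: wK_piideal.
rewrite /gcoef expr1 -{2}[pi]mulr1 -mulrBr -(rmorph1 iota) -rmorphB.
apply: (@piidealW (1 + p.-1 * 1)); first by lia.
apply: piidealM; first exact: (piideal_pi 1).
apply: piideal_iota.
set g := (Gam _)%:F.
have -> : g / (1 - p%:R) - 1 = (g - 1) / (1 - p%:R) + ((1 - p%:R)^-1 - 1).
  by rewrite mulrBl mul1r addrA subrK.
by apply: pidealD => //; apply: pidealMr; [exact: Gam_tau1 | exact: pideal_inv_1p].
Qed.

Lemma p_unitK y : p%:R * y = 0 :> K -> y = 0.
Proof.
move=> h; rewrite -[y]mul1r -(iota_natK (prime_gt0 p_pr)) mulrAC h mul0r //.
Qed.

Lemma root1_near1 z : z ^+ p = 1 -> piideal 2 (z - 1) -> z = 1.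
Proof.
move=> zp [A]; set v := horner _ _ => hv.
have hv0 : piideal 0 v by exists A; rewrite mul1r.
set y := z - 1 in hv; have ez : z = 1 + y by rewrite /y addrC subrK.
(* [z^p - 1 = p y (1 + T)]: the middle binomials are divisible by [p], and [y = pi^2 v] gives
   [y^(p-1) = p^2 v^(p-1)]. Then [y = - T y] with [T] of order 2 pushes [y] into every ideal. *)
pose T := \sum_(i < p.-2) ('C(p, i.+2) %/ p)%:R * y ^+ i.+1 + p%:R * v ^+ p.-1.
have hy : piideal 2 y by exists A.
have hy0 : piideal 0 y by apply: piidealW hy.
have hT : piideal 2 T.
  apply: piidealD.
    apply: piideal_sum => i _; apply: piidealMl; first exact: piideal_nat.
    by rewrite exprS; apply: piidealMr => //; exact: piidealX.
  by apply: piidealMr; [apply: piidealW piideal_p; lia | exact: piidealX].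
have main : y * (1 + T) = 0.
  apply: p_unitK; apply: (@addrI _ 1); rewrite addr0 -[RHS]zp ez.
  have := expr1D_ends p.-2 y; have -> : p.-2.+2 = p by lia.
  move=> ->; rewrite mulrDr mulr1 [T]lock mulrDr -lock; congr (_ + (_ + _)).
  rewrite /T !mulrDr !mulr_sumr; congr (_ + _).
    apply: eq_bigr => i _.
    have hC : (p %| 'C(p, i.+2))%N by apply: prime_dvd_bin => //; have := ltn_ord i; lia.
    by rewrite -{2}(divnK hC) natrM [y ^+ i.+2]exprS; ring.
  have -> : y ^+ p = y * y ^+ p.-1 by rewrite -exprS prednK ?prime_gt0.
  rewrite {3}hv exprMn -!exprM mulnC exprM pi_exp; ring.
have step k : piideal k y -> piideal k.+2 y.
  move=> hk; have -> : y = - (T * y).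
    by apply/eqP; rewrite -subr_eq0 opprK -[X in X + _]mul1r -mulrDl mulrC main.
  by apply: piidealN; have := piidealM hT hk.
rewrite ez; suff -> : y = 0 by rewrite addr0.
apply: piideal_sep; elim=> [|k IH] //; exact: piidealW (step _ IH).
Qed.

(** A symmetric form of additivity; the case [z = 0] also provides the inverses from which
    [addcharD] follows. *)
Lemma addchar_sum3 x y z : x + y + z = 0 -> addchar x * addchar y * addchar z = 1.
Proof.
move=> e; apply: root1_near1; first by rewrite !exprMn !addchar_root !mulr1.
have hx := addchar_near1 x; have hy := addchar_near1 y; have hz := addchar_near1 z.
have px := piideal_addchar x; have py := piideal_addchar y.
have ix u : piideal 1 (pi * wK u) by apply: piidealMr; [exact: (piideal_pi 1) | exact: wK_piideal].
move: hx hy hz px py (ix x) (ix y) (ix z).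
move eX : (addchar x) => X; move eY : (addchar y) => Y; move eZ : (addchar z) => Z.
move=> hX hY hZ pX pY h1 h2 h3.
(* The representatives add up to zero only modulo [p], which is enough at precision [pi^2]. *)
have hw : piideal 2 (pi * wK x + pi * wK y + pi * wK z).
  rewrite -!mulrDr /wK -!(rmorphD iota) -!tofracD; apply: (@piidealM 1 1); first exact: (piideal_pi 1).
  apply: (@piidealW (p.-1 * 1)); first by lia.
  apply: piideal_iota; apply/pideal_tofrac; rewrite !resD !teich_res1 expn1 modnDml.
  apply/eqP; rewrite -/(dvdn _ _) (dvdn_pcharf (pchar_Fp p_pr)) !natrD !natr_Zp.
  by rewrite e.
have near1 U u : piideal 2 (U - 1 - u) -> piideal 1 u -> piideal 1 (U - 1).
  by move=> hU hu; rewrite -[U - 1](subrK u); apply: piidealD => //; apply: piidealW hU.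
move: h1 h2 h3 hw hX hY hZ.
move: (pi * wK x) (pi * wK y) (pi * wK z) => a b c h1 h2 h3 hw hX hY hZ.
have -> : X * Y * Z - 1 = X * Y * (Z - 1 - c) + X * (Y - 1 - b) + (X - 1 - a)
  + (X * (Y - 1) + (X - 1)) * c + (X - 1) * b + (a + b + c) by ring.
have nX := near1 _ _ hX h1; have nY := near1 _ _ hY h2.
apply: piidealD => //; apply: piidealD; last exact: (@piidealM 1 1).
apply: piidealD; last by apply: (@piidealM 1 1) => //; apply: piidealD => //; apply: piidealMl.
apply: piidealD => //; apply: piidealD; last exact: piidealMl.
by apply: piidealMl => //; apply: (@piidealM 0 0).
Qed.

Lemma addcharD x y : addchar (x + y) = addchar x * addchar y.
Proof.
have inv u : addchar u * addchar (- u) = 1.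
  have := @addchar_sum3 u (- u) 0; rewrite subrr addr0 => /(_ erefl).
  by rewrite {3}/addchar eqxx mulr1.
have h := @addchar_sum3 x y (- (x + y)) (subrr _).
by rewrite -[RHS]mulr1 -(inv (x + y)) [X in _ * X]mulrC mulrA h mul1r.
Qed.

Lemma addchar0 : addchar 0 = 1.
Proof. by rewrite /addchar eqxx. Qed.

End AdditiveCharacter.

(** * The ring [Q_p[X] / (X^(p-1) + p)] as a home for [pi] *)

Section RamifiedExtension.
Import Pdiv.Ring Pdiv.RingMonic.
Variables (p : nat) (p_pr : prime p) (p_odd : odd p).
Local Notation Zp := (padic_int p_pr).
Local Notation Qp := (padic_num p_pr).

Let p_gt2 : (2 < p)%N.
Proof. by have := prime_gt1 p_pr; case: p p_odd => [|[|[|]]]. Qed.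

Let hpol (R : nzRingType) : {poly R} := 'X^(p.-1) + p%:R%:P.

Lemma hpol_monic (R : nzRingType) : hpol R \is monic /\ size (hpol R) = p.
Proof.
have s : (size (p%:R%:P : {poly R}) < size ('X^(p.-1) : {poly R}))%N.
  by rewrite size_polyXn (leq_ltn_trans (size_polyC_leq1 _)) // ; lia.
split; last by rewrite /hpol size_polyDl // size_polyXn; lia.
by rewrite monicE /hpol lead_coefDl // lead_coefXn.
Qed.

Local Notation h := (hpol Qp).
Local Notation K := {poly %/ h}.

Let h_mon : mk_monic h = h.
Proof.
have [hm hs] := hpol_monic Qp; rewrite /mk_monic hm hs.
by have -> : (1 < p)%N by lia.
Qed.

Let in_polyC (c : Qp) : in_qpoly h c%:P = qpolyC h c.
Proof.
apply/val_inj => /=; rewrite h_mon rmodp_small //.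
by have [_ ->] := hpol_monic Qp; rewrite (leq_ltn_trans (size_polyC_leq1 _)) //; lia.
Qed.

Let in_poly_horner (A : {poly Zp}) :
  (map_poly (qpolyC h \o @tofrac Zp) A).['qX : K] = in_qpoly h (map_poly (@tofrac Zp) A).
Proof.
elim/poly_ind: A => [|A c IH]; first by rewrite !rmorph0 horner0.
rewrite !rmorphD !rmorphM /= !map_polyX !map_polyC /= hornerMXaddC IH.
by rewrite in_polyC.
Qed.

(** Division by the monic [X^(p-1) + p] is carried out over [Z_p], so the remainder keeps
    coefficients in [Z_p]. Hence every coordinate of an element of [pi^((p-1) k) Z_p[pi]] lies in
    [p^k Z_p], and separation is inherited from [Q_p]. *)
Lemma ramified_extension : exists (K : comNzRingType) (iota : {rmorphism Qp -> K}) (pi : K),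
  [/\ injective iota, pi ^+ p.-1 = - p%:R & forall z, (forall k, piideal iota pi k z) -> z = 0].
Proof.
have [hm hs] := hpol_monic Qp; have [hm' hs'] := hpol_monic Zp.
have pi_exp : ('qX : K) ^+ p.-1 = - p%:R.
  apply/eqP; rewrite -subr_eq0 opprK -rmorphXn -(rmorph_nat (in_qpoly h)) -rmorphD /=.
  rewrite -polyC_natr -/(hpol Qp); apply/eqP/val_inj => /=.
  by rewrite h_mon rmodpp.
exists K, (qpolyC h : {rmorphism Qp -> K}), 'qX; split => //.
  by move=> x y /(congr1 val) /= /polyC_inj.
move=> z hz; apply/val_inj/polyP => i; rewrite coef0.
apply: pideal_sep => k; have [A ->] := hz (p.-1 * k)%N.
rewrite exprM pi_exp in_poly_horner.
have -> : (- p%:R) ^+ k = in_qpoly h ((- p%:R) ^+ k)%:P.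
  by rewrite in_polyC rmorphXn rmorphN rmorph_nat.
have := rdivp_eq hm' A.
set Q := rdivp _ _; set R := rmodp _ _ => eA.
have sR : (size R < p)%N by apply: leq_trans (eq_leq hs'); apply: ltn_rmodpN0; exact: monic_neq0.
have -> : map_poly (@tofrac Zp) A = map_poly (@tofrac Zp) Q * h + map_poly (@tofrac Zp) R.
  rewrite eA rmorphD rmorphM /=; congr (_ * _ + _).
  by rewrite /hpol rmorphD /= map_polyXn map_polyC /= rmorph_nat.
rewrite in_qpolyD in_qpolyM.
have -> : in_qpoly h h = 0 by apply/val_inj => /=; rewrite h_mon rmodpp.
rewrite mulr0 add0r -in_qpolyM /= h_mon rmodp_small; last first.
  rewrite hs mul_polyC (leq_ltn_trans (size_scale_leq _ _)) //.
  by rewrite (leq_ltn_trans (size_poly _ _)).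
rewrite coefCM coef_map /= exprNn; apply: pidealMr; last exact: pideal_int.
by apply: pidealMl; [exact: pideal_sgn | exact: pideal_pX].
Qed.

End RamifiedExtension.

(** * Counting points with characters *)

Section TeichmullerOrthogonality.
Variables (p : nat) (p_pr : prime p).
Local Notation w := (teichmuller p_pr).

Lemma teich_inj : injective w.
Proof. by move=> x y e; apply/val_inj; rewrite /= -!(teich_res1 p_pr) e. Qed.

Lemma card_Fp_nz : #|[pred x : 'F_p | x != 0]| = p.-1.
Proof.
have := cardC1 (0 : 'F_p); rewrite card_Fp // => <-.
Qed.

Lemma teich_orthogonal m :
  \sum_(x : 'F_p | x != 0) w x ^+ m = if (p.-1 %| m)%N then (p.-1)%:R else 0.
Proof.
have p1 := prime_gt1 p_pr.
case: ifP => hm.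
  rewrite (eq_bigr (fun=> 1)) => [|x x0]; last first.
    by rewrite -(divnK hm) mulnC exprM teich_expp1 // expr1n.
  by rewrite sumr_const card_Fp_nz.
(* Otherwise all [p - 1] nonzero elements would be roots of [X^r - 1], where [r = m %% (p - 1)] is
   positive and less than [p - 1]. *)
have [x x0 hx] : exists2 x : 'F_p, x != 0 & w x ^+ m != 1.
  apply/exists_inP; apply/negbNE; apply/negP => /exists_inPn H.
  have r0 : (0 < m %% p.-1)%N by rewrite lt0n; apply/negP => /eqP h; rewrite /dvdn h in hm.
  have := @max_unity_roots 'F_p (m %% p.-1)%N (enum [pred x : 'F_p | x != 0]) r0.
  rewrite -cardE card_Fp_nz leqNgt ltn_mod; have -> : (0 < p.-1)%N by lia.
  move=> absurd; suff : ~~ true by []; apply: absurd; last exact: enum_uniq.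
  apply/allP => x; rewrite mem_enum inE => x0; rewrite unity_rootE.
  have := H x x0; rewrite negbK -teich_exp_mod // -teichX -(teich1 p_pr).
  by move=> /eqP /teich_inj ->.
set S := \sum_(_ | _) _.
have e : S = w x ^+ m * S.
  rewrite mulr_sumr /S (reindex_inj (mulfI x0)) /=.
  by apply: eq_big => y; rewrite ?mulf_eq0 ?(negPf x0) // => _; rewrite teichM exprMn.
apply/eqP; have /eqP : (w x ^+ m - 1) * S = 0 by rewrite mulrBl mul1r -e subrr.
by rewrite mulf_eq0 subr_eq0 (negPf hx).
Qed.
End TeichmullerOrthogonality.

(** * Counting affine points by Fourier expansion *)

Section CharacterCount.
Variables (F : finFieldType) (K : comNzRingType) (q : nat).
Variables (W Psi : F -> K) (G : nat -> K).
Hypothesis q_gt0 : (0 < q)%N.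
Hypothesis WM : {morph W : x y / x * y}.
Hypothesis W1 : W 1 = 1.
Hypothesis W_orth : forall m, \sum_(x | x != 0) W x ^+ m = if (q %| m)%N then q%:R else 0.
Hypothesis Psi0 : Psi 0 = 1.
Hypothesis PsiD : forall x y, Psi (x + y) = Psi x * Psi y.
Hypothesis PsiE : forall x, x != 0 -> Psi x = \sum_(a < q) G a * W x ^+ a.
Hypothesis G0 : q%:R * G 0 = -1.

Let WX m : {morph W : x / x ^+ m}.
Proof. by move=> x; elim: m => [|m IH]; rewrite ?expr0 ?W1 // !exprS WM IH. Qed.

Let W_prod (I : finType) (x : I -> F) : W (\prod_i x i) = \prod_i W (x i).
Proof. exact: (big_morph W WM W1). Qed.

Let Psi_sum (I : finType) (x : I -> F) : Psi (\sum_i x i) = \prod_i Psi (x i).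
Proof. exact: (big_morph Psi PsiD Psi0). Qed.

(** Orthogonality removes all Fourier modes except [a = 0], so the sum is [1 + q G_0]; [G0] thus
    encodes that [Psi] is nontrivial. *)
Lemma sum_Psi : \sum_x Psi x = 0.
Proof.
rewrite (bigD1 0) //= Psi0 (eq_bigr _ (fun x => PsiE (x:=x))) exchange_big /=.
rewrite (eq_bigr (fun a : 'I_q => if a == 0%N :> nat then -1 else 0)) => [|a _]; last first.
  rewrite -mulr_sumr W_orth; case: eqP => [->|/eqP a0].
    by rewrite dvdn0 mulrC.
  by rewrite gtnNdvd ?lt0n // mulr0.
by rewrite -big_mkcond (big_pred1 (Ordinal q_gt0)) /= ?subrr // => a; rewrite -val_eqE.
Qed.

Lemma sum_PsiM u : \sum_z Psi (z * u) = if u == 0 then #|F|%:R else 0.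
Proof.
case: eqVneq => [->|u0].
  by rewrite (eq_bigr (fun=> 1)) ?sumr_const // => z _; rewrite mulr0.
by rewrite -[RHS]sum_Psi [RHS](reindex_inj (mulIf u0)).
Qed.

Variables (n : nat) (n_gt0 : (0 < n)%N) (lambda : F) (lambda_neq0 : n%:R * lambda != 0).
Let c := - (n%:R * lambda).
Let nz := [pred x : F | x != 0].
Local Notation idx := ({ffun 'I_n -> 'I_q} * 'I_q)%type.

(** The exponents that survive the sums over each coordinate and over the dual variable [z]. *)
Definition exp_pair (ab : idx) :=
  [forall i, q %| n * ab.1 i + ab.2]%N && (q %| \sum_i ab.1 i + ab.2)%N.

Definition has_zero (a : {ffun 'I_n -> 'I_q}) := [exists i, a i == 0%N :> nat].

Lemma exp_pair_has_zero ab : exp_pair ab -> has_zero ab.1 -> ab.2 = 0%N :> nat.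
Proof.
move=> /andP[/forallP h _] /existsP[i /eqP ai]; have := h i.
rewrite ai muln0 add0n; have := ltn_ord ab.2; case: (nat_of_ord _) => // b bq.
by rewrite gtnNdvd.
Qed.

Let torus_sum z : z != 0 ->
  \sum_(t : {ffun 'I_n -> F} | t \in ffun_on nz)
     (\prod_i Psi (z * t i ^+ n)) * Psi (z * (c * \prod_i t i)) =
  \sum_(ab : idx) (\prod_i G (ab.1 i)) * G ab.2 * W c ^+ ab.2 * W z ^+ (\sum_i ab.1 i + ab.2) *
     \prod_i \sum_(x | x != 0) W x ^+ (n * ab.1 i + ab.2).
Proof.
move=> z0.
have c0 : c != 0 by rewrite oppr_eq0.
transitivity (\sum_(t : {ffun 'I_n -> F} | t \in ffun_on nz) \sum_(ab : idx)
   (\prod_i G (ab.1 i)) * G ab.2 * W c ^+ ab.2 * W z ^+ (\sum_i ab.1 i + ab.2) *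
     \prod_i W (t i) ^+ (n * ab.1 i + ab.2)).
  apply: eq_bigr => t /ffun_onP ht.
  rewrite PsiE; last first.
    by rewrite !mulf_neq0 //; apply/prodf_neq0 => i _; exact: ht.
  rewrite (eq_bigr (fun i => \sum_(a < q) G a * W (z * t i ^+ n) ^+ a)); last first.
    by move=> i _; rewrite PsiE // mulf_neq0 // expf_neq0 //; exact: ht.
  rewrite bigA_distr_bigA big_distrlr /= pair_big /=; apply: eq_bigr => -[a b] _ /=.
  rewrite big_split /= -!mulrA; congr (_ * _).
  rewrite (eq_bigr (fun i => W z ^+ a i * W (t i) ^+ (n * a i))); last first.
    by move=> i _; rewrite WM exprMn WX -exprM.
  rewrite big_split /= prodrXr.
  rewrite !WM W_prod !exprMn.
  have -> : \prod_i W (t i) ^+ (n * a i + b) =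
     (\prod_i W (t i) ^+ (n * a i)) * (\prod_i W (t i)) ^+ b.
    by rewrite -prodrXl -big_split /=; apply: eq_bigr => i _; rewrite exprD.
  by rewrite exprD; ring.
rewrite exchange_big /=; apply: eq_bigr => -[a b] _ /=.
by rewrite -mulr_sumr; congr (_ * _); rewrite bigA_distr_big.
Qed.


Let kummer_sum z : z != 0 -> \sum_(x | x != 0) Psi (z * x ^+ n) =
  q%:R * \sum_(a < q | (q %| n * a)%N) G a * W z ^+ a.
Proof.
move=> z0.
rewrite (eq_bigr (fun x => \sum_(a < q) G a * W z ^+ a * W x ^+ (n * a))); last first.
  move=> x x0; rewrite PsiE ?mulf_neq0 ?expf_neq0 //.
  by apply: eq_bigr => a _; rewrite WM exprMn WX -exprM mulrA.
rewrite exchange_big mulr_sumr [RHS]big_mkcond /=; apply: eq_bigr => a _.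
by rewrite -mulr_sumr W_orth; case: ifP => _; rewrite ?mulr0 // mulrC.
Qed.

(** Adding the point [x = 0] to a one-variable sum adds [1], which cancels the mode [a = 0] because
    [q G_0 = -1]. The difference of the products therefore consists, with a minus sign, of the terms
    in which some [a_i] is zero. *)
Let boundary_sum :
  \sum_(z | z != 0) ((\prod_(i < n) \sum_x Psi (z * x ^+ n)) -
     \prod_(i < n) \sum_(x | x != 0) Psi (z * x ^+ n)) =
  - (q%:R ^+ n.+1 * \sum_(ab : idx | exp_pair ab && has_zero ab.1) \prod_i G (ab.1 i)).
Proof.
pose Q := [pred a : 'I_q | (q %| n * a)%N].
pose Q' := [pred a : 'I_q | (q %| n * a)%N && (a != 0%N :> nat)].
have full z : z != 0 -> \sum_x Psi (z * x ^+ n) =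
    q%:R * \sum_(a < q | Q' a) G a * W z ^+ a.
  move=> z0; rewrite (bigD1 0) //= expr0n gtn_eqF // mulr0 Psi0 kummer_sum //.
  rewrite (bigD1 (Ordinal q_gt0)) /= ?muln0 ?dvdn0 // expr0 mulr1 mulrDr G0 addrA subrr add0r.
  by congr (_ * _); apply: eq_bigl => a; rewrite -val_eqE.
have prodE (R : pred 'I_q) z : \prod_(i < n) (q%:R * \sum_(a < q | R a) G a * W z ^+ a) =
    q%:R ^+ n * \sum_(a in ffun_on R) (\prod_(i < n) G (a i)) * W z ^+ (\sum_i a i).
  rewrite big_split /= prodr_const card_ord bigA_distr_big; congr (_ * _).
  by apply: eq_bigr => a _; rewrite big_split /= prodrXr.
transitivity (\sum_(z | z != 0) - (q%:R ^+ n * \sum_(a : {ffun 'I_n -> 'I_q} | (a \in ffun_on Q) && has_zero a)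
    (\prod_(i < n) G (a i)) * W z ^+ (\sum_i a i))).
  apply: eq_bigr => z z0.
  rewrite (eq_bigr (fun=> q%:R * \sum_(a < q | Q' a) G a * W z ^+ a)); last by move=> i _; exact: full.
  rewrite [X in _ - X](eq_bigr (fun=> q%:R * \sum_(a < q | Q a) G a * W z ^+ a)); last first.
    by move=> i _; exact: kummer_sum.
  rewrite !prodE -mulrBr -mulrN; congr (_ * _).
  rewrite [X in _ - X](bigID has_zero) /= opprD addrCA; set S := \sum_(_ in _) _.
  set T := \sum_(_ in _ | ~~ has_zero _) _.
  suff -> : S = T by rewrite subrr addr0.
  apply: eq_bigl => a; apply/ffun_onP/andP => [h|[/ffun_onP h /existsPn h0] i].
    split; first by apply/ffun_onP => i; have /andP[] := h i.
    by apply/existsPn => i; have /andP[] := h i.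
  by rewrite inE h0 andbT; exact: h.
rewrite sumrN -mulr_sumr exchange_big exprSr -mulrA; congr (- (_ * _)).
rewrite (eq_bigr (fun a : {ffun 'I_n -> 'I_q} => if (q %| \sum_i a i)%N then q%:R * \prod_(i < n) G (a i) else 0)); last first.
  by move=> a _; rewrite -mulr_sumr W_orth; case: ifP => _; rewrite ?mulr0 // mulrC.
rewrite -big_mkcondr mulr_sumr.
rewrite (reindex_onto (fun ab : idx => ab.1) (fun a => (a, Ordinal q_gt0))) //=.
apply: eq_bigl => -[a b] /=.
have -> : ((a, Ordinal q_gt0) == (a, b)) = (b == 0%N :> nat).
  by rewrite xpair_eqE eqxx -val_eqE eq_sym.
apply/andP/andP => [[/andP[/andP[/ffun_onP h1 h2] h3] /eqP b0]|[h1 h2]].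
  split => //; rewrite /exp_pair /= b0 !addn0 h3 andbT.
  by apply/forallP => i; rewrite addn0; exact: h1.
have b0 := exp_pair_has_zero h1 h2; rewrite /= in b0.
move: h1; rewrite /exp_pair /= b0 addn0 => /andP[/forallP h1 ->]; rewrite eqxx andbT h2 andbT; split => //.
by apply/ffun_onP => i; have := h1 i; rewrite addn0.
Qed.

Definition affine_points := [pred x : 'rV[F]_n | dwork_form lambda x == 0].

(* The terms with [has_zero] come from the points with a vanishing coordinate,
   where the product in [dwork_form] disappears. *)
Lemma affine_count : #|F|%:R * #|affine_points|%:R = #|F|%:R ^+ n + q%:R ^+ n.+1 *
  \sum_(ab : idx | exp_pair ab)
     (\prod_i G (ab.1 i)) * (G ab.2 * W c ^+ ab.2 - (has_zero ab.1)%:R).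
Proof.
pose row (t : {ffun 'I_n -> F}) : 'rV[F]_n := \row_i t i.
have -> : #|F|%:R * #|affine_points|%:R = \sum_(x : 'rV[F]_n) \sum_z Psi (z * dwork_form lambda x).
  rewrite (eq_bigr (fun x : 'rV[F]_n => if dwork_form lambda x == 0 then #|F|%:R else 0)).
    by rewrite -big_mkcond /= sumr_const mulr_natr.
  by move=> x _; rewrite sum_PsiM.
rewrite exchange_big (bigD1 0) //=; congr (_ + _).
  rewrite (eq_bigr (fun=> 1)) => [|x _]; last by rewrite mul0r.
  by rewrite sumr_const cardT -cardE card_mx mul1n natrX.
have rowE z : \sum_(x : 'rV[F]_n) Psi (z * dwork_form lambda x) =
   \sum_(t : {ffun 'I_n -> F}) (\prod_i Psi (z * t i ^+ n)) * Psi (z * (c * \prod_i t i)).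
  rewrite (reindex row) /=; last first.
    exists (fun x => [ffun i => x 0 i]) => x _; first by apply/ffunP => i; rewrite ffunE mxE.
    by apply/rowP => i; rewrite mxE ffunE.
  apply: eq_bigr => t _; rewrite -Psi_sum -PsiD; congr Psi.
  rewrite /dwork_form mulrBr mulr_sumr /c mulNr mulrN; congr (_ - z * (_ * _)).
    by apply: eq_bigr => i _; rewrite mxE.
  by apply: eq_bigr => i _; rewrite mxE.
rewrite (eq_bigr _ (fun z _ => rowE z)).
transitivity (\sum_(z | z != 0)
   ((\sum_(t : {ffun 'I_n -> F} | t \in ffun_on nz)
      (\prod_i Psi (z * t i ^+ n)) * Psi (z * (c * \prod_i t i))) +
    ((\prod_(i < n) \sum_x Psi (z * x ^+ n)) -
     \prod_(i < n) \sum_(x | x != 0) Psi (z * x ^+ n)))).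
  apply: eq_bigr => z z0; rewrite (bigID (fun t => t \in ffun_on nz)) /=; congr (_ + _).
  rewrite bigA_distr_bigA bigA_distr_big [X in X - _](bigID (fun t => t \in ffun_on nz)) /=.
  rewrite addrAC subrr add0r; apply: eq_bigr => t /ffun_onP h.
  suff -> : \prod_i t i = 0 by rewrite !mulr0 Psi0 mulr1.
  apply/eqP; apply/negPn/negP => /prodf_neq0 h0; apply: h => i; exact: h0.
rewrite big_split /= boundary_sum (eq_bigr _ torus_sum) exchange_big /=.
rewrite (eq_bigr (fun ab : idx => if exp_pair ab then
    q%:R ^+ n.+1 * ((\prod_i G (ab.1 i)) * (G ab.2 * W c ^+ ab.2)) else 0)); last first.
  move=> ab _; rewrite -mulr_suml -mulr_sumr W_orth /exp_pair.
  rewrite [\prod_i \sum_(x | _) _](eq_bigr (fun i => if (q %| n * ab.1 i + ab.2)%N then q%:R else 0)); last first.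
    by move=> i _; rewrite W_orth.
  case: (boolP [forall i, q %| n * ab.1 i + ab.2]%N) => [/forallP h|/forallPn [i /negPf h]].
    rewrite (eq_bigr (fun=> q%:R)) => [|i _]; last by rewrite h.
    rewrite prodr_const card_ord /=; case: ifP => _; last by rewrite mulr0 mul0r.
    by rewrite exprS; ring.
  by rewrite [\prod_i (if _ then _ else _)](bigD1 i) //= h mul0r mulr0.
rewrite -big_mkcond -mulr_sumr -mulrBr /=; congr (_ * _).
rewrite [X in _ - X]big_mkcondr -sumrB; apply: eq_bigr => ab _.
by case: ifP => _; rewrite mulrBr ?mulr1 ?mulr0.
Qed.

End CharacterCount.

(** * From affine to projective points *)

Section ProjectiveCount.
Variables (F : finFieldType) (n : nat) (n_gt0 : (0 < n)%N) (lambda : F).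

Lemma dwork_formZ (k : F) (x : 'rV[F]_n) :
  dwork_form lambda (k *: x) = k ^+ n * dwork_form lambda x.
Proof.
rewrite /dwork_form mulrBr mulr_sumr; congr (_ - _).
  by apply: eq_bigr => i _; rewrite mxE exprMn.
rewrite (eq_bigr (fun i => k * x 0 i)) => [|i _]; last by rewrite mxE.
by rewrite big_split /= prodr_const card_ord; ring.
Qed.

Lemma card_proj_point (x : 'rV[F]_n) : x != 0 -> #|proj_point x| = (#|F|.-1)%N.
Proof.
move=> x0; rewrite card_imset; last first.
  by move=> a b /eqP; rewrite -subr_eq0 -scalerBl scaler_eq0 (negPf x0) orbF subr_eq0 => /eqP.
by rewrite -(cardC1 (0 : F)).
Qed.

Lemma proj_point_refl (x : 'rV[F]_n) : x \in proj_point x.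
Proof. by apply/imsetP; exists 1; rewrite ?inE ?oner_eq0 ?scale1r. Qed.

Lemma proj_point_eq (x y : 'rV[F]_n) : y \in proj_point x -> proj_point y = proj_point x.
Proof.
case/imsetP => k; rewrite inE => k0 ->; apply/setP => z; apply/imsetP/imsetP.
  case=> l; rewrite inE => l0 ->; exists (l * k); rewrite ?scalerA //.
  by rewrite inE mulf_neq0.
case=> l; rewrite inE => l0 ->; exists (l / k); rewrite ?scalerA ?divfK //.
by rewrite inE mulf_neq0 ?invr_eq0.
Qed.

Lemma projective_count :
  #|affine_points n lambda| = (#|dwork_points n lambda| * #|F|.-1 + 1)%N.
Proof.
have f0 : dwork_form lambda (0 : 'rV[F]_n) == 0.
  rewrite -(scale0r (0 : 'rV[F]_n)) dwork_formZ expr0n gtn_eqF // mul0r //.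
rewrite (cardD1 0) inE f0 addnC; congr (_ + _)%N.
pose X := [pred x : 'rV[F]_n | (x != 0) && (dwork_form lambda x == 0)].
have -> : #|[predD1 affine_points n lambda & 0]| = #|X| by apply: eq_card => x; rewrite !inE.
rewrite -[#|X|]sum1_card (partition_big_imset (@proj_point F n)) /= -/(dwork_points n lambda).
rewrite -sum_nat_const; apply: eq_bigr => A /imsetP[x]; rewrite inE => /andP[x0 fx] ->.
rewrite -(card_proj_point x0) -sum1_card; apply: eq_bigl => y.
apply/andP/idP => [[_ /eqP <-]|hy]; first exact: proj_point_refl.
split; last by apply/eqP/proj_point_eq.
case/imsetP: hy => k; rewrite inE => k0 ->.
by rewrite inE scaler_eq0 negb_or k0 x0 dwork_formZ (eqP fx) mulr0 eqxx.
Qed.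
End ProjectiveCount.

(** * Surviving exponents and the classes of [W] *)

Section IndexClasses.
Variables (q n d : nat).
Hypotheses (q_gt0 : (0 < q)%N) (n_gt0 : (0 < n)%N) (d_def : d = gcdn q n).
Implicit Types v w : {ffun 'I_n -> 'I_d}.

Let d_gt0 : (0 < d)%N. Proof. by rewrite d_def gcdn_gt0 q_gt0. Qed.
Let e := (q %/ d)%N.
Let qE : q = (e * d)%N. Proof. by rewrite /e divnK // d_def dvdn_gcdl. Qed.
Let e_gt0 : (0 < e)%N. Proof. by move: q_gt0; rewrite qE; case: (e). Qed.
Let nE : n = (n %/ d * d)%N. Proof. by rewrite divnK // d_def dvdn_gcdr. Qed.
Let q_dvd_ne x : (q %| n * (x * e))%N.
Proof.
rewrite nE [in X in (X %| _)%N]qE.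
have -> : (n %/ d * d * (x * e) = n %/ d * x * (e * d))%N by ring.
exact: dvdn_mull.
Qed.

Definition omod x : 'I_q := Ordinal (ltn_pmod x q_gt0).
Definition omodd x : 'I_d := Ordinal (ltn_pmod x d_gt0).

Lemma Wsim_equiv : {in Wset n d & &, equivalence_rel (@Wsim n d)}.
Proof.
have refl w : Wsim w w.
  by apply/existsP; exists (omodd 0); apply/forallP => i; rewrite /= mod0n addn0.
have sym v w : Wsim v w -> Wsim w v.
  move=> /existsP[c /forallP h]; apply/existsP; exists (omodd (d - c)); apply/forallP => i.
  rewrite /= modnDmr -modnDml (eqP (h i)) modnDml -addnA subnKC ?modnDr //.
  exact: ltnW.
have trans u v w : Wsim u v -> Wsim v w -> Wsim u w.
  move=> /existsP[c /forallP h] /existsP[c' /forallP h']; apply/existsP; exists (omodd (c' + c)).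
  apply/forallP => i; rewrite /= modnDmr (eqP (h i)) addnA -modnDml (eqP (h' i)) modnDml //.
move=> u v w _ _ _; split => // huv; apply/idP/idP => h; [exact: trans (sym _ _ huv) h | exact: trans huv h].
Qed.

Lemma Wclasses_partition : partition (Wclasses n d) (Wset n d).
Proof. exact: equivalence_partitionP Wsim_equiv. Qed.

Lemma Wclass_sub C v : C \in Wclasses n d -> v \in C -> v \in Wset n d.
Proof.
by move=> hC hv; rewrite -(cover_partition Wclasses_partition); apply/bigcupP; exists C.
Qed.

Lemma Wclass_sim C D v w : C \in Wclasses n d -> D \in Wclasses n d ->
  v \in C -> w \in D -> Wsim v w = (C == D).
Proof.
move=> hC hD hv hw; have tI := partition_trivIset Wclasses_partition.
rewrite -(pblock_equivalence_partition Wsim_equiv (Wclass_sub hC hv) (Wclass_sub hD hw)).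
rewrite -/(Wclasses n d) (def_pblock tI hC hv); apply/idP/eqP => [h|-> //].
by rewrite -(def_pblock tI hC h) (def_pblock tI hD hw).
Qed.

Variable repr : {set {ffun 'I_n -> 'I_d}} -> {ffun 'I_n -> 'I_d}.
Hypothesis reprP : forall C, C \in Wclasses n d -> repr C \in C.

(** [(q - j) n] stands for [- j n] modulo [q]. The last exponent depends on [j] alone because
    [n (q / d)] is a multiple of [q]. *)
Definition class_pair (u : {set {ffun 'I_n -> 'I_d}} * 'I_q) : {ffun 'I_n -> 'I_q} * 'I_q :=
  ([ffun i => omod (u.2 + repr u.1 i * e)], omod ((q - u.2) * n)).

Let U := [set u : {set {ffun 'I_n -> 'I_d}} * 'I_q | u.1 \in Wclasses n d].

Let simE v w (x : nat) (q_x : forall i, (v i * e = x + w i * e %[mod q])%N) : Wsim v w.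
Proof.
have i0 : 'I_n by exact: Ordinal n_gt0.
have ex : (e %| x)%N.
  have := congr1 (fun z => z %% e)%N (q_x i0).
  rewrite !modn_dvdm ?qE ?dvdn_mulr // modnMl => /esym/eqP.
  by rewrite -/(dvdn _ _) dvdn_addl // dvdn_mull.
apply/existsP; exists (omodd (x %/ e)); apply/forallP => i /=.
rewrite modnDmr; apply/eqP.
have := q_x i; rewrite -{1}(divnK ex) -mulnDl qE [(e * d)%N]mulnC -!muln_modl.
by move=> /eqP; rewrite eqn_pmul2r // => /eqP ->; rewrite addnC.
Qed.

(** Equal images make [j' - j] a common shift, so the two representatives lie in one class. With one
    representative per class they coincide, and then so do [j] and [j']. *)
Lemma class_pair_inj : {in U &, injective class_pair}.
Proof.
move=> [C j] [C' j']; rewrite !inE /= => hC hC' h.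
have hi i : (j + repr C i * e = j' + repr C' i * e %[mod q])%N.
  by have /ffunP/(_ i)/(congr1 val) := congr1 fst h; rewrite /= !ffunE.
have CC : C = C'.
  apply/eqP; rewrite -(Wclass_sim hC hC' (reprP hC) (reprP hC')).
  apply: (@simE _ _ (j' + (q - j))%N) => i.
  have jq := ltnW (ltn_ord j).
  apply/eqP; rewrite -(eqn_modDl j) hi.
  have -> : (j + (j' + (q - j) + repr C' i * e) = j' + repr C' i * e + q)%N by lia.
  by rewrite modnDr.
subst C'; congr (_, _); apply/val_inj => /=.
have := hi (Ordinal n_gt0) => /eqP; rewrite eqn_modDr => /eqP.
by rewrite !modn_small.
Qed.

Lemma class_pair_image : class_pair @: U =i [pred ab | exp_pair ab].
Proof.
move=> [a b]; apply/imsetP/idP; rewrite inE.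
  case=> -[C j]; rewrite inE /= => hC [-> ->] {a b}.
  have hw := Wclass_sub hC (reprP hC); set w := repr C in hw *.
  have jn : ((q - j) * n + j * n = q * n)%N by rewrite -mulnDl subnK // ltnW.
  apply/andP; split.
    apply/forallP => i; rewrite ffunE /= /dvdn modnDmr -modnDml modnMmr modnDml.
    rewrite -/(dvdn _ _) mulnDr addnAC [(n * j)%N]mulnC [(_ + (q - j) * n)%N]addnC jn.
    by apply: dvdn_add; [exact: dvdn_mulr | exact: q_dvd_ne].
  rewrite /dvdn /= modnDmr -modnDml (eq_bigr (fun i => (j + w i * e) %% q)%N) => [|i _]; last by rewrite ffunE.
  rewrite modn_summ modnDml big_split /= sum_nat_const card_ord -big_distrl /=.
  rewrite addnAC [(n * j)%N]mulnC [(_ + (q - j) * n)%N]addnC jn -/(dvdn _ _).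
  apply: dvdn_add; first exact: dvdn_mulr.
  rewrite [in X in (X %| _)%N]qE mulnC dvdn_pmul2r //.
  by rewrite inE in hw.
move=> /andP[/forallP /= h1 h2].
pose i0 := Ordinal n_gt0.
pose X i := (a i + (q - a i0))%N.
have aq i : (a i <= q)%N by exact: ltnW.
(* The congruences give [q %| n * X i]; after cancelling [d], coprimality of [e] and [n / d] leaves
   [e %| X i]. The summand [q] in [X] keeps the difference a natural number. *)
have ai i : (e %| X i)%N.
  have : (q %| n * X i)%N.
    rewrite -(dvdn_addl _ (h1 i0)).
    have -> : (n * X i + (n * a i0 + b) = n * a i + b + n * q)%N.
      by rewrite /X mulnDr mulnBr; have : (n * a i0 <= n * q)%N; [rewrite leq_mul2l aq orbT | lia].
    by rewrite dvdn_addl ?h1 // dvdn_mull.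
  rewrite [in X in (X %| _)%N]qE nE mulnAC dvdn_pmul2r // Gauss_dvdr //.
  have : (gcdn e (n %/ d) * d == d)%N by rewrite muln_gcdl -qE -nE -d_def.
  by rewrite -[X in _ == X]mul1n eqn_pmul2r // => /eqP.
pose v : {ffun 'I_n -> 'I_d} := [ffun i => omodd (X i %/ e)].
have hv : v \in Wset n d.
  rewrite inE /dvdn (eq_bigr (fun i => (X i %/ e) %% d)%N) => [|i _]; last by rewrite ffunE.
  rewrite modn_summ -/(dvdn _ _) -(dvdn_pmul2l e_gt0) -qE mulnC big_distrl /=.
  rewrite (eq_bigr X) => [|i _]; last by rewrite divnK.
  rewrite -(dvdn_addl _ (h1 i0)) big_split /= sum_nat_const card_ord.
  have -> : (\sum_i a i + n * (q - a i0) + (n * a i0 + b) = \sum_i a i + b + n * q)%N.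
    by rewrite mulnBr; have : (n * a i0 <= n * q)%N; [rewrite leq_mul2l aq orbT | lia].
  by rewrite dvdn_addl // dvdn_mull.
have cv := cover_partition Wclasses_partition.
have vC : v \in pblock (Wclasses n d) v by rewrite mem_pblock cv.
have hC : pblock (Wclasses n d) v \in Wclasses n d by rewrite pblock_mem // cv.
set C := pblock _ v in vC hC.
have : Wsim v (repr C) by rewrite (Wclass_sim hC hC vC (reprP hC)).
set w := repr C => /existsP[c /forallP hc].
(* [v = w + c] modulo [d], so replacing [v] by the representative [w] moves [c e] into [j]. *)
pose j := omod (a i0 + c * e).
exists (C, j); first by rewrite inE.
have ha i : (a i = j + w i * e %[mod q])%N.
  apply/eqP; rewrite -(eqn_modDr (q - a i0)) -/(X i) -(divnK (ai i)) /=.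
  have -> : ((a i0 + c * e) %% q + w i * e + (q - a i0) = (a i0 + c * e) %% q + (w i * e + (q - a i0)))%N.
    by rewrite addnA.
  rewrite modnDml.
  have -> : (a i0 + c * e + (w i * e + (q - a i0)) = (w i + c) * e + q)%N.
    by rewrite mulnDl; have := aq i0; lia.
  rewrite modnDr [in X in (_ == _ %[mod X])%N]qE [(e * d)%N]mulnC -!muln_modl.
  by have := hc i; rewrite ffunE /= modn_mod => /eqP ->.
congr (_, _); last first.
  apply/val_inj => /=; rewrite -[LHS](modn_small (ltn_ord b)); apply/eqP.
  have : (q %| b + n * ((a i0 + c * e) %% q))%N.
    rewrite /dvdn -modnDmr modnMmr modnDmr mulnDr addnA -/(dvdn _ _).
    by rewrite dvdn_addl ?q_dvd_ne // addnC h1.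
  have : ((a i0 + c * e) %% q <= q)%N by rewrite ltnW // ltn_mod.
  move: ((a i0 + c * e) %% q)%N => t tq hb.
  rewrite -(eqn_modDr (n * t)).
  have -> : ((q - t) * n + n * t = n * q)%N.
    by rewrite [(n * t)%N]mulnC -mulnDl subnK // mulnC.
  by rewrite modnMl.
by apply/ffunP => i; apply/val_inj; rewrite ffunE /= -[LHS](modn_small (ltn_ord (a i))) ha.
Qed.

(* Solutions [a] of the congruences are exactly the [j + w_i (p-1)/d], and shifting
   [j] by a multiple of [(p-1)/d] changes [w] within its class. *)
Lemma sum_exp_pair (K : nmodType) (Fab : {ffun 'I_n -> 'I_q} * 'I_q -> K) :
  \sum_(ab | exp_pair ab) Fab ab =
  \sum_(C in Wclasses n d) \sum_(j < q) Fab (class_pair (C, j)).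
Proof.
rewrite pair_big /= -(eq_bigl _ _ class_pair_image) (big_imset _ class_pair_inj).
by apply: eq_big => [[C j]|[C j] _]; rewrite ?inE ?andbT.
Qed.

End IndexClasses.

(** * Identification of the hypergeometric summands *)

Lemma fracpartE (x r : rat) (z : int) : x = r + z%:~R -> 0 <= r < 1 ->
  fracpart x = r /\ Num.floor x = z.
Proof.
move=> -> /andP[r0 r1].
have fz : Num.floor (r + z%:~R) = z.
  by apply: floor_def; rewrite lerDr r0 /= intrD addrC ltrD2l.
by rewrite /fracpart fz addrK.
Qed.

Lemma big_multiples (R : Type) (idx : R) (op : Monoid.com_law idx) d m (F : nat -> R) :
  (0 < m)%N ->
  \big[op/idx]_(0 <= h < d * m | (m %| h)%N) F h = \big[op/idx]_(0 <= k < d) F (k * m)%N.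
Proof.
move=> m0; elim: d => [|d IH]; first by rewrite mul0n !big_geq.
rewrite [RHS]big_nat_recr //= -IH (@big_cat_nat _ _ _ (d * m)) ?leq_mul2r ?leqnSn ?orbT //=.
congr (op _ _); rewrite big_ltn_cond ?ltn_mul2r ?m0 //= ?dvdn_mull //.
rewrite big_nat_cond big1 ?Monoid.mulm1 // => h /andP[/andP[h1 h2] /dvdnP[k hk]].
by move: h1 h2; rewrite hk !ltn_mul2r m0 /=; lia.
Qed.

(** Hermite's identity: raising [Q] by one shifts the window and replaces [Q %/ n] by
    [(Q + n) %/ n]. *)
Lemma sum_divn_shift n Q : (0 < n)%N -> (\sum_(0 <= h < n) (h + Q) %/ n = Q)%N.
Proof.
move=> n0; elim: Q => [|Q IH].
  by rewrite big_nat big1 // => h /andP[_ hn]; rewrite addn0 divn_small.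
have : (\sum_(0 <= h < n.+1) (h + Q) %/ n = Q + (Q %/ n).+1)%N.
  by rewrite big_nat_recr //= IH addnC divnDl // divnn n0; lia.
rewrite big_nat_recl // add0n [X in (_ + X)%N = _](eq_bigr (fun h => (h + Q.+1) %/ n)%N); last first.
  by move=> h _; rewrite addSnnS.
by lia.
Qed.

Section GammaRat.
Variables (p : nat) (p_pr : prime p) (p_odd : odd p).
Local Notation Zp := (padic_int p_pr).
Local Notation Qp := (padic_num p_pr).
Local Notation Gam := (@Gammap p p_pr).

(** [ratr] works with the reduced fraction, whose denominator divides [D] and is therefore a unit of
    [Z_p]. *)
Lemma ratr_frac (N D : nat) : ~~ (p %| D)%N ->
  ratr (N%:R / D%:R : rat) = N%:R / D%:R :> Zp.
Proof.
move=> pD; set x := _ / _ : rat.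
have D0 : (D%:R : rat) != 0 by rewrite pnatr_eq0; case: D pD {x} => //; rewrite dvdn0.
have e : (numq x * D%:Z = N%:Z * denq x).
  apply/eqP; rewrite -(eqr_int rat) !rmorphM /= numqE /x.
  by rewrite mulrAC -!pmulrn divfK.
have [m em] : exists m : nat, denq x = m%:Z.
  by exists `|denq x|%N; rewrite gez0_abs // denq_ge0.
have mD : (m %| D)%N.
  have : (denq x %| numq x * D%:Z)%Z by rewrite e dvdz_mull.
  rewrite Gauss_dvdzr; last by rewrite coprimezE coprime_sym coprime_num_den.
  by rewrite em.
have mU : (m%:R : Zp) \is a GRing.unit.
  by apply: nat_unit; apply: contra pD => /dvdn_trans; apply.
have DU := nat_unit p_pr pD.
have e' : (numq x)%:~R * D%:R = N%:R * m%:R :> Zp.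
  by have := congr1 (fun z : int => z%:~R : Zp) e; rewrite em !intrM -!pmulrn.
rewrite /ratr em -pmulrn; apply: (mulIr DU); apply: (mulIr mU).
by rewrite mulrAC divrK // divrK.
Qed.

Definition Gm r : Qp := tofrac (Gam (tau p_pr r)).

Lemma GammaQ_tau r : GammaQ p_pr (r%:R / (p.-1)%:R) = Gm r.
Proof. by rewrite /GammaQ ratr_frac // p1_ndvd. Qed.

Lemma Gm_neq0 r : Gm r != 0.
Proof. by rewrite /Gm tofrac_eq0 Gam_neq0. Qed.

Lemma Gm0 : Gm 0 = 1.
Proof. by rewrite /Gm Gam_tau0 // tofrac1. Qed.

Lemma Gm_reflect r : (0 < r < p.-1)%N -> Gm r * Gm (p.-1 - r) = - (-1) ^+ r.
Proof. by move=> h; rewrite /Gm -tofracM Gam_reflect // tofracN rmorphXn /= tofracN tofrac1. Qed.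

End GammaRat.

Lemma reflect_frac0 (F : fieldType) (x y s P : F) : x != 0 -> y != 0 -> P != 0 ->
  x * y = - s -> s * s = 1 -> 1 / y * (1 / x * (- P)^-1) = s * (1 / P).
Proof.
move=> x0 y0 P0 e1 e2.
have -> : 1 / y * (1 / x * (- P)^-1) = - ((x * y)^-1 / P) by field; rewrite ?oppr_eq0 ?x0 ?y0 ?P0.
have s0 : s != 0 by apply/negP => /eqP s0; move: e2; rewrite s0 mul0r => /esym/eqP; rewrite oner_eq0.
rewrite e1 invrN mulNr opprK mul1r; congr (_ * _).
by apply: (mulfI s0); rewrite divff.
Qed.

Lemma reflect_frac (F : fieldType) (x x' y y' s t Q : F) : y != 0 -> y' != 0 -> Q != 0 ->
  x * x' = - s -> y * y' = - t -> t * t = 1 -> x' / y' * Q * (x / y / Q) = s * t.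
Proof.
move=> y0 y0' Q0 e1 e2 e3.
have -> : x' / y' * Q * (x / y / Q) = (x * x') / (y * y') by field; rewrite y0 y0' Q0.
have t0 : t != 0 by apply/negP => /eqP t0; move: e3; rewrite t0 mul0r => /esym/eqP; rewrite oner_eq0.
rewrite e1 e2 invrN mulrNN; congr (_ * _).
by apply: (mulfI t0); rewrite divff.
Qed.

(** Field algebra for [summand_identity]: [PAB] is the product over both parameter lists, [sg * Z]
    that of the factors completing them, [V] the last Fourier coefficient with its correction; [PE],
    [PW], [Pn], [PL] are powers of [- p]. *)
Lemma summand_frac (F : fieldType) (pp PW G2 sg' ob PAB sg Z gb wnb Pn G1 PL PE V wcb : F) :
  G2 != 0 -> sg != 0 -> Z != 0 ->
  PAB * (sg * Z) = gb * wnb * Pn * (G1 / G2 * PL) ->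
  PE = PW * Pn * PL -> V * Z = pp * (gb * wcb) -> sg' * ob * wnb = sg * wcb ->
  PE * G1 * V = pp * (PW * G2 * (sg' * ob * PAB)).
Proof.
move=> G20 sg0 Z0 e1 e2 e3 e4; have sZ : sg * Z != 0 by rewrite mulf_neq0.
apply: (mulIf sZ).
have -> : PE * G1 * V * (sg * Z) = PE * G1 * sg * (V * Z) by ring.
have -> : pp * (PW * G2 * (sg' * ob * PAB)) * (sg * Z) =
  pp * (PW * G2 * (sg' * ob * (PAB * (sg * Z)))) by ring.
rewrite e1 e2 e3.
have -> : PW * Pn * PL * G1 * sg * (pp * (gb * wcb)) = pp * PW * Pn * PL * G1 * gb * (sg * wcb) by ring.
by rewrite -e4; field.
Qed.

(** * Each hypergeometric summand as a product of gamma values *)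

Section SummandIdentity.
Variables (p : nat) (p_pr : prime p) (p_odd : odd p).
Local Notation Zp := (padic_int p_pr).
Local Notation Qp := (padic_num p_pr).
Local Notation Gam := (@Gammap p p_pr).
Local Notation Gm := (@Gm p p_pr).
Local Notation w_ := (teichmuller p_pr).
Local Notation q := (p.-1).
Variables (n : nat) (n_gt0 : (0 < n)%N) (pn : ~~ (p %| n)%N).
Variables (d : nat) (d_def : d = gcdn q n).
Variables (j : nat) (j_lt : (j < q)%N).

Let q_gt0 : (0 < q)%N. Proof. by have := prime_gt1 p_pr; lia. Qed.
Let q_even : odd q = false.
Proof. by have := prime_gt0 p_pr; case: p p_odd => // p' /= /negPf. Qed.
Let d_gt0 : (0 < d)%N. Proof. by rewrite d_def gcdn_gt0 q_gt0. Qed.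
Let e := (q %/ d)%N.
Let qE : q = (d * e)%N. Proof. by rewrite /e mulnC divnK // d_def dvdn_gcdl. Qed.
Let e_gt0 : (0 < e)%N. Proof. by rewrite /e divn_gt0 // d_def dvdn_leq ?dvdn_gcdl. Qed.
Let m := (n %/ d)%N.
Let nE : n = (d * m)%N. Proof. by rewrite /m mulnC divnK // d_def dvdn_gcdr. Qed.
Let m_gt0 : (0 < m)%N. Proof. by rewrite /m divn_gt0 // d_def dvdn_leq ?dvdn_gcdr. Qed.
Let q0 : (q%:R : rat) != 0. Proof. by rewrite pnatr_eq0 -lt0n. Qed.
Let n0 : (n%:R : rat) != 0. Proof. by rewrite pnatr_eq0 -lt0n. Qed.
Let d0 : (d%:R : rat) != 0. Proof. by rewrite pnatr_eq0 -lt0n. Qed.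
Let e0 : (e%:R : rat) != 0. Proof. by rewrite pnatr_eq0 -lt0n. Qed.
Let m0 : (m%:R : rat) != 0. Proof. by rewrite pnatr_eq0 -lt0n. Qed.
Let Np0 : - p%:R != 0 :> Qp. Proof. by rewrite oppr_eq0 pQ_neq0. Qed.

Let u : rat := j%:R / (p%:R - 1).
Let uE : u = j%:R / q%:R. Proof. by rewrite /u natr_pred ?prime_gt0. Qed.
Let kdE k : (k%:R / d%:R : rat) = (k * e)%:R / q%:R.
Proof. by rewrite qE !natrM; field; rewrite d0 e0. Qed.

(** A summand of [padicG] splits into contributions of single parameters, so that each list can be
    completed and evaluated on its own. *)
Definition facA (a : rat) : Qp := GammaQ p_pr (fracpart (a - u)) / GammaQ p_pr (fracpart a) *
  (- p%:R) ^ (- Num.floor (fracpart a - u)).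
Definition facB (b : rat) : Qp := GammaQ p_pr (fracpart (- b + u)) / GammaQ p_pr (fracpart (- b)) *
  (- p%:R) ^ (- Num.floor (fracpart (- b) + u)).

Lemma padic_summandE (A B : seq rat) s : size A = s -> size B = s ->
  \prod_(i < s)
      (GammaQ p_pr (fracpart (A`_i - u)) / GammaQ p_pr (fracpart A`_i) *
       (GammaQ p_pr (fracpart (- B`_i + u)) / GammaQ p_pr (fracpart (- B`_i))) *
       (- p%:R) ^ (- Num.floor (fracpart A`_i - u)
                   - Num.floor (fracpart (- B`_i) + u))) =
  (\prod_(a <- A) facA a) * \prod_(b <- B) facB b.
Proof.
move=> sA sB; rewrite !(big_nth (0 : rat)) sA sB !big_mkord -big_split /=.
by apply: eq_bigr => i _; rewrite expfzDr // mulrACA.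
Qed.

Let ra k := ((j + k * e) %% q)%N.
Let fl k := ((j + k * e) %/ q)%N.

Let ra_lt k : (ra k < q)%N. Proof. by rewrite ltn_mod. Qed.

Let r01 r : (r < q)%N -> 0 <= (r%:R / q%:R : rat) < 1.
Proof. by move=> h; rewrite divr_ge0 ?ler0n //= ltr_pdivrMr ?ltr0n // mul1r ltr_nat. Qed.

Let kuE k : (k%:R / d%:R + u : rat) = (ra k)%:R / q%:R + (fl k)%:R.
Proof.
rewrite kdE uE -mulrDl -natrD addnC (divn_eq (j + k * e) q) -/(fl k) -/(ra k).
by rewrite natrD natrM mulrDl mulfK // addrC.
Qed.

Let dkE k : (k <= d)%N -> ((d%:R - k%:R) / d%:R : rat) = 1 - k%:R / d%:R.
Proof. by move=> _; rewrite mulrBl divff. Qed.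

Lemma facBE k : (k < d)%N ->
  facB ((d%:R - k%:R) / d%:R) = Gm (ra k) / Gm (k * e) * (- p%:R) ^ (- (fl k)%:Z).
Proof.
move=> kd; have ke : (k * e < q)%N by rewrite qE ltn_mul2r e_gt0.
rewrite /facB dkE ?(ltnW kd) //.
have [f1 _] : fracpart (- (1 - k%:R / d%:R)) = (k * e)%:R / q%:R /\ Num.floor (- (1 - k%:R / d%:R) : rat) = -1.
  by apply: fracpartE; [rewrite kdE opprB | exact: r01].
have [f2 _] : fracpart (- (1 - k%:R / d%:R) + u) = (ra k)%:R / q%:R /\
   Num.floor (- (1 - k%:R / d%:R) + u : rat) = (fl k)%:Z - 1.
  apply: fracpartE; last by exact: r01.
  by rewrite opprB addrAC kuE intrD addrA -pmulrn.
have [_ f3] : fracpart ((k * e)%:R / q%:R + u) = (ra k)%:R / q%:R /\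
   Num.floor ((k * e)%:R / q%:R + u : rat) = (fl k)%:Z.
  by apply: fracpartE; [rewrite -kdE kuE pmulrn | exact: r01].
by rewrite f1 f2 f3 !GammaQ_tau.
Qed.

(* The two values of [Gam] are related by reflection. The power of [p] comes from
   the floors: for [k = 0] the representative is [d/d = 1] rather than [0], and
   [j/(p-1) + k/d] may be an integer. *)
Lemma facA_facB k : (k < d)%N ->
  facA ((d%:R - k%:R) / d%:R) * facB ((d%:R - k%:R) / d%:R) =
  (-1) ^+ j * ((if k == 0%N then p%:R else 1) / (if ra k == 0%N then p%:R else 1)).
Proof.
move=> kd; rewrite facBE // /facA dkE ?(ltnW kd) //.
have ke : (k * e < q)%N by rewrite qE ltn_mul2r e_gt0.
have raE : (fl k * q + ra k = j + k * e)%N by rewrite -divn_eq.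
have g0 r := Gm_neq0 p_pr p_odd r.
have par : odd (ra k) = odd j (+) odd (k * e).
  have := congr1 odd raE; rewrite !oddD oddM q_even andbF //.
have sgn : (-1) ^+ j * (-1) ^+ (k * e) = (-1) ^+ ra k :> Qp.
  by rewrite -exprD -signr_odd oddD -par signr_odd.
have sq : (-1) ^+ (k * e) * (-1) ^+ (k * e) = 1 :> Qp by rewrite -exprMn mulrNN mulr1 expr1n.
have fl1 : (fl k <= 1)%N.
  by rewrite -ltnS /fl ltn_divLR // mul2n -addnn -addSn leq_add // ltnW.
case: (posnP k) => [k0|k_gt0].
  have rj : ra k = j by rewrite /ra k0 mul0n addn0 modn_small.
  have flk : fl k = 0%N by rewrite /fl k0 mul0n addn0 divn_small.
  have [f1 _] : fracpart (1 - k%:R / d%:R) = 0 /\ Num.floor (1 - k%:R / d%:R : rat) = 1.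
    by apply: fracpartE; rewrite ?k0 ?mul0r ?subr0 ?add0r ?lexx.
  rewrite f1 rj flk k0 mul0n mul0r subr0 sub0r /=.
  have -> : GammaQ p_pr 0 = 1 by rewrite -(mul0r (q%:R^-1)) (GammaQ_tau p_pr 0) Gm0.
  rewrite Gm0 // !divr1 oppr0 expr0z mulr1.
  case: (posnP j) => [j0|j_gt0].
    have [-> _] : fracpart (1 - u) = 0 /\ Num.floor (1 - u) = 1.
      by apply: fracpartE; rewrite ?uE ?j0 ?mul0r ?subr0 ?add0r ?lexx.
    have -> : - u = 0 by rewrite uE j0 mul0r oppr0.
    rewrite floor0 oppr0 expr0z mulr1 -(mul0r (q%:R^-1)) (GammaQ_tau p_pr 0) j0 Gm0 //.
    by rewrite expr0 !mul1r divff ?pQ_neq0.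
  have [-> _] : fracpart (1 - u) = (q - j)%:R / q%:R /\ Num.floor (1 - u) = 0.
    apply: fracpartE; last by apply: r01; rewrite ltn_subrL j_gt0.
    by rewrite uE natrB ?(ltnW j_lt) // mulrBl divff // addr0.
  have [_ ->] : fracpart (- u) = (q - j)%:R / q%:R /\ Num.floor (- u) = -1.
    apply: fracpartE; last by apply: r01; rewrite ltn_subrL j_gt0.
    by rewrite uE natrB ?(ltnW j_lt) // mulrBl divff // addrC addKr.
  rewrite GammaQ_tau opprK expr1z mulrAC mulrC [Gm (q - j) * _]mulrC.
  by rewrite divr1 Gm_reflect ?j_gt0 // mulrNN mulrC.
have ke0 : (0 < k * e)%N by rewrite muln_gt0 k_gt0.
have refl_ke := Gm_reflect p_pr p_odd (r := k * e).
have [-> _] : fracpart (1 - k%:R / d%:R) = (q - k * e)%:R / q%:R /\ Num.floor (1 - k%:R / d%:R : rat) = 0.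
  apply: fracpartE; last by apply: r01; rewrite ltn_subrL ke0.
  by rewrite kdE natrB ?(ltnW ke) // mulrBl divff // addr0.
have ek : (q - k * e)%:R / q%:R = 1 - k%:R / d%:R :> rat.
  by rewrite kdE natrB ?(ltnW ke) // mulrBl divff.
rewrite ek; have eku : 1 - k%:R / d%:R - u = 1 - (ra k)%:R / q%:R - (fl k)%:R.
  by rewrite -addrA -opprD kuE opprD addrA.
rewrite eku -ek GammaQ_tau.
case: (posnP (ra k)) => [r0|r_gt0].
  have flk : fl k = 1%N.
    move: raE; rewrite r0 addn0; case: (fl k) fl1 => [|[|]] // _.
    by rewrite mul0n => /esym/eqP; rewrite addn_eq0 [(k * e == 0)%N]eqn0Ngt ke0 andbF.
  have [-> ->] : fracpart (1 - (ra k)%:R / q%:R - (fl k)%:R) = 0 /\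
      Num.floor (1 - (ra k)%:R / q%:R - (fl k)%:R : rat) = 0.
    by apply: fracpartE; rewrite ?r0 ?flk ?mul0r ?subr0 ?subrr ?addr0 ?lexx.
  rewrite oppr0 expr0z mulr1 r0 flk -(mul0r (q%:R^-1)) (GammaQ_tau p_pr 0) Gm0 // exprN1.
  rewrite r0 expr0 in sgn.
  have -> : (-1) ^+ j = (-1) ^+ (k * e) :> Qp.
    transitivity ((-1) ^+ j * (-1) ^+ (k * e) * (-1) ^+ (k * e) : Qp).
      by rewrite -mulrA sq mulr1.
    by rewrite sgn mul1r.
  by apply: reflect_frac0 sq; [exact: g0 | exact: g0 | exact: pQ_neq0 | rewrite refl_ke ?ke0].
have [-> ->] : fracpart (1 - (ra k)%:R / q%:R - (fl k)%:R) = (q - ra k)%:R / q%:R /\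
    Num.floor (1 - (ra k)%:R / q%:R - (fl k)%:R : rat) = - (fl k)%:Z.
  apply: fracpartE; last by apply: r01; rewrite ltn_subrL r_gt0.
  by rewrite natrB ?(ltnW (ra_lt k)) // mulrBl divff // intrN -pmulrn.
rewrite GammaQ_tau opprK -invr_expz divr1 mulr1.
have -> : (-1) ^+ j = (-1) ^+ ra k * (-1) ^+ (k * e) :> Qp by rewrite -sgn -mulrA sq mulr1.
apply: reflect_frac sq; [exact: g0 | exact: g0 | exact: expfz_neq0 | | by rewrite refl_ke ?ke0].
by rewrite Gm_reflect // r_gt0 ra_lt.
Qed.


(** The parameter for [k = 0] is [d/d = 1], while the numbers [h/n] start at [0]; a factor depends
    on its parameter only modulo 1. *)
Lemma facA1 : facA 1 = facA 0.
Proof.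
rewrite /facA.
have [-> _] : fracpart (1 : rat) = 0 /\ Num.floor (1 : rat) = 1.
  by apply: fracpartE; rewrite ?add0r ?lexx.
have [-> _] : fracpart (0 : rat) = 0 /\ Num.floor (0 : rat) = 0.
  by apply: fracpartE; rewrite ?add0r ?lexx.
suff -> : fracpart (1 - u) = fracpart (0 - u) by [].
have [r r1 er] : exists2 r : rat, 0 <= r < 1 & 0 - u = r + (-1)%:~R \/ 0 - u = r + 0%:~R.
  case: (posnP j) => [j0|j_gt0].
    by exists 0; rewrite ?lexx //; right; rewrite uE j0 mul0r subr0.
  exists ((q - j)%:R / q%:R); first by apply: r01; rewrite ltn_subrL j_gt0.
  by left; rewrite sub0r uE natrB ?(ltnW j_lt) // mulrBl divff // addrC addKr.
have e1u : 1 - u = (0 - u) + 1 by rewrite sub0r addrC.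
case: er => er; have [-> _] := fracpartE er r1.
  by have [] := @fracpartE (1 - u) r 0; rewrite // e1u er -addrA.
by have [] := @fracpartE (1 - u) r 1; rewrite // e1u er addr0.
Qed.

Let fb := ((q - j) * n %/ q)%N.
Let b := ((q - j) * n %% q)%N.

Let b_lt : (b < q)%N. Proof. by rewrite ltn_mod. Qed.

(** From [(q - j) n = fb q + b] one gets [h/n - j/q = (h + fb + b/q)/n - 1]; dividing [h + fb] by
    [n] separates the integer part. *)
Lemma facA_nat h : (h < n)%N -> facA (h%:R / n%:R) =
  tofrac (Gam ((tau p_pr b + ((h + fb) %% n)%:R) / n%:R)) / tofrac (Gam (h%:R / n%:R)) *
  (- p%:R) ^ (1 - ((h + fb) %/ n)%:Z).
Proof.
move=> hn; rewrite /facA.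
have [-> _] : fracpart (h%:R / n%:R : rat) = h%:R / n%:R /\ Num.floor (h%:R / n%:R : rat) = 0.
  apply: fracpartE; rewrite ?addr0 // divr_ge0 ?ler0n //=.
  by rewrite ltr_pdivrMr ?ltr0n // mul1r ltr_nat.
set h' := ((h + fb) %% n)%N; set fh := ((h + fb) %/ n)%N.
pose r : rat := (h' * q + b)%:R / (n * q)%:R.
have bE : ((q - j) * n = fb * q + b)%N by rewrite -divn_eq.
have hE : (h + fb = fh * n + h')%N by rewrite -divn_eq.
have er : h%:R / n%:R - u = r + (fh%:Z - 1)%:~R.
  rewrite intrD -pmulrn uE /r.
  have e1 : (h * q + (q - j) * n = h' * q + b + fh * (n * q))%N by rewrite bE addnA -mulnDl hE; ring.
  have -> : (h' * q + b)%:R = h%:R * q%:R + (q%:R - j%:R) * n%:R - fh%:R * (n%:R * q%:R) :> rat.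
    by rewrite -natrB ?(ltnW j_lt) // -!natrM -natrD e1 [in RHS]natrD addrK.
  by rewrite natrM; field; rewrite n0 q0.
have rr : 0 <= r < 1.
  rewrite /r divr_ge0 ?ler0n //= ltr_pdivrMr ?ltr0n ?muln_gt0 ?n_gt0 // mul1r ltr_nat.
  apply: (@leq_trans (h'.+1 * q)); last by rewrite leq_mul2r ltn_mod n_gt0 orbT.
  by rewrite mulSn addnC ltn_add2r.
have [-> ->] := fracpartE er rr.
rewrite opprB /GammaQ !ratr_frac //; last first.
  by rewrite Euclid_dvdM // negb_or pn p1_ndvd.
congr (tofrac (Gam _) / _ * _).
have nU := nat_unit p_pr pn; have qU := p1_unit p_pr.
have nqU : ((n * q)%:R : Zp) \is a GRing.unit by rewrite natrM unitrM nU qU.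
apply: (mulIr nqU); rewrite divrK // natrM mulrA divrK // mulrDl /tau divrK // natrD natrM.
by rewrite addrC.
Qed.

(** [h |-> h + fb] permutes the residues modulo [n], so the multiplication formula applies at
    [b/(p-1)]; the floors add up by [sum_divn_shift]. *)
Lemma prod_facA_nat : \prod_(0 <= h < n) facA (h%:R / n%:R) =
  Gm b * tofrac (w_ n%:R) ^+ b * (- p%:R) ^ (n%:Z - fb%:Z).
Proof.
have nF : n%:R != 0 :> 'F_p by rewrite -(dvdn_pcharf (pchar_Fp p_pr)).
pose N := \prod_(0 <= h < n) tofrac (Gam ((tau p_pr b + h%:R) / n%:R)) : Qp.
pose M := \prod_(0 <= h < n) tofrac (Gam (h%:R / n%:R)) : Qp.
have M0 : M != 0.
  by rewrite prodf_seq_neq0; apply/allP => h _; rewrite /= tofrac_eq0 Gam_neq0.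
have NM : tofrac (w_ n%:R) ^+ (q - b) * N = M * Gm b.
  rewrite /N /M -!rmorph_prod -tofracXn -!tofracM !big_mkord.
  by rewrite Gam_mult // ltnW.
have wq : tofrac (w_ n%:R) ^+ b * tofrac (w_ n%:R) ^+ (q - b) = 1 :> Qp.
  by rewrite -exprD subnKC ?(ltnW b_lt) // -tofracXn teich_expp1 // tofrac1.
rewrite (eq_big_nat _ _ (fun h H => facA_nat (proj2 (andP H)))) /= 2!big_split /=.
have -> : \prod_(0 <= h < n) tofrac (Gam ((tau p_pr b + ((h + fb) %% n)%:R) / n%:R)) = N.
  rewrite /N !big_mkord.
  have inj : injective (fun h : 'I_n => Ordinal (ltn_pmod (h + fb) n_gt0)).
    move=> h h' /(congr1 val) /= /eqP; rewrite eqn_modDr => /eqP.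
    by rewrite !modn_small // => /val_inj.
  by rewrite [RHS](reindex_inj inj).
rewrite prodfV -/M; congr (_ * _).
  apply: (mulfI M0); rewrite mulrCA divff // mulr1 mulrA -NM mulrAC.
  by rewrite [X in X * N]mulrC wq mul1r.
rewrite -(big_morph (fun z : int => (- p%:R : Qp) ^ z) (fun x y => expfzDr x y Np0) (expr0z _)).
congr (_ ^ _); rewrite sumrB sumr_const_nat subn0 natz.
have -> : \sum_(0 <= h < n) ((h + fb) %/ n)%:Z = (\sum_(0 <= h < n) (h + fb) %/ n)%N%:Z.
  by rewrite (big_morph Posz PoszD (erefl _)).
by rewrite sum_divn_shift.
Qed.

Section Lists.
Variable w : {ffun 'I_n -> 'I_d}.
Local Notation Sc := (~: Sset w).

(** Modulo 1 the numbers [(d - k)/d] are the [h/n] with [n/d] dividing [h], so the parameters for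
    [k] outside [Sset w] complete [Alist w] to all [h/n]. *)
Lemma prod_facA_list : (\prod_(a <- Alist w) facA a) *
  \prod_(k in Sc) facA ((d%:R - k%:R) / d%:R) = \prod_(0 <= h < n) facA (h%:R / n%:R).
Proof.
rewrite /Alist big_cat big_map big_enum big_map big_filter /= mulrAC.
have -> : (\prod_(k in Sset w) facA ((d%:R - k%:R) / d%:R)) *
    \prod_(k in Sc) facA ((d%:R - k%:R) / d%:R) = \prod_(k < d) facA ((d%:R - k%:R) / d%:R).
  by rewrite [RHS](bigID (mem (Sset w))) /=; congr (_ * _); apply: eq_bigl => k; rewrite inE.
have -> : \prod_(k < d) facA ((d%:R - k%:R) / d%:R) = \prod_(0 <= h < n | (m %| h)%N) facA (h%:R / n%:R).
  rewrite [in RHS]nE big_multiples // -(big_mkord predT (fun k => facA ((d%:R - k%:R) / d%:R))).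
  have hk k : facA ((k * m)%:R / (d * m)%:R) = facA (k%:R / d%:R).
    by congr facA; rewrite !natrM; field; rewrite d0 m0.
  rewrite (eq_bigr _ (fun k _ => hk k)) big_nat_rev /= add0n.
  transitivity (\prod_(0 <= k < d) facA (k.+1%:R / d%:R)).
    apply: eq_big_nat => k /andP[_ kd]; rewrite natrB // opprD opprK addrA subrr add0r //.
  case: (d) d_gt0 d0 => // d' _ dn0.
  rewrite big_nat_recr // [RHS]big_nat_recl //= mulrC; congr (_ * _).
  by rewrite divff // mul0r facA1.
by rewrite mulrC [RHS](bigID (fun h => m %| h)%N) /= mulrC /index_iota subn0.
Qed.

(** The same parameters restore the copy that [Blist w] omits for each occurring [k], which leaves
    one factor per coordinate of [w]. *)
Lemma prod_facB_list : (\prod_(x <- Blist w) facB x) *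
  \prod_(k in Sc) facB ((d%:R - k%:R) / d%:R) = \prod_i facB ((d%:R - (w i)%:R) / d%:R).
Proof.
rewrite /Blist big_flatten big_map big_enum /= -big_split /=.
rewrite [RHS](partition_big (fun i => w i) (fun k => k \in Sc)) /=; last first.
  move=> i _; rewrite !inE /nocc; apply/negP => /eqP/cards0_eq /setP /(_ i).
  by rewrite !inE eqxx.
apply: eq_bigr => k; rewrite !inE => hk.
rewrite big_nseq (eq_bigr (fun=> facB ((d%:R - k%:R) / d%:R))) => [|i /eqP -> //].
rewrite prodr_const; have -> : #|[pred i | w i == k]| = nocc w k by rewrite /nocc cardsE.
by rewrite iter_mulr_1 -exprSr prednK // lt0n.
Qed.

Lemma sum_nocc : (\sum_(k in Sc) (nocc w k).-1 + #|Sc| = n)%N.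
Proof.
rewrite -sum1_card -big_split /= -[RHS](card_ord n) -sum1_card.
rewrite [RHS](partition_big (fun i => w i) (fun k => k \in Sc)) /=; last first.
  move=> i _; rewrite !inE /nocc; apply/negP => /eqP/cards0_eq /setP /(_ i).
  by rewrite !inE eqxx.
apply: eq_bigr => k; rewrite !inE => hk; rewrite sum1_card addn1 prednK ?lt0n //.
by rewrite /nocc cardsE.
Qed.

Lemma size_Blist : size (Blist w) = sdim w.
Proof.
rewrite /Blist size_flatten /shape -map_comp sumnE big_map big_enum /=.
rewrite (eq_bigr (fun k => (nocc w k).-1)) => [|k _]; last by rewrite /= size_nseq.
by rewrite /sdim -[X in _ = (X - _)%N]sum_nocc addnK.
Qed.

Lemma size_Alist : size (Alist w) = sdim w.
Proof.
rewrite /Alist size_cat !size_map -cardE size_filter -sum1_count.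
have e1 : (\sum_(0 <= h < n | ~~ (m %| h)) 1 + d = n)%N.
  rewrite -[X in (_ + X = _)%N](subn0 d) -[X in (_ + X = _)%N]muln1 -sum_nat_const_nat.
  rewrite -(@big_multiples _ _ _ d m (fun=> 1%N)) // -nE addnC.
  rewrite -[RHS](subn0 n) -[RHS]muln1 -sum_nat_const_nat.
  by rewrite [RHS](bigID (fun h => m %| h)%N).
have e2 : (#|Sset w| + #|Sc| = d)%N by rewrite cardsC card_ord.
have e3 : (#|Sc| <= n)%N by rewrite -[X in (_ <= X)%N]sum_nocc leq_addl.
rewrite /sdim; move: e1; rewrite /index_iota subn0 -/m; set c := (\sum_(_ <- _ | _) _)%N => e1.
by apply/eqP; rewrite -(eqn_add2r #|Sc|) subnK // addnAC e2 addnC e1.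
Qed.

Definition hits_zero := [exists i, ((j + w i * e) %% q == 0)%N].

Lemma mem_Sc i : w i \in Sc.
Proof.
rewrite !inE /nocc; apply/negP => /eqP/cards0_eq /setP /(_ i).
by rewrite !inE eqxx.
Qed.

Lemma Sc_mem k : k \in Sc -> exists i, w i = k.
Proof.
by rewrite !inE /nocc cards_eq0 => /set0Pn [i]; rewrite inE => /eqP <-; exists i.
Qed.

Lemma ra_inj (k k' : 'I_d) : ra k = ra k' -> k = k'.
Proof.
move=> /eqP; rewrite /ra eqn_modDl !modn_small ?[in X in (_ < X)%N]qE ?ltn_mul2r ?e_gt0 //=.
by rewrite eqn_pmul2r // => /eqP /val_inj.
Qed.

(** By reflection the completing factors cancel up to signs and powers of [p]. A zero coordinate
    puts [0] among the values of [w], which gives a factor [p]; by [ra_inj] at most one value [k]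
    has [ra k = 0], and it removes that factor again. *)
Lemma prod_Sc : (exists i, w i = 0%N :> nat) ->
  (\prod_(k in Sc) facA ((d%:R - k%:R) / d%:R)) * \prod_(k in Sc) facB ((d%:R - k%:R) / d%:R) =
  (-1) ^+ (j * #|Sc|) * (if hits_zero then 1 else p%:R).
Proof.
move=> [i0 wi0]; rewrite -big_split /= (eq_bigr _ (fun k _ => facA_facB (ltn_ord k))).
rewrite big_split /= prodr_const -exprM; congr (_ * _).
rewrite big_split /= prodfV.
have -> : \prod_(k in Sc) (if k == 0%N :> nat then p%:R else 1) = p%:R :> Qp.
  rewrite (bigD1 (w i0)) ?mem_Sc //= wi0 eqxx big1 ?mulr1 // => k /andP[_ kw].
  by rewrite -wi0 (inj_eq val_inj) (negPf kw).
have -> : \prod_(k in Sc) (if ra k == 0%N :> nat then p%:R else 1) = (if hits_zero then p%:R else 1) :> Qp.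
  case: (boolP hits_zero) => [/existsP [i hi]|/existsPn h].
    rewrite (bigD1 (w i)) ?mem_Sc //= -/(ra (w i)) in hi *; rewrite hi big1 ?mulr1 // => k /andP[_ kw].
    case: eqP => // rk; case/eqP: kw; apply: ra_inj; by rewrite rk (eqP hi).
  rewrite big1 // => k /Sc_mem [i <-]; by rewrite (negPf (h i)).
by case: hits_zero; rewrite ?divr1 // divff // pQ_neq0.
Qed.

Variables (lambda : 'F_p) (lambda0 : lambda != 0).
Let c := - (n%:R * lambda).

Lemma teichN1 : w_ (-1) = -1.
Proof.
have /eqP : w_ (-1) ^+ 2 = 1 by rewrite -teichX sqrrN expr1n teich1.
rewrite sqrf_eq1 => /orP[/eqP h|/eqP //].
move: h; rewrite -[in RHS](teich1 p_pr) => /teich_inj /eqP; rewrite eq_sym -addr_eq0.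
rewrite -(natrD _ 1 1) -(dvdn_pcharf (pchar_Fp p_pr)) => h.
by have := odd_prime_ndvd2 p_pr p_odd; rewrite h.
Qed.

(** [b = - j n] modulo [p - 1] accounts for the power of [lambda]. As [p - 1] is even,
    [(-1)^(j n) = (-1)^b], which supplies the sign in [c = - n lambda]. *)
Lemma character_factor : (-1) ^+ (j * n) * omega_bar_exp p_pr j (lambda ^+ n) *
  tofrac (w_ n%:R) ^+ b = tofrac (w_ c) ^+ b.
Proof.
rewrite /omega_bar_exp expf_eq0 (negPf lambda0) andbF.
have lU : w_ lambda \is a GRing.unit by exact: teich_unit.
have bE : ((q - j) * n = fb * q + b)%N by rewrite -divn_eq.
have wl : w_ lambda ^+ b = (w_ (lambda ^+ n))^-1 ^+ j.
  have := teich_exp_mod p_pr ((q - j) * n) lambda0; rewrite -/b => ->.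
  apply: (mulIr (unitrX (j * n) lU)); rewrite -exprD -mulnDl subnK ?(ltnW j_lt) //.
  rewrite exprM teich_expp1 // expr1n teichX exprVn -exprM [(n * j)%N]mulnC mulVr //.
  exact: unitrX.
have sgn : (-1) ^+ (j * n) = (-1) ^+ b :> Qp.
  rewrite -signr_odd -[RHS]signr_odd; congr (_ ^+ nat_of_bool _).
  have := congr1 odd bE; rewrite oddD !oddM q_even andbF /= => <-.
  by rewrite oddB ?(ltnW j_lt) // q_even.
have -> : w_ c = - (w_ n%:R * w_ lambda) by rewrite /c -mulN1r !teichM teichN1 mulN1r.
rewrite sgn tofracN tofracM [in RHS]exprNn exprMn -(tofracXn b (w_ lambda)) wl -mulrA.
by congr (_ * _); rewrite mulrC.
Qed.

Lemma hits_zero_b : hits_zero -> b = 0%N.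
Proof.
move=> /existsP[i hi]; have h : (q %| (j + w i * e) * n)%N by rewrite dvdn_mulr.
have qne x : (q %| x * e * n)%N.
  rewrite [in X in (X %| _)%N]qE nE.
  by have -> : (x * e * (d * m) = x * m * (d * e))%N; [ring | exact: dvdn_mull].
rewrite mulnDl dvdn_addl // in h.
apply/eqP; rewrite -/(dvdn _ _) mulnBl dvdn_sub // dvdn_mulr //.
Qed.

Lemma summand_identity E :
  (exists i, w i = 0%N :> nat) ->
  (E + \sum_i (j + w i * e) %/ q + (q - j) * n %/ q = n + (\sum_i w i) %/ d)%N ->
  (- p%:R) ^+ E * (\prod_i Gm ((j + w i * e) %% q)) *
    (if hits_zero then p%:R else Gm ((q - j) * n %% q) * tofrac (w_ c) ^+ ((q - j) * n %% q)) =
  p%:R * ((- p%:R) ^+ ((\sum_i w i) %/ d) * (\prod_i GammaQ p_pr ((w i)%:R / d%:R)) *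
   ((-1) ^+ (j * sdim w) * omega_bar_exp p_pr j (lambda ^+ n) *
    \prod_(i < sdim w)
      (GammaQ p_pr (fracpart ((Alist w)`_i - u)) / GammaQ p_pr (fracpart (Alist w)`_i) *
       (GammaQ p_pr (fracpart (- (Blist w)`_i + u)) / GammaQ p_pr (fracpart (- (Blist w)`_i))) *
       (- p%:R) ^ (- Num.floor (fracpart (Alist w)`_i - u)
                   - Num.floor (fracpart (- (Blist w)`_i) + u))))).
Proof.
move=> w0 hE; rewrite padic_summandE ?size_Alist ?size_Blist //.
have gQ i : GammaQ p_pr ((w i)%:R / d%:R) = Gm (w i * e) by rewrite kdE GammaQ_tau.
rewrite (eq_bigr _ (fun i _ => gQ i)) -/b.
set PA := \prod_(a <- Alist w) facA a; set PB := \prod_(x <- Blist w) facB x.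
(* Multiplication by the completing factors turns the two lists into products over all [h < n] and
   over all coordinates of [w]. *)
have key : PA * PB * ((-1) ^+ (j * #|Sc|) * (if hits_zero then 1 else p%:R)) =
   Gm b * tofrac (w_ n%:R) ^+ b * (- p%:R) ^ (n%:Z - fb%:Z) *
    ((\prod_i Gm (ra (w i))) / (\prod_i Gm (w i * e)) * (- p%:R) ^ (- (\sum_i fl (w i))%N%:Z)).
  rewrite -prod_Sc // mulrACA /PA /PB prod_facA_list prod_facB_list prod_facA_nat; congr (_ * _).
  rewrite (eq_bigr _ (fun i _ => facBE (ltn_ord (w i)))) 2!big_split /= prodfV; congr (_ * _).
  rewrite -(big_morph (fun z : int => (- p%:R : Qp) ^ z) (fun x y => expfzDr x y Np0) (expr0z _)).
  by rewrite sumrN (big_morph Posz PoszD (erefl _)).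
apply: (summand_frac _ _ _ key).
- by apply/prodf_neq0 => i _; exact: Gm_neq0.
- by rewrite signr_eq0.
- by case: ifP => _; [exact: oner_neq0 | exact: pQ_neq0].
- rewrite !exprnP -!expfzDr //; congr (_ ^ _).
  have hE' : (E + (\sum_i fl (w i)) + fb = n + (\sum_i w i) %/ d)%N := hE.
  have := congr1 Posz hE'; rewrite !PoszD; clear.
  move: (\sum_i fl (w i))%N ((\sum_i w i) %/ d)%N => x y h.
  by rewrite -(addrK (x%:Z + fb%:Z) E%:Z) addrA h; ring.
- case: ifP => [hz|_]; last by rewrite mulrC.
  by rewrite hits_zero_b // expr0 !mulr1 Gm0 ?mulr1.
rewrite -character_factor !mulrA -exprD; congr (_ * _ * _).
rewrite -signr_odd -[RHS]signr_odd; congr (_ ^+ nat_of_bool _).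
have e3 : (#|Sc| <= n)%N by rewrite -[X in (_ <= X)%N]sum_nocc leq_addl.
by rewrite /sdim oddD !oddM oddB //; case: (odd j); case: (odd n); case: (odd _).
Qed.

End Lists.

End SummandIdentity.

(** The unreduced exponents add up to [q (n + (sum of w_i)/d)]. So the reduced ones add up to some
    [q E], and the power of [pi] in a product of Fourier coefficients is [(- p)^E]; the quotients by
    [q] are the floors in the hypergeometric exponents. *)
Lemma exponent_balance (q n d j : nat) (w : {ffun 'I_n -> 'I_d}) (e := (q %/ d)%N) :
  d = gcdn q n -> (j < q)%N -> (d %| \sum_i w i)%N ->
  exists2 E, (E + \sum_i (j + w i * e) %/ q + (q - j) * n %/ q = n + (\sum_i w i) %/ d)%N
    & (\sum_i (j + w i * e) %% q + (q - j) * n %% q = q * E)%N.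
Proof.
move=> d_def j_lt dW; have q_gt0 : (0 < q)%N by apply: leq_ltn_trans j_lt.
set S := (\sum_i (j + w i * e) %/ q)%N; set T := ((q - j) * n %/ q)%N.
set Sm := (\sum_i (j + w i * e) %% q)%N; set Tm := ((q - j) * n %% q)%N.
have eS : (\sum_i (j + w i * e) = S * q + Sm)%N.
  by rewrite /S /Sm big_distrl -big_split /=; apply: eq_bigr => i _; exact: divn_eq.
have eT : ((q - j) * n = T * q + Tm)%N by exact: divn_eq.
have eQ : (e * d = q)%N by rewrite /e divnK // d_def dvdn_gcdl.
have tot : (\sum_i (j + w i * e) + (q - j) * n = q * (n + (\sum_i w i) %/ d))%N.
  rewrite big_split /= sum_nat_const card_ord -big_distrl /= -[in LHS](divnK dW).
  rewrite -mulnA [(d * e)%N]mulnC eQ mulnDr mulnBl [(n * j)%N]mulnC.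
  have : (j * n <= q * n)%N by rewrite leq_mul2r ltnW ?orbT.
  rewrite [(_ %/ d * q)%N]mulnC; lia.
have key : (q * (S + T) + (Sm + Tm) = q * (n + (\sum_i w i) %/ d))%N.
  by rewrite -tot eS eT; ring.
have le : (S + T <= n + (\sum_i w i) %/ d)%N by rewrite -(leq_pmul2l q_gt0) -key leq_addr.
exists (n + (\sum_i w i) %/ d - (S + T))%N; first by rewrite -addnA subnK.
by rewrite mulnBr -key addKn.
Qed.

(** * Products of Fourier coefficients as elements of [Q_p] *)

Section FourierTerm.
Variables (p : nat) (p_pr : prime p) (p_odd : odd p).
Local Notation Qp := (padic_num p_pr).
Local Notation Gm := (@Gm p p_pr).
Local Notation q := (p.-1).
Variables (K : comNzRingType) (iota : {rmorphism Qp -> K}) (pi : K).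
Hypothesis pi_exp : pi ^+ q = - p%:R.
Variables (n : nat) (n_gt0 : (0 < n)%N).
Variables (d : nat) (d_def : d = gcdn q n).
Variables (j : nat) (j_lt : (j < q)%N) (w : {ffun 'I_n -> 'I_d}).
Let e := (q %/ d)%N.

Lemma gcoefE r : q%:R * gcoef iota pi r = - (pi ^+ r * iota (Gm r)).
Proof.
rewrite /gcoef one_subp // mulrCA -(rmorph_nat iota) -rmorphM -mulrN -rmorphN.
congr (_ * iota _); rewrite invrN mulrN mulrN mulrCA mulfV ?mulr1 //.
by rewrite Qp_nat_eq0 -lt0n -subn1 subn_gt0 prime_gt1.
Qed.

Lemma fourier_term (c : 'F_p) E :
  (\sum_i (j + w i * e) %% q + (q - j) * n %% q = q * E)%N ->
  q%:R ^+ n.+1 * ((\prod_i gcoef iota pi ((j + w i * e) %% q)) *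
     (gcoef iota pi ((q - j) * n %% q) * wK iota c ^+ ((q - j) * n %% q) - (hits_zero p j w)%:R)) =
  iota ((-1) ^+ n.+1 * ((- p%:R) ^+ E * (\prod_i Gm ((j + w i * e) %% q)) *
    (if hits_zero p j w then p%:R else
      Gm ((q - j) * n %% q) * tofrac (teichmuller p_pr c) ^+ ((q - j) * n %% q)))).
Proof.
move=> hE.
have eP : pi ^+ (\sum_i (j + w i * e) %% q) * pi ^+ ((q - j) * n %% q) = iota ((- p%:R) ^+ E).
  by rewrite -exprD hE exprM pi_exp rmorphXn rmorphN rmorph_nat.
have -> : q%:R ^+ n.+1 * ((\prod_i gcoef iota pi ((j + w i * e) %% q)) *
     (gcoef iota pi ((q - j) * n %% q) * wK iota c ^+ ((q - j) * n %% q) - (hits_zero p j w)%:R)) =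
  (\prod_i (q%:R * gcoef iota pi ((j + w i * e) %% q))) *
  (q%:R * gcoef iota pi ((q - j) * n %% q) * wK iota c ^+ ((q - j) * n %% q) - q%:R * (hits_zero p j w)%:R).
  by rewrite [in RHS]big_split /= prodr_const card_ord exprSr; ring.
rewrite gcoefE (eq_bigr _ (fun i _ => gcoefE _)).
rewrite (eq_bigr (fun i => -1 * (pi ^+ ((j + w i * e) %% q) * iota (Gm ((j + w i * e) %% q))))); last first.
  by move=> i _; rewrite mulN1r.
rewrite big_split /= prodr_const card_ord big_split /= prodrXr -rmorph_prod /=.
move: eP; set P1 := pi ^+ _; set P2 := pi ^+ _; set M := \prod_i _; set r := ((q - j) * n %% q)%N.
move=> eP.
have -> : (- (P2 * iota (Gm r)) * wK iota c ^+ r - q%:R * (hits_zero p j w)%:R) =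
  - (P2 * iota (if hits_zero p j w then p%:R else Gm r * tofrac (teichmuller p_pr c) ^+ r)).
  (* If some exponent is zero, so is the last one, and the corrected coefficient is
     [- 1 - (p - 1) = - p]. *)
  case: (boolP (hits_zero p j w)) => [hz|_].
    rewrite /P2 /r (hits_zero_b d_def hz) !expr0 Gm0 // rmorph1 rmorph_nat !mul1r mulr1.
    by rewrite -opprD [(true : nat)%:R]mulr1n mulr1 -(natrD _ 1) add1n prednK // prime_gt0.
  by rewrite mulr0 subr0 rmorphM rmorphXn /wK mulNr mulrA.
rewrite exprSr !(rmorphM iota) -eP rmorphXn !rmorphN rmorph1.
by move: (iota M) (iota (if _ then _ else _)) => x y; ring.
Qed.
End FourierTerm.

Lemma point_count_frac (F : fieldType) (P Q N A s X : F) : P != 0 -> Q != 0 ->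
  P * (N * Q + 1) = P * A + - s * (P * X) -> N = (A - 1) / Q + s * (-1 / Q * X).
Proof.
move=> P0 Q0 e; apply: (mulIf Q0); apply: (addIr 1); apply: (mulfI P0).
by rewrite e; field.
Qed.

Theorem theorem2p2 (p : nat) (p_pr : prime p) (p_odd : odd p)
    (n : nat) (n_gt0 : (0 < n)%N) (p_ndvd_n : ~~ (p %| n)%N)
    (lambda : 'F_p) (lambda_neq0 : lambda != 0)
    (d : nat) (d_def : d = gcdn p.-1 n)
    (repr : {set {ffun 'I_n -> 'I_d}} -> {ffun 'I_n -> 'I_d})
    (reprP : forall C, C \in Wclasses n d ->
       repr C \in C /\ exists i, repr C i = 0%N :> nat) :
  #|dwork_points n lambda|%:R =
    (p%:R ^+ n.-1 - 1) / (p%:R - 1) +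
    (-1) ^+ n *
    \sum_(C in Wclasses n d)
      let w := repr C in
      (- p%:R) ^+ ((\sum_i w i) %/ d)%N *
      \prod_i GammaQ p_pr ((w i)%:R / d%:R) *
      padicG p_pr (sdim w) (Alist w) (Blist w) (lambda ^+ n)
    :> padic_num p_pr.
Proof.
have [K [iota [pi [iota_inj pi_exp piideal_sep]]]] := ramified_extension p_pr p_odd.
have q_gt0 : (0 < p.-1)%N by have := prime_gt1 p_pr; lia.
have nl : n%:R * lambda != 0 by rewrite mulf_neq0 // -(dvdn_pcharf (pchar_Fp p_pr)).
have W_orth m : \sum_(x : 'F_p | x != 0) wK iota x ^+ m = if (p.-1 %| m)%N then (p.-1)%:R else 0.
  transitivity (iota (tofrac (\sum_(x : 'F_p | x != 0) teichmuller p_pr x ^+ m))).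
    by rewrite !rmorph_sum /=; apply: eq_bigr => x _; rewrite /wK tofracXn rmorphXn.
  by rewrite teich_orthogonal; case: ifP => _; rewrite ?tofrac_nat ?rmorph_nat ?tofrac0 ?rmorph0.
have W1 : wK iota (1 : 'F_p) = 1 by rewrite /wK teich1 tofrac1 rmorph1.
have PsiE (x : 'F_p) : x != 0 -> addchar iota pi x = \sum_(a < p.-1) gcoef iota pi a * wK iota x ^+ a.
  by rewrite /addchar => /negPf ->.
have G0 : (p.-1)%:R * gcoef iota pi 0 = -1.
  by rewrite gcoefE expr0 Gm0 // rmorph1 mul1r.
have := affine_count q_gt0 (wKM iota) W1 W_orth (addchar0 iota pi)
  (addcharD p_odd pi_exp piideal_sep) PsiE G0 n_gt0 nl.
rewrite (sum_exp_pair q_gt0 n_gt0 d_def (fun C hC => proj1 (reprP C hC))).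
rewrite (projective_count n_gt0) card_Fp //.
set c := - (n%:R * lambda); set N := #|dwork_points n lambda|.
pose S (w : {ffun 'I_n -> 'I_d}) j : padic_num p_pr := (-1) ^+ (j * sdim w) * omega_bar_exp p_pr j (lambda ^+ n) *
    \prod_(i < sdim w)
      (GammaQ p_pr (fracpart ((Alist w)`_i - j%:R / (p%:R - 1))) / GammaQ p_pr (fracpart (Alist w)`_i) *
       (GammaQ p_pr (fracpart (- (Blist w)`_i + j%:R / (p%:R - 1))) / GammaQ p_pr (fracpart (- (Blist w)`_i))) *
       (- p%:R) ^ (- Num.floor (fracpart (Alist w)`_i - j%:R / (p%:R - 1))
                   - Num.floor (fracpart (- (Blist w)`_i) + j%:R / (p%:R - 1)))).
pose T (w : {ffun 'I_n -> 'I_d}) : padic_num p_pr := (- p%:R) ^+ ((\sum_i w i) %/ d)%N * \prod_i GammaQ p_pr ((w i)%:R / d%:R).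
rewrite mulr_sumr (eq_bigr (fun C => iota ((-1) ^+ n.+1 * (p%:R * (T (repr C) * \sum_(j < p.-1) S (repr C) j))))); last first.
  move=> C hC; have [hr hz] := reprP C hC; set w := repr C in hr hz *.
  have dW : (d %| \sum_i w i)%N.
    by have := Wclass_sub q_gt0 d_def hC hr; rewrite inE.
  rewrite !mulr_sumr rmorph_sum /=; apply: eq_bigr => j _.
  have [E hE hq] := exponent_balance d_def (ltn_ord j) dW.
  have sid := summand_identity p_pr p_odd n_gt0 p_ndvd_n d_def (ltn_ord j) lambda_neq0 hz hE.
  rewrite -/(T w) -/(S w j) in sid; rewrite -sid -(fourier_term p_odd iota pi_exp d_def c hq).
  congr (_ * (_ * (_ - _))).
    by apply: eq_bigr => i _; rewrite ffunE.
  congr (_%:R); congr (nat_of_bool _).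
  by apply: eq_existsb => i; rewrite ffunE.
(* Both sides now lie in the image of [iota], and its injectivity brings the identity back to
   [Q_p]. *)
rewrite -rmorph_sum -natrX -natrM -(rmorph_nat iota) -[X in _ = X + _](rmorph_nat iota) -rmorphD => /iota_inj.
rewrite natrM natrX natrD natrM -mulr_sumr -mulr_sumr exprS mulN1r => main.
have Q0 : (p.-1)%:R != 0 :> padic_num p_pr by rewrite Qp_nat_eq0 -lt0n.
have -> : \sum_(C in Wclasses n d)
      (let w := repr C in
      (- p%:R) ^+ ((\sum_i w i) %/ d)%N *
      \prod_i GammaQ p_pr ((w i)%:R / d%:R) *
      padicG p_pr (sdim w) (Alist w) (Blist w) (lambda ^+ n)) =
   -1 / (p%:R - 1) * \sum_(C in Wclasses n d) T (repr C) * \sum_(j < p.-1) S (repr C) j.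
  rewrite mulr_sumr; apply: eq_bigr => C _.
  by rewrite /= -/(T (repr C)) /padicG big_mkord mulrCA.
rewrite natr_pred ?prime_gt0 //.
apply: (point_count_frac (pQ_neq0 p_pr) Q0).
by rewrite -exprS prednK.
Qed.
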